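(* Let $F_n$ be the empirical cdf of $U_1,\dots,U_n$ i.i.d. uniform on $(0,1)$, and let $U(\cdot)$ be a standard Brownian bridge on $[0,1]$. Let $0<a<b<1$ and $\eta>0$. (i) $$\mathbb P\Bigl(\sup_{t\in[a,b]}\frac{U(t)}{\sqrt{t(1-t)}}>\eta\Bigr)\le\frac{\frac2\eta+\eta\log\frac{b(1-a)}{a(1-b)}}{\sqrt{2\pi}}\,e^{-\eta^2/2}.$$ (ii) $$\mathbb P\Bigl(\sup_{t\in[a,b]}n\Bigl(F_n(t)\log\frac{F_n(t)}{t}+(1-F_n(t))\log\frac{1-F_n(t)}{1-t}\Bigr)>\eta\Bigr)\le 2e\Bigl(\eta\log\frac{b(1-a)}{a(1-b)}+1\Bigr)\exp(-\eta).$$ (iii) For every $K>1$, $$\mathbb P_{H_0}(BJ_n>\eta)\le 22K(\log n)(\eta+1)\exp(-\eta)+2n^{1-K}.$$ (iv) For every $D>2$ there is a constant $C$ depending only on $D$ such that for $\eta\ge\sqrt{D\log\log n}$, $$\mathbb P_{H_0}(HC_n>\eta)\le\mathbb P\Bigl(\sup_{t\in(0,1)}\sqrt n\,\frac{F_n(t)-t}{\sqrt{t(1-t)}}>\eta\Bigr)\le\frac C\eta.$$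
   Context: $\log$ is the natural logarithm, with the convention $0\log 0=0$. For p-values $p_1,\dots,p_n$ with increasing order statistics $p_{(1)}\le\dots\le p_{(n)}$, $$HC_n=\max_{1\le i\le n/2}\sqrt n\,\frac{\frac in-p_{(i)}}{\sqrt{p_{(i)}(1-p_{(i)})}},\qquad BJ_n=\max_{1\le i\le n/2}\Bigl(i\log\frac{i}{np_{(i)}}+(n-i)\log\frac{1-\frac in}{1-p_{(i)}}\Bigr)\mathbf 1\Bigl(p_{(i)}<\frac in\Bigr).$$ $\mathbb P_{H_0}$ denotes the null distribution, under which the p-values $p_i=U_i$ are i.i.d. uniform on $(0,1)$. In (iv), $n\ge3$ so that $\log\log n>0$. *)

(* Defs.v *)
From HB Require Import structures.
From mathcomp Require Import all_boot all_order all_algebra.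
From mathcomp Require Import all_classical all_reals all_analysis.
Set Implicit Arguments.
Unset Strict Implicit.
Unset Printing Implicit Defensive.
Import Order.TTheory GRing.Theory Num.Theory.
Import numFieldNormedType.Exports.
Local Open Scope classical_set_scope.
Local Open Scope ring_scope.

Section processes.
Context {d : measure_display} {T : measurableType d} {R : realType}.
Variable P : probability T R.

Definition mutually_independent (I : finType) (X : I -> {RV P >-> R}) : Prop :=
  forall (J : {set I}) (A : I -> set R), (forall i, measurable (A i)) ->
    P [set w | forall i, i \in J -> A i (X i w)] =
    (\prod_(i in J) P (X i @^-1` A i))%E.

Definition iid_uniform01 (n : nat) (U : 'I_n -> {RV P >-> R}) : Prop :=
  mutually_independent U /\
  forall i (A : set R), measurable A ->
    distribution P (U i) A = uniform_prob (@ltr01 R) A.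

(* The degenerate case is separate because [normal_prob m 0] is not the Dirac
   mass at [m] (it is the uniform law on [0, 1]). *)
Definition gaussian (X : T -> R) : Prop :=
  exists m s : R, 0 <= s /\
    forall A : set R, measurable A ->
      P (X @^-1` A) = if s == 0 then \d_m A else normal_prob m s A.

(* The index set is [0, 1]; the values of [X] at other times are irrelevant. *)
Definition gaussian_process01 (X : R -> {RV P >-> R}) : Prop :=
  forall (k : nat) (t c : 'I_k -> R), (forall j, 0 <= t j <= 1) ->
    gaussian (fun w => \sum_(j < k) c j * X (t j) w).

Definition brownian_bridge (X : R -> {RV P >-> R}) : Prop :=
  [/\ gaussian_process01 X,
      forall t, 0 <= t <= 1 -> ('E_P[X t] = 0)%E,
      forall s t, 0 <= s <= 1 -> 0 <= t <= 1 ->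
        covariance P (X s) (X t) = (Num.min s t - s * t)%:E &
      forall w, {within `[0, 1], continuous (fun t => X t w)}].

End processes.

Section statistics.
Context {R : realType} {n : nat}.
Implicit Types p u : 'I_n -> R.

Definition ecdf u (t : R) : R := (\sum_(i < n) (u i <= t)%R%:R) / n%:R.

(* One-based: [order_stat p 1] is the smallest value. *)
Definition order_stat p (i : nat) : R := nth 0 (sort <=%R (codom p)) i.-1.

(* For i : nat, i <= n / 2 iff i <= n./2; the empty maximum (n <= 1) is -oo. *)
Definition HC p : \bar R :=
  (\big[maxe/-oo]_(1 <= i < n./2.+1)
    (Num.sqrt n%:R * ((i%:R / n%:R - order_stat p i) /
      Num.sqrt (order_stat p i * (1 - order_stat p i))))%:E)%E.

Definition BJ p : \bar R :=
  (\big[maxe/-oo]_(1 <= i < n./2.+1)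
    ((i%:R * ln (i%:R / (n%:R * order_stat p i)) +
      (n%:R - i%:R) * ln ((1 - i%:R / n%:R) / (1 - order_stat p i))) *
     (order_stat p i < i%:R / n%:R)%R%:R)%:E)%E.

End statistics.

(* Main.v *)
Require Import Defs.
From HB Require Import structures.
From mathcomp Require Import all_boot all_order all_algebra.
From mathcomp Require Import all_classical all_reals all_analysis.
From mathcomp Require Import measurable_realfun.
From mathcomp Require Import ring lra.
Set Implicit Arguments.
Unset Strict Implicit.
Unset Printing Implicit Defensive.
Import Order.TTheory GRing.Theory Num.Theory.
Import numFieldNormedType.Exports.
Local Open Scope classical_set_scope.
Local Open Scope ring_scope.

(** The proof has two engines: an optional-stopping bound for counts, behind (ii), (iii) and (iv), and a drift
    estimate for a stationary gaussian chain, behind (i).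

    Counts.  Let [S_0, ..., S_m] be decreasing sets of probabilities [s_0 >= ... >= s_m], and let [N_k] be the number
    of sample points in [S_k].  Given the points of [S_k], each of them lies in [S_m] with probability [s_m / s_k],
    so [z^N_m] has conditional expectation [q_k^N_k] with [q_k = 1 - (s_m / s_k) (1 - z)].  Stopping at the first [k]
    with [N_k <= n c s_k] and optimising over [z] shows that such a [k] exists with probability at most
    [exp (- n kl (c s_m) s_m)]: the Chernoff bound of the last set alone ([nested_sets_doob], [nested_sets_kl]).
    For half-lines with end points on finer and finer grids this controls [F_n(t) / t], or [(1 - F_n(t)) / (1 - t)],
    on a whole interval by a Chernoff bound at one of its ends ([lt_tail_slice], [gt_tail_slice]).
    On an interval from [u] to [v] of log-odds length at most [1 / eta], take the ratio [c] with [n kl (c v) v = eta]: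
    an exceedance of [eta] anywhere in the interval is a deviation of ratio less than [c].  Since
    [kl (c u) u (1 - u) / u] is nonincreasing in [u] ([kl_odds_le]), the exponent of the Chernoff bound at [u] is at
    least [exp (- 1 / eta) eta >= eta - 1] ([ratio_slice]).  Each slice costs
    [2 exp (1 - eta)], and [eta L + 1] slices cover an interval of log-odds length [L]: this is (ii).

    For (iii), use (ii) between [n^-K] and [1 / 2]: [BJ_n] is dominated by the supremum there, because
    [F_n(p_(i)) >= i / n] and the divergence increases away from its second argument, unless some p-value is below
    [n^-K], which has probability at most [n^(1 - K)].

    For (iv), the first inequality holds pointwise for the same reason.  A Bernstein lower bound on the divergence
    ([kl_bernstein]) turns a standardised deviation larger than [eta] at [t] into a value of [n kl] larger than
    [eta^2 / (2 (1 + eta / sqrt (n t (1 - t))))].  In the middle region, where [n t (1 - t)] is of order at least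
    [eta^2], this is at least [beta eta^2] for some [beta > 1 / D], which beats the factor [2 log n] coming from the
    log-odds length, since [log n <= exp (eta^2 / D)].  Nearer to the end points the level is only of order
    [sqrt eta], but the log-odds length is polynomial in [eta].  Below [1 / (n eta)] there is a sample point with
    probability at most [1 / eta] only, and above [1 - 1 / (n eta)] the deviation is at most [eta].

    Gaussian chain.  In the time scale [s = log (t / (1 - t))] the process [U(t) / sqrt (t (1 - t))] is stationary
    with covariance [exp (- |s - s'| / 2)].  On an equally spaced grid it is therefore a chain
    [X_(k+1) = rho X_k + sqrt (1 - rho^2) Y_(k+1)] with innovations independent of the past.  Let [A_k] be the event
    that the chain has stayed below [eta] up to time [k], and [V x = exp (2 eta x - 2 eta^2)], the factor that
    reflects the law of [X_k] at the level [eta] ([tilt (2 * eta)] in the text).  The score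
    [P (~ A_k) + E [V (X_k); A_k]] is [2 P (N > eta)] at time [0] for a standard normal [N], and the independence of
    the innovation shows that it grows at each step by at most [P (- eta < N <= eta - 2 eta rho)].  Summing over the
    grid and refining it gives [2 P (N > eta) + eta L phi(eta)], and Mills' inequality concludes
    ([chain_bound], [bridge_sup_tail]).

    A gaussian process is given through the laws of its linear combinations, so the independence of the innovation
    has to be extracted from the expectations of cosines of such combinations.  This is [rays_of_trig]: the bounded
    functions [psi] for which [E [psi(X) cos (c . X + t)]] agrees for two random vectors are closed under linear
    combinations, bounded limits and multiplication by [sin (a x_j + b)], hence contain indicators of orthants. *)

(** * A maximal inequality for counts in nested sets *)

(** Conditioning on a coarsening [phi] of independent labels of law [p]: an event that depends on the coarse labels
    only does not separate weights with the same averages over the fibres of [phi]. *)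
Lemma sum_prod_coarsen (R : realType) (n : nat) (I : finType) (phi : I -> I)
    (p z z' : I -> R) (G : pred {ffun 'I_n -> I}) :
  (forall f : {ffun 'I_n -> I}, G [ffun i => phi (f i)] = G f) ->
  (forall y, \sum_(x | phi x == y) p x * z x = \sum_(x | phi x == y) p x * z' x) ->
  \sum_(f : {ffun 'I_n -> I} | G f) \prod_i (p (f i) * z (f i)) =
  \sum_(f : {ffun 'I_n -> I} | G f) \prod_i (p (f i) * z' (f i)).
Proof.
move=> Gphi pz.
have key (w : I -> R) : \sum_(f : {ffun 'I_n -> I} | G f) \prod_i (p (f i) * w (f i)) =
    \sum_(h : {ffun 'I_n -> I} | G h) \prod_i \sum_(x | phi x == h i) p x * w x.
  rewrite (partition_big (fun f : {ffun 'I_n -> I} => [ffun i => phi (f i)]) predT)//=.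
  rewrite [RHS]big_mkcond/=; apply: eq_bigr => h _.
  have [Gh|Gh] := boolP (G h); last first.
    rewrite big1// => f /andP[Gf /eqP fh].
    by move: Gh; rewrite -fh Gphi Gf.
  rewrite bigA_distr_big_dep/=; apply: eq_bigl => f.
  apply/andP/familyP => [[_ /eqP <-] i|fh].
    by rewrite ffunE unfold_in.
  have e : [ffun i => phi (f i)] = h.
    by apply/ffunP => i; rewrite ffunE; move: (fh i) => /eqP.
  by rewrite -Gphi e.
by rewrite !key; apply: eq_bigr => h _; apply: eq_bigr => i _; exact: pz.
Qed.

(** [p] is the law of the label of a sample point, its label being the number of nested sets that contain it.  The
    martingale is [q k ^+ alive k]: from the first crossing [k] on it may be replaced by its terminal value
    [z ^+ alive m], and at a crossing it is at least [z `^ (x * tail m)], by concavity of the logarithm. *)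
Section finite_doob.
Context {R : realType} (n m : nat) (p : 'I_m.+2 -> R).
Hypothesis p0 : forall x, 0 <= p x.
Hypothesis p1 : \sum_x p x = 1.

Definition tail (k : nat) : R := \sum_(x < m.+2 | (k < x)%N) p x.
Definition alive (k : nat) (f : {ffun 'I_n -> 'I_m.+2}) : nat :=
  \sum_(i < n) (k < f i)%N.

Lemma tail_ge0 k : 0 <= tail k.
Proof. by apply: sumr_ge0. Qed.

Lemma le_tail k l : (k <= l)%N -> tail l <= tail k.
Proof.
move=> kl; rewrite /tail big_mkcond/= [leRHS]big_mkcond/=.
apply: ler_sum => x _; case: ifPn => lx; last by case: ifP.
by rewrite (leq_ltn_trans kl lx).
Qed.

Variables (z x : R).
Hypotheses (z0 : 0 < z) (z1 : z <= 1) (x0 : 0 <= x) (tm0 : 0 < tail m).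

Let tk0 k : (k <= m)%N -> 0 < tail k.
Proof. by move=> km; apply: lt_le_trans (le_tail km). Qed.

Let q k : R := 1 - tail m / tail k * (1 - z).
Let zz k (y : 'I_m.+2) : R := if (k < y)%N then q k else 1.

Let crossed k f := (alive k f)%:R <= x * tail k.

Let first k f := crossed k f && [forall j : 'I_m.+1, (j < k)%N ==> ~~ crossed j f].

Let r_le1 k : (k <= m)%N -> tail m / tail k <= 1.
Proof. by move=> km; rewrite ler_pdivrMr ?tk0// mul1r le_tail. Qed.

Let r_ge0 k : (k <= m)%N -> 0 <= tail m / tail k.
Proof. by move=> km; rewrite divr_ge0// tail_ge0. Qed.

Let mix_gt0 (r : R) : 0 <= r -> r <= 1 -> 0 < 1 - r * (1 - z).
Proof.
move=> r0 r1; have h0 : 0 <= (1 - r) * (1 - z) by rewrite mulr_ge0// subr_ge0.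
by have z0' := z0; lra.
Qed.

Let q_gt0 k : (k <= m)%N -> 0 < q k.
Proof. by move=> km; apply: mix_gt0; rewrite ?r_ge0// r_le1. Qed.

Let q_le1 k : (k <= m)%N -> q k <= 1.
Proof. by move=> km; rewrite /q gerBl mulr_ge0 ?r_ge0// subr_ge0. Qed.

Let mix_ge (r : R) : 0 <= r -> r <= 1 -> z `^ r <= 1 - r * (1 - z).
Proof.
move=> r0 r1; rewrite -ler_ln ?posrE ?powR_gt0 ?mix_gt0// ln_powR.
have := @concave_ln R (Itv01 r0 r1) z 1 z0 ltr01.
rewrite !convRE/= ln1 mulr0 addr0 mulr1 => /le_trans; apply.
rewrite (_ : r * z + (1 - r) = 1 - r * (1 - z)) //; ring.
Qed.

Let q_ge k : (k <= m)%N -> z `^ (tail m / tail k) <= q k.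
Proof. by move=> km; apply: mix_ge; rewrite ?r_ge0// r_le1. Qed.

Let prod_zz k (f : {ffun 'I_n -> 'I_m.+2}) : \prod_i zz k (f i) = q k ^+ alive k f.
Proof.
rewrite /alive /zz; elim/big_rec2 : _ => [|i y1 y2 _ ->]; first by rewrite expr0.
by case: ifP => _; rewrite ?mul1r ?add0n// add1n exprS.
Qed.

Let crossed_zz k (f : {ffun 'I_n -> 'I_m.+2}) : (k <= m)%N -> crossed k f -> z `^ (x * tail m) <= \prod_i zz k (f i).
Proof.
move=> km cf; rewrite prod_zz.
have -> : x * tail m = (tail m / tail k) * (x * tail k).
  by field; rewrite gt_eqF// tk0.
rewrite powRrM -powR_mulrn ?(ltW (q_gt0 km))//.
apply: (@le_trans _ _ (q k `^ (x * tail k))).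
  apply: ge0_ler_powR; rewrite ?nnegrE ?powR_ge0 ?(ltW (q_gt0 km)) ?q_ge//.
  by rewrite mulr_ge0 ?tail_ge0.
by apply: ger_powR => //; rewrite q_gt0// q_le1.
Qed.

(* Labels are truncated at [k.+1], which is all that the sets up to the [k]-th one can see. *)
Let trunc k (y : 'I_m.+2) : 'I_m.+2 := inord (minn k.+1 y).

Let trunc_lt k j (y : 'I_m.+2) : (j <= k)%N -> (k <= m)%N -> (j < trunc k y)%N = (j < y)%N.
Proof.
move=> jk km; rewrite /trunc inordK; last first.
  by rewrite (@leq_ltn_trans y)// geq_minr.
by rewrite leq_min ltnS jk.
Qed.

Let alive_trunc k j (f : {ffun 'I_n -> 'I_m.+2}) : (j <= k)%N -> (k <= m)%N ->
  alive j [ffun i => trunc k (f i)] = alive j f.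
Proof.
by move=> jk km; apply: eq_bigr => i _; rewrite ffunE trunc_lt.
Qed.

Let step k : (k <= m)%N ->
  \sum_(f : {ffun 'I_n -> 'I_m.+2} | first k f) \prod_i (p (f i) * zz k (f i)) =
  \sum_(f : {ffun 'I_n -> 'I_m.+2} | first k f) \prod_i (p (f i) * zz m (f i)).
Proof.
move=> km; apply: (@sum_prod_coarsen _ _ _ (trunc k)).
  move=> f; rewrite /first /crossed alive_trunc//; congr andb.
  apply: eq_forallb => j; case: ltnP => // jk /=.
  by rewrite alive_trunc// ltnW.
move=> y; have [ky|yk] := ltnP k y; last first.
  apply: eq_bigr => w /eqP wy; congr (_ * _).
  have wk : (w <= k)%N.
    move: yk; rewrite -wy leqNgt trunc_lt// -leqNgt//.
  by rewrite /zz !ltnNge wk (leq_trans wk km).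
have [yk1|yk1] := eqVneq (nat_of_ord y) k.+1; last first.
  have ny w : (trunc k w == y) = false.
    apply/negbTE/eqP => wy; move: ky yk1; rewrite -wy /trunc inordK; last first.
      by rewrite (@leq_ltn_trans w)// geq_minr.
    by move=> h1; rewrite eqn_leq geq_minl h1.
  by rewrite !big1// => w; rewrite ny.
have cond w : (trunc k w == y) = (k < w)%N.
  rewrite -val_eqE/= yk1 /trunc inordK; last first.
    by rewrite (@leq_ltn_trans w)// geq_minr.
  by rewrite (sameP eqP minn_idPl).
under eq_bigl do rewrite cond.
under [RHS]eq_bigl do rewrite cond.
transitivity (tail k * q k).
  rewrite /tail mulr_suml; apply: eq_bigr => w kw.
  by rewrite /zz kw.
transitivity (tail k - tail m + tail m * z).
  by rewrite /q; field; rewrite gt_eqF// tk0.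
have tkm : tail k - tail m = \sum_(w < m.+2 | (k < w)%N && ~~ (m < w)%N) p w.
  rewrite {1}/tail (bigID (fun w : 'I_m.+2 => (m < w)%N))/= addrC.
  rewrite (_ : \sum_(i < m.+2 | _ && (m < i)%N) p i = tail m) ?addrK//.
  apply: eq_bigl => w; case: (ltnP m w) => mw; rewrite ?andbF// andbT.
  by rewrite (leq_ltn_trans km mw).
rewrite [RHS](bigID (fun w : 'I_m.+2 => (m < w)%N))/= addrC tkm; congr (_ + _).
  by apply: eq_bigr => w /andP[_ mw]; rewrite /zz (negbTE mw) mulr1.
rewrite /tail mulr_suml; apply: eq_big.
  move=> w; case: (ltnP m w) => mw; rewrite ?andbF// andbT.
  by rewrite (leq_ltn_trans km mw).
by move=> w mw; rewrite /zz mw /q divff ?gt_eqF// mul1r opprB addrC subrK.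
Qed.

Lemma finite_doob :
  \sum_(f : {ffun 'I_n -> 'I_m.+2} | [exists k : 'I_m.+1, crossed k f]) \prod_i p (f i) <=
  z `^ (- (x * tail m)) * (1 - tail m + tail m * z) ^+ n.
Proof.
have zx : 0 < z `^ (x * tail m) by exact: powR_gt0.
rewrite powRN mulrC ler_pdivlMr// mulr_suml.
have -> : (1 - tail m + tail m * z) ^+ n =
    \sum_(f : {ffun 'I_n -> 'I_m.+2}) \prod_i (p (f i) * zz m (f i)).
  rewrite -(bigA_distr_bigA (fun (_ : 'I_n) j => p j * zz m j)) prodr_const card_ord.
  congr (_ ^+ _); rewrite [RHS](bigID (fun w : 'I_m.+2 => (m < w)%N))/= [RHS]addrC.
  congr (_ + _).
    rewrite -{1}p1 (bigID (fun w : 'I_m.+2 => (m < w)%N))/= addrC addrK.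
    by apply: eq_bigr => w mw; rewrite /zz (negbTE mw) mulr1.
  rewrite mulr_suml; apply: eq_bigr => w mw.
  by rewrite /zz mw /q divff ?gt_eqF// mul1r opprB addrC subrK.
have W0 g (f : {ffun 'I_n -> 'I_m.+2}) :
    (g <= m)%N -> 0 <= \prod_i (p (f i) * zz g (f i)).
  move=> gm; apply: prodr_ge0 => i _; rewrite mulr_ge0// /zz.
  by case: ifP => // _; rewrite ltW// q_gt0.
(* At most one index is the first crossing, so the sum over first crossings is at most the total mass. *)
apply: (@le_trans _ _ (\sum_(k < m.+1) \sum_(f : {ffun 'I_n -> 'I_m.+2} | first k f)
    \prod_i (p (f i) * zz m (f i)))); last first.
  under eq_bigr do rewrite big_mkcond/=.
  rewrite exchange_big/=; apply: ler_sum => f _.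
  rewrite -big_mkcond/=.
  have [k0 fk0|nf] := pickP (fun k : 'I_m.+1 => first k f); last first.
    by rewrite [leLHS]big_pred0// W0.
  rewrite (bigD1 k0)//= [X in _ + X]big_pred0 ?addr0// => j; apply/negP => /andP[fj jk0].
  move: fj fk0 => /andP[cj /forallP fj] /andP[ck /forallP fk].
  have := jk0; rewrite -val_eqE/= neq_ltn => /orP[] h.
  - by have := fk j; rewrite h cj.
  - by have := fj k0; rewrite h ck.
apply: (@le_trans _ _ (\sum_(k < m.+1) \sum_(f : {ffun 'I_n -> 'I_m.+2} | first k f)
    \prod_i p (f i) * z `^ (x * tail m))); last first.
  apply: ler_sum => k _; have km : (k <= m)%N by rewrite -ltnS.
  rewrite -step//; apply: ler_sum => f /andP[cf _].
  rewrite big_split/=; apply: ler_wpM2l; first exact: prodr_ge0.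
  exact: crossed_zz.
under [leRHS]eq_bigr do rewrite big_mkcond/=.
rewrite exchange_big/= big_mkcond/=; apply: ler_sum => f _.
rewrite -big_mkcond/=.
have c0 : 0 <= \prod_i p (f i) * z `^ (x * tail m).
  by rewrite mulr_ge0 ?powR_ge0//; exact: prodr_ge0.
case: ifPn => [/existsP[k0 ck0]|_]; last exact: sumr_ge0.
have [k ck kmin] := @arg_minnP _ k0 (fun k : 'I_m.+1 => crossed k f) val ck0.
rewrite (bigD1 k)/=; last first.
  rewrite /first ck/=; apply/forallP => j; apply/implyP => jk.
  by apply/negP => cj; have := kmin _ cj; rewrite leqNgt jk.
by rewrite lerDl sumr_ge0.
Qed.

End finite_doob.

Lemma measure_bigsetU_le d (T : measurableType d) (R : realType)
    (P : {measure set T -> \bar R}) (I : Type) (r : seq I) (Q : pred I)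
    (A : I -> set T) : (forall i, measurable (A i)) ->
  (P (\big[setU/set0]_(i <- r | Q i) A i) <= \sum_(i <- r | Q i) P (A i))%E.
Proof.
move=> mA; elim: r => [|i r ih]; first by rewrite !big_nil measure0.
rewrite !big_cons; case: ifP => // _.
apply: le_trans (measureU2 _ _ _) _ => //; first exact: bigsetU_measurable.
exact: leeD2l.
Qed.

Section nested_sets.
Context {d : measure_display} {T : measurableType d} {R : realType}.
Variables (P : probability T R) (mu : probability (measurableTypeR R) R).
Variables (n : nat) (U : 'I_n -> {RV P >-> R}).
Hypothesis indepU : mutually_independent U.
Hypothesis lawU : forall i (A : set R), measurable A -> P (U i @^-1` A) = mu A.
Variables (S : nat -> set R) (m : nat).
Hypothesis mS : forall k, measurable (S k).
Hypothesis nestedS : forall k, S k.+1 `<=` S k.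

Let nested k l : (k <= l)%N -> S l `<=` S k.
Proof.
move=> kl; rewrite -(subnK kl); elim: (l - k)%N => [//|j ih].
by rewrite addSn; apply: subset_trans ih; exact: nestedS.
Qed.

Let exits (u : R) : nat := (\sum_(k < m.+1) (u \in S k))%N.

Let exits_lt u : (exits u < m.+2)%N.
Proof.
rewrite ltnS; apply: leq_trans (_ : \sum_(k < m.+1) 1 <= _)%N.
  by apply: leq_sum => k _; case: (_ \in _).
by rewrite sum1_card card_ord.
Qed.

Let exit u : 'I_m.+2 := Ordinal (exits_lt u).

Let exitP u k : (k <= m)%N -> (k < exit u)%N = (u \in S k).
Proof.
move=> km /=; apply/idP/idP => [ku|uSk].
  apply/negPn/negP => nuS; move: ku; rewrite ltnNge => /negP; apply.
  rewrite /exits -(big_mkord predT (fun j => nat_of_bool (u \in S j))).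
  rewrite (@big_cat_nat _ _ _ k)//=; last by rewrite leqW.
  rewrite [X in (_ + X)%N]big_nat_cond [X in (_ + X)%N]big1 ?addn0.
    rewrite -[leqRHS]subn0 -[leqRHS]muln1 -sum_nat_const_nat.
    by apply: leq_sum => j _; case: (_ \in _).
  move=> j /andP[/andP[kj _] _]; case: (boolP (u \in S j)) => // /set_mem uS.
  by move: nuS; rewrite (mem_set (nested kj uS)).
rewrite /exits -(big_mkord predT (fun j => nat_of_bool (u \in S j))).
rewrite (@big_cat_nat _ _ _ k.+1)//=.
apply: leq_trans (leq_addr _ _).
rewrite -[leqLHS]subn0 -[leqLHS]muln1 -sum_nat_const_nat.
rewrite big_nat_cond [leqRHS]big_nat_cond; apply: leq_sum => j /andP[/andP[_ jk] _].
by rewrite (mem_set (nested _ (set_mem uSk))).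
Qed.

Let C (j : 'I_m.+2) : set R := [set u | exit u = j].

Let mC j : measurable (C j).
Proof.
rewrite [X in measurable X](_ : _ =
    (fun u => \sum_(k < m.+1) \1_(S k) u) @^-1` [set (j%:R : R)]); last first.
  apply/seteqP; split => u /=; rewrite /C/=.
    move=> <-; rewrite /exits natr_sum; apply: eq_bigr => k _.
    by rewrite indicE.
  move=> h; apply/val_inj/eqP => /=; rewrite -(@eqr_nat R) -h /exits natr_sum.
  by apply/eqP; apply: eq_bigr => k _; rewrite indicE.
have mf : measurable_fun setT (fun u => \sum_(k < m.+1) \1_(S k) u : R).
  by apply: measurable_sum => k; exact: measurable_indic.
rewrite -[X in measurable X]setTI; exact: (mf measurableT).
Qed.

Let p j : R := fine (mu (C j)).

Let pE j : mu (C j) = (p j)%:E.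
Proof. by rewrite fineK//; apply: fin_num_measure; exact: mC. Qed.

Let p0 j : 0 <= p j.
Proof. by rewrite fine_ge0. Qed.

Let mass (Q : pred 'I_m.+2) (A : set R) :
  (forall u, A u <-> Q (exit u)) -> mu A = (\sum_(j | Q j) p j)%:E.
Proof.
move=> AQ; rewrite -sumEFin.
under eq_bigr do rewrite -pE.
rewrite -measure_bigsetU_ord_cond.
- congr (mu _); rewrite -bigcup_pred.
  apply/seteqP; split => [u /AQ Qu|u [j]] /=; first by exists (exit u).
  by move=> /= Qj uj; apply/AQ; rewrite uj.
- by move=> i _; exact: mC.
- by move=> i j _ _ [u [/= <- <-]].
Qed.

Let p1 : \sum_j p j = 1.
Proof.
by apply: EFin_inj; rewrite -(@mass predT setT)// probability_setT.
Qed.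

Let tailE k : (k <= m)%N -> mu (S k) = (tail p k)%:E.
Proof.
move=> km; rewrite (@mass (fun j => (k < j)%N))// => u.
by rewrite exitP//; split => [/mem_set|/set_mem].
Qed.

(** Transfers [finite_doob] to the sample: by nesting, membership in the sets is encoded by the number of sets that
    contain a point, and these labels are independent. *)
Lemma nested_sets_doob (z x : R) : 0 < z -> z <= 1 -> 0 <= x -> (0 < mu (S m))%E ->
  let E := [set w | exists2 k, (k <= m)%N &
    (\sum_(i < n) (U i w \in S k))%:R <= x * fine (mu (S k))] in
  measurable E /\
  let s := fine (mu (S m)) in
  (P E <= (z `^ (- (x * s)) * (1 - s + s * z) ^+ n)%:E)%E.
Proof.
move=> z0 z1 x0 sm0 E.
pose crossing (f : {ffun 'I_n -> 'I_m.+2}) :=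
  [exists k : 'I_m.+1, (alive k f)%:R <= x * tail p k].
pose A (f : {ffun 'I_n -> 'I_m.+2}) := [set w | forall i, i \in [set: 'I_n]%SET -> C (f i) (U i w)].
have EA : E = \big[setU/set0]_(f : {ffun 'I_n -> 'I_m.+2} | crossing f) A f.
  rewrite -bigcup_pred; apply/seteqP; split => [w [k km wk]|w [f]]/=.
    exists [ffun i => exit (U i w)]; last by move=> i _; rewrite /C/= ffunE.
    suff cf : crossing [ffun i => exit (U i w)] by [].
    apply/existsP; exists (Ordinal (km : (k < m.+1)%N)) => /=.
    rewrite -[tail _ _]/(fine (tail p k)%:E) -tailE//.
    rewrite [X in X%:R <= _](_ : _ = \sum_(i < n) (U i w \in S k))%N//.
    by apply: eq_bigr => i _; rewrite ffunE exitP.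
  move=> cf Aw; have /existsP[k hk] : crossing f by exact: cf.
  have km : (k <= m)%N by rewrite -ltnS.
  exists k => //; rewrite tailE//=.
  rewrite [X in X%:R <= _](_ : _ = alive k f)//.
  by apply: eq_bigr => i _; rewrite -exitP//= -(Aw i)// inE.
have mA f : measurable (A f).
  rewrite [A f](_ : _ = \bigcap_(i in [set: 'I_n]) (U i @^-1` C (f i))).
    apply: fin_bigcap_measurable => // i _.
    by rewrite -[X in measurable X]setTI; exact: measurable_funPT.
  apply/seteqP; split => [w Aw i _|w Aw i _]; first by apply: Aw; rewrite inE.
  exact: Aw.
split; first by rewrite EA; apply: bigsetU_measurable => f _; exact: mA.
move=> s.
have sE : s = tail p m by rewrite /s tailE.
rewrite EA (le_trans (measure_bigsetU_le _ _ _ mA))//.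
have PA f : P (A f) = (\prod_i p (f i))%:E.
  rewrite /A (indepU _ (fun i => mC (f i))) -prodEFin.
  by apply: eq_big => [i|i _]; rewrite ?inE// lawU// pE.
rewrite (eq_bigr (fun f : {ffun 'I_n -> 'I_m.+2} => (\prod_i p (f i))%:E)); last first.
  by move=> f _; exact: PA.
rewrite sumEFin lee_fin sE; apply: finite_doob => //.
by rewrite -lte_fin -tailE.
Qed.

End nested_sets.

(** * The binary Kullback-Leibler divergence *)

Section kl.
Context {R : realType}.
Implicit Types a b c t u x y : R.

Definition kl x t : R := x * ln (x / t) + (1 - x) * ln ((1 - x) / (1 - t)).

Lemma ln_le_sub1 x : 0 < x -> ln x <= x - 1.
Proof. by move=> x0; have := @le_ln1Dx R (x - 1); rewrite (_ : 1 + (x - 1) = x); [apply; lra|ring]. Qed.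

Lemma ln_ge_subV x : 0 < x -> 1 - x^-1 <= ln x.
Proof.
move=> x0; have := @ln_le_sub1 x^-1; rewrite invr_gt0 lnV ?posrE// => /(_ x0).
by lra.
Qed.

(** The right-hand side is convex in [a], and the left-hand side is its tangent at [a = b * c]. *)
Lemma xlnx_tangent a b c : 0 <= a -> 0 < b -> 0 < c ->
  a * ln c + a - b * c <= a * ln (a / b).
Proof.
move=> a0 b0 c0; have [->|an0] := eqVneq a 0.
  by rewrite !mul0r !add0r oppr_le0 mulr_ge0// ltW.
have {}a0 : 0 < a by rewrite lt_neqAle eq_sym an0.
have := @ln_ge_subV (a / b / c); rewrite !divr_gt0// => /(_ isT).
rewrite ln_div ?posrE ?divr_gt0// => h.
have {h} : a * (1 - (a / b / c)^-1) <= a * (ln (a / b) - ln c) by rewrite ler_pM2l.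
rewrite (_ : a * (1 - _) = a - b * c); last by field; rewrite !gt_eqF.
by rewrite mulrBr; lra.
Qed.

(** The log-sum inequality for the pairs [(a, b)] and [(c, c)], of which the second contributes [c * ln 1 = 0]. *)
Lemma log_sum a b c : 0 <= a -> 0 < b -> 0 <= c -> 0 < a + c ->
  (a + c) * ln ((a + c) / (b + c)) <= a * ln (a / b).
Proof.
move=> a0 b0 c0 ac0; set r := (a + c) / (b + c).
have bc0 : 0 < b + c by lra.
have r0 : 0 < r by rewrite divr_gt0.
have h1 := xlnx_tangent a0 b0 r0.
have h2 : c * ln r <= c * (r - 1) by rewrite ler_wpM2l// ln_le_sub1.
have h3 : (b + c) * r = a + c by rewrite /r mulrC divfK// gt_eqF.
have h4 : ln r * (a + c) = a * ln r + c * ln r by ring.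
rewrite mulrC h4; have h5 : a * ln r + a - b * r = a * ln r + c * (r - 1) + (a + c - (b + c) * r) by ring.
by lra.
Qed.

Lemma kl_ge0 x t : 0 <= x -> x <= 1 -> 0 < t -> t < 1 -> 0 <= kl x t.
Proof.
move=> x0 x1 t0 t1; have h1 := xlnx_tangent x0 t0 ltr01.
have h2 := @xlnx_tangent (1 - x) (1 - t) 1.
rewrite ln1 in h1 h2; rewrite /kl.
have := h2 _ _ ltr01; rewrite subr_ge0 subr_gt0 => /(_ x1 t1).
by lra.
Qed.

(** Joint convexity of the divergence on the segment from [(0, 0)], where it vanishes. *)
Lemma kl_scale r x t : 0 < r -> r <= 1 -> 0 <= x -> x <= 1 -> 0 < t -> t < 1 ->
  kl (r * x) (r * t) <= r * kl x t.
Proof.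
move=> r0 r1 x0 x1 t0 t1; rewrite /kl mulrDr; apply: lerD.
  have [->|xn0] := eqVneq x 0; first by rewrite !(mulr0, mul0r).
  rewrite -mulrA ler_pM2l// ler_wpM2l//.
  by rewrite (_ : r * x / (r * t) = x / t)//; field; rewrite !gt_eqF.
have [->|xn1] := eqVneq x 1.
  have [->|rn1] := eqVneq r 1; first by rewrite !mul1r subrr !mul0r.
  rewrite subrr !mul0r mulr0 mulr1; apply: mulr_ge0_le0; first by lra.
  apply: ln_le0; rewrite ler_pdivrMr; last first.
    by rewrite subr_gt0 (le_lt_trans _ t1)// ler_piMl// ltW.
  by rewrite mul1r lerB// ler_piMr// ltW.
have {}x1 : x < 1 by rewrite lt_neqAle xn1.
have := @log_sum (r * (1 - x)) (r * (1 - t)) (1 - r).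
rewrite (_ : r * (1 - x) + (1 - r) = 1 - r * x); last by ring.
rewrite (_ : r * (1 - t) + (1 - r) = 1 - r * t); last by ring.
rewrite (_ : r * (1 - x) / (r * (1 - t)) = (1 - x) / (1 - t)); last first.
  by field; rewrite !gt_eqF ?subr_gt0.
rewrite -mulrA; apply; rewrite ?mulr_ge0 ?mulr_gt0 ?subr_ge0 ?subr_gt0 ?(ltW r0) ?(ltW x1)//.
rewrite (le_lt_trans _ x1)// ler_piMl//.
Qed.

Lemma kl_convex r x t : 0 < r -> r <= 1 -> 0 <= x -> x <= 1 -> 0 < t -> t < 1 ->
  kl (r * x + (1 - r) * t) t <= r * kl x t.
Proof.
have aux r' x' t' : 0 < r' -> r' <= 1 -> 0 <= x' -> x' <= 1 -> 0 < t' -> t' < 1 ->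
   (r' * x' + (1 - r') * t') * ln ((r' * x' + (1 - r') * t') / t') <= r' * (x' * ln (x' / t')).
  move=> r0 r1 x0 x1 t0 t1.
  have [->|xn0] := eqVneq x' 0.
    rewrite mulr0 add0r mul0r mulr0 mulfK ?gt_eqF//; apply: mulr_ge0_le0.
      by rewrite mulr_ge0 ?subr_ge0// ltW.
    by apply: ln_le0; lra.
  have xp : 0 < x' by rewrite lt_neqAle eq_sym xn0.
  have := @log_sum (r' * x') (r' * t') ((1 - r') * t').
  rewrite (_ : r' * t' + (1 - r') * t' = t'); last by ring.
  rewrite (_ : r' * x' / (r' * t') = x' / t'); last by field; rewrite !gt_eqF.
  rewrite -mulrA; apply; rewrite ?mulr_ge0 ?mulr_gt0 ?subr_ge0 ?(ltW r0) ?(ltW t0)//.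
  by rewrite ltr_pwDl ?mulr_gt0// mulr_ge0 ?subr_ge0// ltW.
move=> r0 r1 x0 x1 t0 t1; rewrite /kl mulrDr; apply: lerD; first exact: aux.
have -> : 1 - (r * x + (1 - r) * t) = r * (1 - x) + (1 - r) * (1 - t) by ring.
by apply: aux => //; rewrite ?subr_ge0 ?subr_gt0//; lra.
Qed.

Lemma kl_refl t : 0 < t -> t < 1 -> kl t t = 0.
Proof. by move=> t0 t1; rewrite /kl !divff ?ln1 ?mulr0 ?addr0// gt_eqF// subr_gt0. Qed.

(** At a fixed ratio [c] between the arguments, the divergence is monotone: this is why a Chernoff bound at one end
    point of an interval rules over the whole interval. *)
Lemma kl_proportional_le c u v : 0 <= c -> c <= 1 -> 0 < u -> u <= v -> v < 1 ->
  kl (c * u) u <= kl (c * v) v.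
Proof.
move=> c0 c1 u0 uv v1; have v0 : 0 < v by lra.
have := @kl_scale (u / v) (c * v) v.
rewrite (_ : u / v * (c * v) = c * u); last by field; rewrite gt_eqF.
rewrite divfK ?gt_eqF// => h; apply: le_trans (h _ _ _ _ v0 v1) _.
- by rewrite divr_gt0.
- by rewrite ler_pdivrMr// mul1r.
- by rewrite mulr_ge0// ltW.
- by rewrite (le_trans _ (ltW v1))// ler_piMl// ltW.
rewrite ler_piMl//; last by rewrite ler_pdivrMr// mul1r.
by rewrite kl_ge0// ?mulr_ge0// ?(ltW v0)// (le_trans _ (ltW v1))// ler_piMl// ltW.
Qed.

Lemma kl_ratio_le c e u : 0 < u -> u < 1 -> 0 <= c -> c <= e -> e <= 1 ->
  kl (e * u) u <= kl (c * u) u.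
Proof.
move=> u0 u1 c0 ce e1; have [->|en1] := eqVneq e 1.
  rewrite mul1r kl_refl// kl_ge0// ?mulr_ge0// ?(ltW u0)//.
  rewrite (le_trans _ (ltW u1))// ler_piMl ?(ltW u0)//; lra.
have {}e1 : e < 1 by rewrite lt_neqAle en1.
have c1 : c < 1 by lra.
have := @kl_convex ((1 - e) / (1 - c)) (c * u) u.
rewrite (_ : _ + _ = e * u); last by field; rewrite gt_eqF ?subr_gt0.
have cu1 : c * u <= 1 by rewrite (le_trans _ (ltW u1))// ler_piMl ?(ltW u0)// ltW.
have r1 : (1 - e) / (1 - c) <= 1 by rewrite ler_pdivrMr ?subr_gt0// mul1r; lra.
move=> h; apply: le_trans (h _ r1 _ _ u0 u1) _ => //.
- by rewrite divr_gt0// subr_gt0.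
- by rewrite mulr_ge0// ltW.
- by rewrite ler_piMl// kl_ge0// mulr_ge0// ltW.
Qed.

Lemma nondecreasing_is_derive (f df : R -> R) a b : a <= b ->
  (forall x, a <= x -> x <= b -> is_derive x 1 f (df x)) ->
  (forall x, a <= x -> x <= b -> 0 <= df x) -> f a <= f b.
Proof.
move=> ab fdf df0.
have [||c] := @MVT_segment R f df a b ab.
- by move=> x; rewrite in_itv/= => /andP[/ltW ax /ltW xb]; exact: fdf.
- apply: derivable_within_continuous => x; rewrite in_itv/= => /andP[ax xb].
  by case: (fdf _ ax xb).
rewrite in_itv/= => /andP[ac cb] h; rewrite -subr_ge0 h mulr_ge0 ?subr_ge0//.
exact: df0.
Qed.

(** The derivation rules for functions written pointwise rather than as sums and products of functions. *)
Section pointwise_derive.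
Implicit Types (f g : R -> R) (df dg : R).

Lemma is_derive_eq1 f x df dg : is_derive x 1 f df -> df = dg -> is_derive x 1 f dg.
Proof. by move=> h <-. Qed.

Lemma is_deriveB1 f g x df dg : is_derive x 1 f df -> is_derive x 1 g dg ->
  is_derive x 1 (fun y => f y - g y) (df - dg).
Proof. by move=> hf hg; exact: is_deriveB. Qed.

Lemma is_deriveD1 f g x df dg : is_derive x 1 f df -> is_derive x 1 g dg ->
  is_derive x 1 (fun y => f y + g y) (df + dg).
Proof. by move=> hf hg; exact: is_deriveD. Qed.

Lemma is_deriveM1 f g x df dg : is_derive x 1 f df -> is_derive x 1 g dg ->
  is_derive x 1 (fun y => f y * g y) (f x * dg + g x * df).
Proof. by move=> hf hg; exact: is_deriveM. Qed.

Lemma is_deriveX1 f n x df : is_derive x 1 f df ->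
  is_derive x 1 (fun y => f y ^+ n) (n%:R * f x ^+ n.-1 * df).
Proof.
move=> hf; have := is_deriveX n hf.
by rewrite (_ : f ^+ n = (fun y => f y ^+ n))//; apply/funext => y; rewrite fctE.
Qed.

Lemma is_derive_cst1 c x : is_derive x 1 (fun=> c : R) 0.
Proof. exact: is_derive_cst. Qed.

Lemma is_derive_id1 x : is_derive x 1 (fun y : R => y) 1.
Proof. exact: is_derive_id. Qed.

End pointwise_derive.

Lemma is_derive_ln_comp (g : R -> R) x dg : 0 < g x -> is_derive x 1 g dg ->
  is_derive x 1 (fun y => ln (g y)) (dg / g x).
Proof.
move=> gx hg; have := @is_derive1_comp R (@ln R) g x (g x)^-1 dg (is_derive1_ln gx) hg.
by rewrite mulrC.
Qed.

Lemma is_derive_kl x t : 0 < x -> x < 1 -> 0 < t -> t < 1 ->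
  is_derive x 1 (kl ^~ t) (ln (x / t) - ln ((1 - x) / (1 - t))).
Proof.
move=> x0 x1 t0 t1.
have x1' : 0 < 1 - x by rewrite subr_gt0.
have t1' : 0 < 1 - t by rewrite subr_gt0.
have i1 : is_derive x 1 (fun y : R => 1 - y) (-1).
  by apply: is_derive_eq1 (is_deriveB1 (is_derive_cst1 1 x) (is_derive_id1 x)) _; rewrite sub0r.
have d1 : is_derive x 1 (fun y : R => y / t) t^-1.
  apply: is_derive_eq1 (is_deriveM1 (is_derive_id1 x) (is_derive_cst1 t^-1 x)) _.
  by rewrite mulr0 add0r mulr1.
have d2 : is_derive x 1 (fun y : R => (1 - y) / (1 - t)) (- (1 - t)^-1).
  apply: is_derive_eq1 (is_deriveM1 i1 (is_derive_cst1 (1 - t)^-1 x)) _.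
  by rewrite mulr0 add0r mulrN1.
have h1 := @is_derive_ln_comp (fun y : R => y / t) x _ (divr_gt0 x0 t0) d1.
have h2 := @is_derive_ln_comp (fun y : R => (1 - y) / (1 - t)) x _ (divr_gt0 x1' t1') d2.
apply: is_derive_eq1 (is_deriveD1 (is_deriveM1 (is_derive_id1 x) h1) (is_deriveM1 i1 h2)) _.
field.
by rewrite !gt_eqF.
Qed.

(** With the denominator [V] of the left-hand side frozen, [(y - t) ^+ 2 / (2 * V)] and [kl y t] both vanish at
    [y = t].  The derivative of the latter is at least [(y - t) / (y * (1 - t))], by [ln z >= 1 - 1 / z], and
    [y * (1 - t) <= V] as long as [y <= x]. *)
Lemma kl_bernstein x t : 0 < t -> t < 1 -> t <= x -> x <= 1 ->
  (x - t) ^+ 2 / (2 * (t * (1 - t) + (x - t))) <= kl x t.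
Proof.
move=> t0 t1 tx x1.
have tt0 : 0 < t * (1 - t) by rewrite mulr_gt0// subr_gt0.
have V0 : 0 < t * (1 - t) + (x - t) by rewrite ltr_wpDr// subr_ge0.
have [->|xn1] := eqVneq x 1.
  rewrite /kl subrr mul0r addr0 mul1r div1r lnV ?posrE//.
  have h : 1 - t <= - ln t by have := ln_le_sub1 t0; lra.
  apply: le_trans h.
  rewrite ler_pdivrMr; last by nra.
  by nra.
have {}x1 : x < 1 by rewrite lt_neqAle xn1.
set V := t * (1 - t) + (x - t) in V0 *.
pose g y := kl y t - (y - t) ^+ 2 / (2 * V).
have gt : g t = 0 by rewrite /g subrr expr0n/= mul0r subr0 kl_refl.
suff : g t <= g x by rewrite gt /g subr_ge0.
apply: (@nondecreasing_is_derive g (fun y => ln (y / t) - ln ((1 - y) / (1 - t)) - (y - t) / V)) => //.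
  move=> y ty yx.
  have hk := @is_derive_kl y t (lt_le_trans t0 ty) (le_lt_trans yx x1) t0 t1.
  have i1 : is_derive y 1 (fun y : R => y - t) 1.
    by apply: is_derive_eq1 (is_deriveB1 (is_derive_id1 y) (is_derive_cst1 t y)) _; rewrite subr0.
  have i2 : is_derive y 1 (fun y : R => (y - t) ^+ 2 / (2 * V)) ((y - t) / V).
    apply: is_derive_eq1 (is_deriveM1 (is_deriveX1 2 i1) (is_derive_cst1 (2 * V)^-1 y)) _.
    by rewrite mulr0 add0r /=; field; rewrite !gt_eqF.
  exact: is_deriveB1 hk i2.
move=> y ty yx.
have y0 : 0 < y by lra.
have y1 : 0 < 1 - y by lra.
have t1' : 0 < 1 - t by rewrite subr_gt0.
rewrite -ln_div ?posrE ?divr_gt0//.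
have := @ln_ge_subV (y / t / ((1 - y) / (1 - t))).
rewrite !divr_gt0// => /(_ isT); rewrite -subr_ge0 => h.
rewrite subr_ge0; apply: le_trans (_ : 1 - (y / t / ((1 - y) / (1 - t)))^-1 <= _); last first.
  by rewrite -subr_ge0.
rewrite (_ : 1 - (y / t / ((1 - y) / (1 - t)))^-1 = (y - t) / (y * (1 - t))); last first.
  by field; rewrite !gt_eqF.
rewrite ler_wpM2l ?subr_ge0// lef_pV2 ?posrE ?mulr_gt0//.
rewrite /V; nra.
Qed.

End kl.

Section kl2.
Context {R : realType}.
Implicit Types a b c t u v x y : R.

Lemma kl_sym x t : kl (1 - x) (1 - t) = kl x t.
Proof. by rewrite /kl !subKr addrC. Qed.

Lemma is_derive_kl_ratio u y : 0 < u -> u < 1 -> 0 < y -> y <= 1 ->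
  is_derive y 1 (fun z => kl (z * u) u) (- u * ln (1 + (1 - y) / y / (1 - u))).
Proof.
move=> u0 u1 y0 y1.
have u1' : 0 < 1 - u by rewrite subr_gt0.
have yu1 : 0 < 1 - y * u by rewrite subr_gt0 (le_lt_trans _ u1)// ler_piMl// ltW.
have dyu : is_derive y 1 (fun z : R => z * u) u.
  apply: is_derive_eq1 (is_deriveM1 (is_derive_id1 y) (is_derive_cst1 u y)) _.
  by rewrite mulr0 add0r mulr1.
have dk := @is_derive_kl R (y * u) u (mulr_gt0 y0 u0) _ u0 u1.
rewrite -subr_gt0 in dk; have {}dk := dk yu1.
have h : is_derive y 1 (fun z => kl (z * u) u) _ :=
  @is_derive1_comp R (kl ^~ u) (fun z => z * u) y _ _ dk dyu.
apply: (is_derive_eq1 h).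
rewrite mulrC mulNr -mulrN; congr (_ * _).
rewrite mulfK ?gt_eqF// -ln_div ?posrE ?divr_gt0//.
rewrite (_ : y / ((1 - y * u) / (1 - u)) = (1 + (1 - y) / y / (1 - u))^-1).
  rewrite lnV// posrE ltr_pwDl//.
  by rewrite divr_ge0 ?(ltW u1')// divr_ge0 ?(ltW y0)// subr_ge0.
field; rewrite !gt_eqF//=.
by rewrite (_ : _ + _ = 1 - y * u)//; ring.
Qed.

(** Concavity of the logarithm between [1] and [1 + k / s]. *)
Lemma xln1DVx_le (s w k : R) : 0 < s -> s <= w -> 0 <= k ->
  s * ln (1 + k / s) <= w * ln (1 + k / w).
Proof.
move=> s0 sw k0; have w0 : 0 < w by lra.
have t0 : 0 <= s / w by rewrite divr_ge0// ltW.
have t1 : s / w <= 1 by rewrite ler_pdivrMr// mul1r.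
have ks : 0 < 1 + k / s by rewrite ltr_pwDl// divr_ge0// ltW.
have := @concave_ln R (Itv01 t0 t1) _ 1 ks ltr01.
rewrite !convRE/= ln1 mulr0 addr0 mulr1.
rewrite (_ : s / w * (1 + k / s) + (1 - s / w) = 1 + k / w); last first.
  by field; rewrite !gt_eqF.
move=> h; rewrite -ler_pdivrMl//.
by rewrite (le_trans _ h)// mulrA [_^-1 * s]mulrC.
Qed.

(** At a fixed ratio [c], the divergence grows at most linearly with the odds [u / (1 - u)].  Both sides agree for
    [c = 1], and the difference of their derivatives in [c] has the sign given by [xln1DVx_le]. *)
Lemma kl_odds_le c u v : 0 < c -> c <= 1 -> 0 < u -> u <= v -> v < 1 ->
  kl (c * v) v * ((1 - v) / v) <= kl (c * u) u * ((1 - u) / u).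
Proof.
move=> c0 c1 u0 uv v1; have v0 : 0 < v by lra.
have u1 : u < 1 by lra.
rewrite -subr_ge0.
pose D y := kl (y * v) v * ((1 - v) / v) - kl (y * u) u * ((1 - u) / u).
have D1 : D 1 = 0 by rewrite /D !mul1r !kl_refl// !mul0r subrr.
suff : D c <= D 1 by rewrite D1 /D -oppr_ge0 opprB.
apply: (@nondecreasing_is_derive R D
   (fun y => (1 - u) * ln (1 + (1 - y) / y / (1 - u)) - (1 - v) * ln (1 + (1 - y) / y / (1 - v)))) => //.
  move=> y cy y1; have y0 : 0 < y by lra.
  have du := @is_deriveM1 R _ _ y _ _ (is_derive_kl_ratio u0 u1 y0 y1) (is_derive_cst1 ((1 - u) / u) y).
  have dv := @is_deriveM1 R _ _ y _ _ (is_derive_kl_ratio v0 v1 y0 y1) (is_derive_cst1 ((1 - v) / v) y).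
  apply: (is_derive_eq1 (is_deriveB1 dv du)).
  move: (ln (1 + _ / _ / (1 - u))) (ln (1 + _ / _ / (1 - v))) => A B.
  by field; rewrite !gt_eqF.
move=> y cy y1; have y0 : 0 < y by lra.
rewrite subr_ge0 xln1DVx_le ?subr_gt0 ?divr_ge0 ?subr_ge0 ?(ltW y0)//; lra.
Qed.

(** Intermediate values between [c = 1] and a [c] close to [0]: [is_derive_kl_ratio] gives continuity
    away from [c = 0] only, so the lower end of the interval is chosen by hand. *)
Lemma exists_kl_ratio u h : 0 < u -> u < 1 -> 0 <= h -> h < kl 0 u ->
  exists c, [/\ 0 < c, c <= 1 & kl (c * u) u = h].
Proof.
move=> u0 u1 h0; set X := kl 0 u => hX.
have u1' : 0 < 1 - u by rewrite subr_gt0.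
have XE : X = - ln (1 - u).
  by rewrite /X /kl mul0r add0r subr0 mul1r div1r lnV.
have X0 : 0 < X by lra.
have [d [d0 d1 dX]] : exists d, [/\ 0 < d, d < 1 & d * (3 + X) <= X - h].
  exists ((X - h) / (3 + X)); split.
  - by rewrite divr_gt0//; lra.
  - by rewrite ltr_pdivrMr; lra.
  - by rewrite divfK// gt_eqF//; lra.
(* The square makes [e * ln e] of the order of [d], by [ln d >= 1 - 1 / d]. *)
pose e := d ^+ 2.
have e0 : 0 < e by rewrite exprn_gt0.
have ed : e <= d by rewrite /e expr2 ler_piMr// ltW.
have eu1 : 0 < 1 - e * u by nra.
have low : h <= kl (e * u) u.
  rewrite /kl mulfK ?gt_eqF// ln_div ?posrE//.
  have a1 : -(2 * d) <= e * u * ln e.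
    have ld := ln_ge_subV d0.
    have h1 : e * u * ln e = 2 * u * (d * (d * ln d)) by rewrite /e lnXn// -mulr_natr; ring.
    have h2 : d * (1 - d^-1) <= d * ln d by rewrite ler_pM2l.
    rewrite (_ : d * (1 - d^-1) = d - 1) in h2; last by field; rewrite gt_eqF.
    have h3 : d * (d - 1) <= d * (d * ln d) by rewrite ler_pM2l.
    have h4 : 2 * u * (d * (d - 1)) <= e * u * ln e by rewrite h1 ler_pM2l// mulr_gt0.
    apply: le_trans h4; nra.
  have a2 : - d <= (1 - e * u) * ln (1 - e * u).
    have h2 : (1 - e * u) * (1 - (1 - e * u)^-1) <= (1 - e * u) * ln (1 - e * u).
      by rewrite ler_pM2l// ln_ge_subV.
    apply: le_trans h2; rewrite (_ : _ * _ = - (e * u)); last by field; rewrite gt_eqF.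
    nra.
  have a3 : X - d * X <= (1 - e * u) * X.
    have : e * u <= d by nra.
    nra.
  move: a1 a2 a3; rewrite XE; nra.
have eu : e <= 1 by lra.
have cont : {within `[e, 1], continuous (fun z => kl (z * u) u)}.
  apply: derivable_within_continuous => y; rewrite in_itv/= => /andP[ey y1].
  by have := is_derive_kl_ratio u0 u1 (lt_le_trans e0 ey) y1; case.
have [|c] := @IVT R (fun z => kl (z * u) u) e 1 h eu cont.
  by rewrite mul1r kl_refl// ge_min h0 orbT/= le_max low.
rewrite in_itv/= => /andP[ec c1] ch; exists c; split => //.
exact: lt_le_trans ec.
Qed.

End kl2.

(** * Suprema of processes along grids *)

Section liminf_events.
Context d (T : measurableType d) (R : realType) (P : probability T R).

(** The limit inferior of a sequence of events. *)
Definition eventually_in (E : nat -> set T) : set T :=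
  \bigcup_M \bigcap_(N in [set k | (M <= k)%N]) E N.

Lemma measurable_eventually_in E : (forall N, measurable (E N)) ->
  measurable (eventually_in E).
Proof.
by move=> mE; apply: bigcup_measurable => M _; exact: bigcap_measurableType.
Qed.

(** Fatou's lemma for events: it passes to the limit in bounds obtained on grids that are not nested. *)
Lemma measure_eventually_in_le (E : nat -> set T) (B : nat -> R) (b : R) :
  (forall N, measurable (E N)) -> (forall N, (P (E N) <= (B N)%:E)%E) ->
  B @ \oo --> b -> (P (eventually_in E) <= b%:E)%E.
Proof.
move=> mE PE Bb.
pose F M := \bigcap_(N in [set k | (M <= k)%N]) E N.
have mF M : measurable (F M) by exact: bigcap_measurableType.
have PF M : (P (F M) <= b%:E)%E.
  rewrite -(@fineK _ (P (F M))) ?fin_num_measure// lee_fin.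
  have <- : limn B = b by exact: cvg_lim.
  apply: limr_ge; first by apply/cvg_ex; exists b.
  near=> n; rewrite -lee_fin fineK ?fin_num_measure//.
  apply: le_trans (PE n); apply: le_measure; rewrite ?inE// => w; apply.
  by rewrite /=; near: n; exact: nbhs_infty_ge.
have ndF : {homo F : x y / (x <= y)%N >-> (x <= y)%O}.
  move=> x y xy; apply/subsetPset => w Fw k /= yk; apply: Fw => /=.
  exact: leq_trans yk.
have cF : P (F M) @[M --> \oo] --> P (\bigcup_M F M).
  by apply: nondecreasing_cvg_mu => //; exact: bigcup_measurable.
rewrite -[P _](cvg_lim _ cF)//; apply: lime_le; last exact: nearW.
by apply/cvg_ex; eexists; exact: cF.
Unshelve. all: by end_near. Qed.

End liminf_events.

Section grid.
Context {R : realType}.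
Implicit Types a b t e : R.

Definition grid a b (N j : nat) : R := a + (b - a) * (j%:R / N.+1%:R).

Lemma grid_itv a b N j : a <= b -> (j <= N.+1)%N -> a <= grid a b N j <= b.
Proof.
move=> ab jN; have h : (j%:R / N.+1%:R : R) <= 1.
  by rewrite ler_pdivrMr ?ltr0n// mul1r ler_nat.
have h0 : 0 <= (j%:R / N.+1%:R : R) by rewrite divr_ge0.
have ba : 0 <= b - a by rewrite subr_ge0.
have h1 := mulr_ge0 ba h0; have h2 := ler_piMr ba h.
by rewrite /grid lerDl h1/= -lerBrDl.
Qed.

Lemma grid0 a b N : grid a b N 0 = a.
Proof. by rewrite /grid mul0r mulr0 addr0. Qed.

Lemma gridS a b N j : grid a b N j.+1 = grid a b N j + (b - a) / N.+1%:R.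
Proof. by rewrite /grid -[j.+1]addn1 natrD (mulrDl j%:R) mul1r mulrDr addrA. Qed.

Lemma grid_max a b N : grid a b N N.+1 = b.
Proof. by rewrite /grid divff ?pnatr_eq0// mulr1 addrC subrK. Qed.

Lemma grid_le a b N i j : a <= b -> (i <= j)%N -> grid a b N i <= grid a b N j.
Proof.
move=> ab ij; rewrite /grid lerD2l ler_wpM2l ?subr_ge0// ler_wpM2r//.
by rewrite ler_nat.
Qed.

Lemma near_step a b e : a <= b -> 0 < e -> \forall N \near \oo, (b - a) / N.+1%:R < e.
Proof.
move=> ab e0; near=> N.
rewrite ltr_pdivrMr ?ltr0n// mulrC -ltr_pdivrMr//.
apply: lt_le_trans (_ : N%:R <= _); last by rewrite ler_nat.
by near: N; exact: nbhs_infty_gtr.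
Unshelve. all: by end_near. Qed.

Lemma near_grid_right a b t e : a <= t -> t <= b -> 0 < e ->
  \forall N \near \oo, exists2 j, (j <= N.+1)%N & t <= grid a b N j < t + e.
Proof.
move=> at_ tb e0; have ab := le_trans at_ tb.
have := near_step ab e0; apply: filterS => N hN.
have ex : exists j, t <= grid a b N j by exists N.+1; rewrite grid_max.
have [j tj jmin] := ex_minnP ex.
have jN : (j <= N.+1)%N by apply: jmin; rewrite grid_max.
exists j => //; rewrite tj/=; case: j tj jmin jN => [|j] tj jmin jN.
  by move: tj; rewrite grid0; lra.
have jt : grid a b N j < t by rewrite ltNge; apply/negP => /jmin; rewrite ltnn.
by rewrite gridS ltrD.
Qed.

Lemma near_grid_left a b t e : a <= t -> t <= b -> 0 < e ->
  \forall N \near \oo, exists2 j, (j <= N.+1)%N & t - e < grid a b N j <= t.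
Proof.
move=> at_ tb e0; have ab := le_trans at_ tb.
have := near_step ab e0; apply: filterS => N hN.
have ex : exists j, (grid a b N j <= t) && (j <= N.+1)%N by exists 0%N; rewrite grid0 at_.
have bnd i : (grid a b N i <= t) && (i <= N.+1)%N -> (i <= N.+1)%N by case/andP.
have [j /andP[tj jN] jmax] := ex_maxnP ex bnd.
exists j => //; rewrite tj andbT; have [jN1|jN1] := eqVneq j N.+1.
  by move: tj; rewrite jN1 grid_max; lra.
have {}jN : (j < N.+1)%N by rewrite ltn_neqAle jN1.
have jt : t < grid a b N j.+1.
  rewrite ltNge; apply/negP => h; have := jmax j.+1; rewrite h jN => /(_ isT).
  by rewrite ltnn.
by rewrite ltrBlDr (lt_trans jt)// gridS ltrD2l.
Qed.

Lemma lt_ereal_sup_ex (A : set R) (f : R -> R) (e : R) :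
  (e%:E < ereal_sup [set (f t)%:E | t in A])%E <-> exists2 t, A t & e < f t.
Proof.
split=> [/ereal_sup_gt[_ [t At <-]]|[t At eft]].
  by rewrite lte_fin => ?; exists t.
apply: (@lt_le_trans _ _ (f t)%:E); first by rewrite lte_fin.
by apply: ereal_sup_ubound; exists t.
Qed.

End grid.

(** If the process exceeds a level on a nondegenerate interval to the right of each exceedance, then the exceedances of the
    supremum are seen by all fine enough grids; this covers empirical processes as well as continuous ones. *)
Section right_open_sup.
Context d (T : measurableType d) (R : realType).
Variables (X : R -> T -> R) (a b eta : R).
Hypothesis ab : a <= b.
Hypothesis mX : forall t, a <= t <= b -> measurable_fun setT (X t).
Hypothesis right_open : forall w t, a <= t <= b -> eta < X t w ->
  exists2 e : R, 0 < e & forall s, t <= s < t + e -> s <= b -> eta < X s w.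

Let E N := \bigcup_(j in [set j | (j <= N.+1)%N]) [set w | eta < X (grid a b N j) w].

Let mE N : measurable (E N).
Proof.
apply: bigcup_measurable => j jN.
have := mX (grid_itv ab jN) measurableT (measurable_itv `]eta, +oo[).
rewrite setTI; congr measurable.
by apply/seteqP; split => w/=; rewrite in_itv/= andbT.
Qed.

Lemma sup_grid_eventually w t : a <= t <= b -> eta < X t w -> eventually_in E w.
Proof.
move=> tab h; have [e e0 he] := right_open tab h; case/andP: tab => at_ tb.
have [M _ hM] := near_grid_right at_ tb e0.
exists M => // N /= MN; have [j jN hj] := hM N MN.
exists j => //=; apply: he => //.
by have /andP[] := grid_itv ab jN.
Qed.

Lemma measurable_right_open_sup :
  measurable [set w | (eta%:E < ereal_sup [set (X t w)%:E | t in `[a, b]])%E].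
Proof.
rewrite [X in measurable X](_ : _ = \bigcup_N E N); first exact: bigcup_measurable.
apply/seteqP; split => [w /lt_ereal_sup_ex[t tab h]|w [N _ [j jN hj]]].
  have [M _ h'] := sup_grid_eventually tab h.
  by exists M => //; apply: h' => /=.
by apply/lt_ereal_sup_ex; exists (grid a b N j) => //; exact: grid_itv.
Qed.

End right_open_sup.

(** * The uniform law and the empirical distribution function *)

Section uniform_law.
Context {R : realType}.
Let mu := uniform_prob (@ltr01 R).

Lemma uniform01_itv (A : set R) (i : interval R) (l : R) : measurable A ->
  A `&` `[0, 1]%classic = [set` i] -> lebesgue_measure [set` i] = l%:E ->
  mu A = l%:E.
Proof.
move=> mA Ai il; rewrite /mu /uniform_prob integral_uniform_pdf Ai.
rewrite (eq_integral (fun=> 1%:E)).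
  by rewrite integral_cst//= mul1e.
move=> x; rewrite inE -Ai => -[_]; rewrite /= in_itv/= /uniform_pdf => ->.
by rewrite subr0 invr1.
Qed.

Lemma uniform01_le t : 0 <= t -> t <= 1 -> mu `]-oo, t] = t%:E.
Proof.
move=> t0 t1; apply: (@uniform01_itv _ `[0, t]) => //.
  apply/seteqP; split => x /=; rewrite !in_itv/=; first by case=> -> /andP[->].
  by move=> /andP[x0 xt]; rewrite xt x0 (le_trans xt t1).
rewrite lebesgue_measure_itv/= lte_fin; case: ltP => [_|t0']; first by rewrite -EFinD subr0.
by congr EFin; apply/le_anti/andP.
Qed.

Lemma uniform01_gt t : 0 <= t -> t <= 1 -> mu `]t, +oo[ = (1 - t)%:E.
Proof.
move=> t0 t1; apply: (@uniform01_itv _ `]t, 1]) => //.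
  apply/seteqP; split => x /=; rewrite !in_itv/= ?andbT; first by case=> -> /andP[_ ->].
  by move=> /andP[tx x1]; rewrite tx x1 (le_trans t0 (ltW tx)).
rewrite lebesgue_measure_itv/= lte_fin; case: ltP => [_|t1']; first by rewrite -EFinD.
by congr EFin; apply/esym/eqP; rewrite subr_eq0; apply/eqP/le_anti/andP.
Qed.

End uniform_law.

Section ecdf_facts.
Context {R : realType} {n : nat}.
Implicit Types (u : 'I_n -> R) (t s : R).
Hypothesis n0 : (0 < n)%N.

Lemma ecdf_ge0 u t : 0 <= ecdf u t.
Proof. by rewrite divr_ge0// sumr_ge0. Qed.

Lemma ecdf_le1 u t : ecdf u t <= 1.
Proof.
rewrite ler_pdivrMr ?ltr0n// mul1r -[leRHS]mulr1n -[in leRHS](card_ord n).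
rewrite mulr1n -sum1_card natr_sum; apply: ler_sum => i _.
by case: (u i <= t).
Qed.

Lemma ecdf_le u t s : t <= s -> ecdf u t <= ecdf u s.
Proof.
move=> ts; rewrite ler_wpM2r//; apply: ler_sum => i _.
by rewrite ler_nat; case: (leP (u i) t) => // ut; rewrite (le_trans ut ts).
Qed.

Lemma count_le_ecdf u t :
  (\sum_(i < n) (u i \in (`]-oo, t]%classic : set R)))%:R = n%:R * ecdf u t :> R.
Proof.
rewrite /ecdf mulrC divfK ?pnatr_eq0 ?gt_eqF ?ltr0n// natr_sum.
by apply: eq_bigr => i _; rewrite mem_setE in_itv.
Qed.

Lemma count_gt_ecdf u t :
  (\sum_(i < n) (u i \in (`]t, +oo[%classic : set R)))%:R = n%:R * (1 - ecdf u t) :> R.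
Proof.
rewrite mulrBr mulr1 -count_le_ecdf -[in X in _ = X - _](card_ord n) -sum1_card.
rewrite !natr_sum -sumrB; apply: eq_bigr => i _.
by rewrite !mem_setE !in_itv/= andbT; case: leP => _; rewrite ?subrr ?subr0.
Qed.

Lemma near_ecdf_right u t : \forall s \near t^'+, ecdf u s = ecdf u t.
Proof.
have : \forall s \near t^'+, forall i, (u i <= s) = (u i <= t).
  apply: filter_forall => i; have [ut|tu] := leP (u i) t.
    near=> s; apply: le_trans ut _; apply: ltW; near: s; exact: nbhs_right_gt.
  near=> s; apply/negbTE; rewrite -ltNge; near: s; exact: nbhs_right_lt.
apply: filterS => s h; rewrite /ecdf; congr (_ / _).
by apply: eq_bigr => i _; rewrite h.
Unshelve. all: by end_near. Qed.

End ecdf_facts.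

Lemma measurable_ecdf {d : measure_display} {T : measurableType d} {R : realType}
    (P : probability T R) (n : nat) (U : 'I_n -> {RV P >-> R}) (t : R) :
  measurable_fun setT (fun w => ecdf (fun i => U i w) t).
Proof.
apply: measurable_funM => //; apply: measurable_sum => i.
rewrite (_ : (fun x => _) = (fun x => \1_(`]-oo, t]) (U i x))); last first.
  by apply/funext => x; rewrite indicE mem_setE in_itv.
by apply: measurableT_comp => //; exact: measurable_indic.
Qed.

(** Rephrases right neighbourhoods in the form in which [sup_grid_eventually] expects them. *)
Lemma near_right_ex {R : realType} (Q : R -> Prop) (t : R) : Q t ->
  (\forall s \near t^'+, Q s) ->
  exists2 e : R, 0 < e & forall s, t <= s < t + e -> Q s.
Proof.
move=> Qt [e /= e0 he]; exists e => // s /andP[]; rewrite le_eqVlt => /predU1P[<-//|ts] se.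
apply: he => //=; rewrite distrC ger0_norm ?subr_ge0 ?(ltW ts)//.
by rewrite ltrBlDr addrC.
Qed.

Section kl_measurable.
Context {R : realType}.

Lemma measurable_kl (t : R) : measurable_fun setT (kl ^~ t).
Proof.
have m1 : measurable_fun setT (fun x : R => ln (x / t)).
  by apply: measurableT_comp => //; exact: measurable_funM.
have m2 : measurable_fun setT (fun x : R => ln ((1 - x) / (1 - t))).
  by apply: measurableT_comp => //; apply: measurable_funM => //; exact: measurable_funB.
apply: measurable_funD; apply: measurable_funM => //; exact: measurable_funB.
Qed.

Lemma cvg_ln {S : Type} (F : set_system S) {FF : Filter F} (f : S -> R) (l : R) :
  0 < l -> f @ F --> l -> (fun s => ln (f s)) @ F --> ln l.
Proof. by move=> l0 fl; exact: (continuous_cvg _ (continuous_ln l0) fl). Qed.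

(** Together with [near_ecdf_right] this makes the Berk-Jones process right-continuous. *)
Lemma continuous_kl (x t : R) : 0 <= x -> x <= 1 -> 0 < t -> t < 1 ->
  {for t, continuous (kl x)}.
Proof.
move=> x0 x1 t0 t1; apply: cvgD.
  have [->|xn0] := eqVneq x 0; first by under eq_fun do rewrite mul0r; rewrite mul0r; exact: cvg_cst.
  have {}x0 : 0 < x by rewrite lt_neqAle eq_sym xn0.
  apply: cvgM; first exact: cvg_cst.
  apply: cvg_ln; first by rewrite divr_gt0.
  by apply: cvgM; [exact: cvg_cst|apply: cvgV; rewrite ?gt_eqF//; exact: cvg_id].
have [->|xn1] := eqVneq x 1; first by rewrite subrr; under eq_fun do rewrite mul0r; rewrite mul0r; exact: cvg_cst.
have {}x1 : 0 < 1 - x by rewrite subr_gt0 lt_neqAle xn1.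
have t1' : 0 < 1 - t by rewrite subr_gt0.
apply: cvgM; first exact: cvg_cst.
apply: cvg_ln; first by rewrite divr_gt0.
apply: cvgM; first exact: cvg_cst.
apply: cvgV; rewrite ?gt_eqF//.
by apply: cvgB; [exact: cvg_cst|exact: cvg_id].
Qed.

End kl_measurable.

(** * The supremum of the Berk-Jones process *)

(** The cut point [c] has odds [exp (1 / eta)] times those of [a]. *)
Section slices.
Context {d : measure_display} {T : measurableType d} {R : realType}.
Variables (P : probability T R) (n : nat) (U : 'I_n -> {RV P >-> R}).
Hypothesis n0 : (0 < n)%N.
Hypothesis iidU : iid_uniform01 U.

Let F (w : T) (t : R) : R := ecdf (fun i => U i w) t.
Let mu : probability (measurableTypeR R) R := uniform_prob (@ltr01 R).

(** [z] minimises the left-hand side of the equality, the Chernoff bound for a binomial lower tail. *)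
Lemma chernoff_kl (c s : R) : 0 < c -> c <= 1 -> 0 < s -> s < 1 ->
  let z := c * (1 - s) / (1 - c * s) in
  [/\ 0 < z, z <= 1 & z `^ (- (n%:R * c * s)) * (1 - s + s * z) ^+ n =
     expR (- (n%:R * kl (c * s) s))].
Proof.
move=> c0 c1 s0 s1 z.
have s1' : 0 < 1 - s by rewrite subr_gt0.
have cs1 : 0 < 1 - c * s by rewrite subr_gt0 (le_lt_trans _ s1)// ler_piMl// ltW.
have z0 : 0 < z by rewrite divr_gt0// mulr_gt0.
split => //; first by rewrite ler_pdivrMr// mul1r; nra.
have e1 : 1 - s + s * z = (1 - s) / (1 - c * s).
  by rewrite /z; field; rewrite gt_eqF.
rewrite e1 -[(1 - s) / _ in X in _ * X]lnK ?posrE ?divr_gt0// -expRM_natl.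
rewrite /powR gt_eqF// -expRD; congr expR.
rewrite /kl mulfK ?gt_eqF// /z !ln_div ?posrE ?mulr_gt0// lnM ?posrE//.
ring.
Qed.

Lemma nested_sets_kl (S : nat -> set R) (m : nat) (c : R) :
  (forall k, measurable (S k)) -> (forall k, S k.+1 `<=` S k) ->
  0 < c -> c <= 1 -> 0 < fine (mu (S m)) -> fine (mu (S m)) < 1 ->
  let E := [set w | exists2 k, (k <= m)%N &
    (\sum_(i < n) (U i w \in S k))%:R <= n%:R * c * fine (mu (S k))] in
  measurable E /\
  (P E <= (expR (- (n%:R * kl (c * fine (mu (S m))) (fine (mu (S m))))))%:E)%E.
Proof.
move=> mS nS c0 c1 s0 s1.
have [z0 z1 <-] := chernoff_kl c0 c1 s0 s1.
apply: (@nested_sets_doob _ _ _ P mu n U _ _ S m mS nS) => //.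
- by case: iidU.
- by move=> i A mA; case: iidU => _ /(_ i A mA).
- by rewrite !mulr_ge0// ltW.
- rewrite -[X in (_ < X)%E]fineK ?lte_fin//.
  by apply: fin_num_measure; exact: mS.
Qed.

(** Upward deviations of [F w] are downward deviations of the counts in the decreasing half-lines [(t, +oo)], so the
    bound is the one at the right end [b]. *)
Lemma gt_tail_slice (a b c : R) : 0 <= a -> a <= b -> 0 < b -> b < 1 -> 0 < c -> c <= 1 ->
  exists G, [/\ measurable G,
    forall w t, a <= t <= b -> 1 - F w t < c * (1 - t) -> G w &
    (P G <= (expR (- (n%:R * kl (c * (1 - b)) (1 - b))))%:E)%E].
Proof.
move=> a0 ab b0 b1 c0 c1.
pose S N (k : nat) : set R := `]grid a b N k, +oo[%classic.
pose E N := [set w | exists2 k, (k <= N.+1)%N &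
    (\sum_(i < n) (U i w \in S N k))%:R <= n%:R * c * fine (mu (S N k))].
have muS N k : (k <= N.+1)%N -> fine (mu (S N k)) = 1 - grid a b N k.
  move=> kN; have /andP[h1 h2] := grid_itv ab kN.
  have -> : mu (S N k) = (1 - grid a b N k)%:E by apply: uniform01_gt; lra.
  by [].
have EN N : measurable (E N) /\ (P (E N) <= (expR (- (n%:R * kl (c * (1 - b)) (1 - b))))%:E)%E.
  have := @nested_sets_kl (S N) N.+1 c _ _ c0 c1.
  rewrite muS// grid_max; apply; rewrite ?subr_gt0 ?gtrBl//.
  - by move=> k; exact: measurable_itv.
  - by move=> k x; rewrite /S/= !in_itv/= !andbT; apply: le_lt_trans; exact: grid_le.
exists (eventually_in E); split.
- by apply: measurable_eventually_in => N; case: (EN N).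
- move=> w t /andP[at_ tb] h.
  have e0 : 0 < (1 - t) - (1 - F w t) / c by rewrite subr_gt0 ltr_pdivrMr// mulrC.
  have [M _ hM] := near_grid_right at_ tb e0.
  exists M => // N /= MN; have [j jN /andP[tj jt]] := hM N MN.
  exists j => //; rewrite muS// /S count_gt_ecdf// -mulrA ler_pM2l ?ltr0n//.
  apply: (@le_trans _ _ (1 - F w t)); first by rewrite lerB// ecdf_le.
  rewrite mulrC -ler_pdivrMr//; lra.
- apply: (@measure_eventually_in_le _ _ _ P E (fun=> _)); last exact: cvg_cst.
  + by move=> N; case: (EN N).
  + by move=> N; case: (EN N).
Qed.

(** Downward deviations of [F w]: the half-lines [(-oo, t]] decrease when [t] does, so the grid is read from right to
    left and the bound is the one at the left end [a]. *)
Lemma lt_tail_slice (a b c : R) : 0 < a -> a <= b -> b <= 1 -> a < 1 -> 0 < c -> c <= 1 ->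
  exists G, [/\ measurable G,
    forall w t, a <= t <= b -> F w t < c * t -> G w &
    (P G <= (expR (- (n%:R * kl (c * a) a)))%:E)%E].
Proof.
move=> a0 ab b1 a1 c0 c1.
pose S N (k : nat) : set R := `]-oo, grid a b N (N.+1 - k)]%classic.
pose E N := [set w | exists2 k, (k <= N.+1)%N &
    (\sum_(i < n) (U i w \in S N k))%:R <= n%:R * c * fine (mu (S N k))].
have muS N k : fine (mu (S N k)) = grid a b N (N.+1 - k).
  have /andP[h1 h2] := grid_itv ab (leq_subr k N.+1).
  have -> : mu (S N k) = (grid a b N (N.+1 - k))%:E by apply: uniform01_le; lra.
  by [].
have EN N : measurable (E N) /\ (P (E N) <= (expR (- (n%:R * kl (c * a) a)))%:E)%E.
  have := @nested_sets_kl (S N) N.+1 c _ _ c0 c1.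
  rewrite muS// subnn grid0; apply => //.
  - by move=> k; exact: measurable_itv.
  - move=> k x; rewrite /S/= !in_itv/= => /le_trans; apply; apply: grid_le => //.
    exact: leq_sub2l.
exists (eventually_in E); split.
- by apply: measurable_eventually_in => N; case: (EN N).
- move=> w t /andP[at_ tb] h.
  have e0 : 0 < t - F w t / c by rewrite subr_gt0 ltr_pdivrMr// mulrC.
  have [M _ hM] := near_grid_left at_ tb e0.
  exists M => // N /= MN; have [j jN /andP[tj jt]] := hM N MN.
  exists (N.+1 - j)%N; first exact: leq_subr.
  rewrite muS subKn// /S subKn// count_le_ecdf// -mulrA ler_pM2l ?ltr0n//.
  apply: (@le_trans _ _ (F w t)); first by rewrite ecdf_le.
  rewrite mulrC -ler_pdivrMr//; lra.
- apply: (@measure_eventually_in_le _ _ _ P E (fun=> _)); last exact: cvg_cst.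
  + by move=> N; case: (EN N).
  + by move=> N; case: (EN N).
Qed.

(** [c] is the ratio for which [n kl] equals [eta] at [v].  Going from [v] down to [u] divides the odds by at most
    [exp (1 / eta)], hence by [kl_odds_le] also the divergence, and [eta * exp (- 1 / eta) >= eta - 1]. *)
Lemma ratio_slice (u v eta : R) : 0 < u -> u <= v -> v < 1 -> 0 < eta ->
  v * (1 - u) <= expR eta^-1 * (u * (1 - v)) -> eta / n%:R < kl 0 v ->
  exists c, [/\ 0 < c, c <= 1,
    forall r s, 0 <= r -> r <= 1 -> 0 < s -> s <= v -> eta < n%:R * kl (r * s) s -> r < c &
    expR (- (n%:R * kl (c * u) u)) <= expR (1 - eta)].
Proof.
move=> u0 uv v1 eta0 odds big.
have v0 : 0 < v by lra.
have nR : 0 < n%:R :> R by rewrite ltr0n.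
have [c [c0 c1 hc]] := exists_kl_ratio v0 v1 (ltW (divr_gt0 eta0 nR)) big.
exists c; split => //.
  move=> r s r0 r1 s0 sv; rewrite -ltr_pdivrMl// mulrC => h.
  rewrite ltNge; apply/negP => cr; move: h; apply/negP; rewrite -leNgt.
  apply: le_trans (kl_proportional_le r0 r1 s0 sv v1) _.
  by rewrite -hc; apply: kl_ratio_le => //; exact: ltW.
rewrite ler_expR lerNl opprB.
have h := kl_odds_le c0 c1 u0 uv v1; rewrite hc in h.
have k0 : 0 <= kl (c * u) u.
  by rewrite kl_ge0// ?mulr_ge0 ?(ltW c0) ?(ltW u0)//; nra.
have u1' : 0 < 1 - u by lra.
have v1' : 0 < 1 - v by lra.
have {}h : eta / n%:R <= expR eta^-1 * kl (c * u) u.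
  apply: le_trans (_ : kl (c * u) u * ((v * (1 - u)) / (u * (1 - v))) <= _); last first.
    by rewrite mulrC ler_wpM2r// ler_pdivrMr// mulr_gt0.
  have -> : v * (1 - u) / (u * (1 - v)) = (1 - u) / u / ((1 - v) / v).
    by field; rewrite !gt_eqF.
  by rewrite mulrA ler_pdivlMr// divr_gt0.
have {}h : eta <= expR eta^-1 * (n%:R * kl (c * u) u).
  by rewrite mulrCA -ler_pdivrMl// mulrC.
have : expR (- eta^-1) * eta <= n%:R * kl (c * u) u.
  by rewrite expRN ler_pdivrMl// ?expR_gt0.
apply: le_trans.
have := expR_ge1Dx (- eta^-1); rewrite -(ler_pM2r eta0) mulrDl mulNr mulVf ?gt_eqF//.
by rewrite mul1r.
Qed.

(** The level may be out of reach: when [eta / n] is at least the divergence of [0], the corresponding deviation is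
    impossible and the event is empty. *)
Lemma slice (a b eta : R) : 0 < a -> a <= b -> b < 1 -> 0 < eta ->
  b * (1 - a) <= expR eta^-1 * (a * (1 - b)) ->
  exists G, [/\ measurable G,
    forall w t, a <= t <= b -> eta < n%:R * kl (F w t) t -> G w &
    (P G <= (2 * expR (1 - eta))%:E)%E].
Proof.
move=> a0 ab b1 eta0 odds.
have nR : 0 < n%:R :> R by rewrite ltr0n.
have [Gu [mGu hGu PGu]] : exists G, [/\ measurable G,
    forall w t, a <= t <= b -> t <= F w t -> eta < n%:R * kl (F w t) t -> G w &
    (P G <= (expR (1 - eta))%:E)%E].
  have [big|small] := ltP (eta / n%:R) (kl 0 (1 - a)); last first.
    exists set0; split => //; last by rewrite measure0 lee_fin expR_ge0.
    move=> w t /andP[at_ tb] tF; rewrite ltNge => /negP; apply.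
    rewrite -ler_pdivlMl// mulrC (le_trans _ small)// -kl_sym.
    have t1 : 0 < 1 - t by lra.
    rewrite -[1 - F w t](@divfK _ (1 - t)) ?gt_eqF//.
    have F1 := ecdf_le1 n0 (fun i => U i w) t.
    have q0 : 0 <= (1 - F w t) / (1 - t) by rewrite divr_ge0 ?(ltW t1)// subr_ge0.
    have q1 : (1 - F w t) / (1 - t) <= 1 by rewrite ler_pdivrMr// mul1r; lra.
    apply: le_trans (kl_proportional_le q0 q1 t1 (_ : _ <= 1 - a) _) _; [lra|lra|].
    have := @kl_ratio_le R 0 _ (1 - a) _ _ (lexx 0) q0 q1; rewrite mul0r; apply; lra.
  have [||||c [c0 c1 hc he]] := @ratio_slice (1 - b) (1 - a) eta _ _ _ eta0 _ big; try lra.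
  have [||G [mG GE PG]] := @gt_tail_slice a b c _ ab _ b1 c0 c1; try lra.
  exists G; split => //; last by rewrite (le_trans PG)// lee_fin.
  move=> w t /andP[at_ tb] tF h; apply: (GE w t); first by rewrite at_ tb.
  have t1 : 0 < 1 - t by lra.
  have F1 := ecdf_le1 n0 (fun i => U i w) t.
  have q0 : 0 <= (1 - F w t) / (1 - t) by rewrite divr_ge0 ?(ltW t1)// subr_ge0.
  have q1 : (1 - F w t) / (1 - t) <= 1 by rewrite ler_pdivrMr// mul1r; lra.
  rewrite -ltr_pdivrMr//; apply: (hc _ (1 - t)) => //; first by lra.
  by rewrite divfK ?gt_eqF// kl_sym.
have [Gl [mGl hGl PGl]] : exists G, [/\ measurable G,
    forall w t, a <= t <= b -> F w t <= t -> eta < n%:R * kl (F w t) t -> G w &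
    (P G <= (expR (1 - eta))%:E)%E].
  have [big|small] := ltP (eta / n%:R) (kl 0 b); last first.
    exists set0; split => //; last by rewrite measure0 lee_fin expR_ge0.
    move=> w t /andP[at_ tb] tF; rewrite ltNge => /negP; apply.
    rewrite -ler_pdivlMl// mulrC (le_trans _ small)//.
    have t0 : 0 < t by lra.
    rewrite -[F w t](@divfK _ t) ?gt_eqF//.
    have F0 := ecdf_ge0 (fun i => U i w) t.
    have q0 : 0 <= F w t / t by rewrite divr_ge0// ltW.
    have q1 : F w t / t <= 1 by rewrite ler_pdivrMr// mul1r.
    apply: le_trans (kl_proportional_le q0 q1 t0 tb b1) _.
    have := @kl_ratio_le R 0 _ b _ b1 (lexx 0) q0 q1; rewrite mul0r; apply; lra.
  have [c [c0 c1 hc he]] := @ratio_slice a b eta a0 ab b1 eta0 odds big.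
  have [||G [mG GE PG]] := @lt_tail_slice a b c a0 ab _ _ c0 c1; try lra.
  exists G; split => //; last by rewrite (le_trans PG)// lee_fin.
  move=> w t /andP[at_ tb] tF h; apply: (GE w t); first by rewrite at_ tb.
  have t0 : 0 < t by lra.
  have F0 := ecdf_ge0 (fun i => U i w) t.
  have q0 : 0 <= F w t / t by rewrite divr_ge0// ltW.
  have q1 : F w t / t <= 1 by rewrite ler_pdivrMr// mul1r.
  rewrite -ltr_pdivrMr//; apply: (hc _ t) => //.
  by rewrite divfK ?gt_eqF.
exists (Gu `|` Gl); split; first exact: measurableU.
  move=> w t tab h; have [tF|/ltW tF] := leP t (F w t).
    by left; exact: hGu h.
  by right; exact: hGl h.
apply: le_trans (measureU2 _ mGu mGl) _.
rewrite mulr_natl mulr2n EFinD; exact: leeD.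
Qed.

Lemma slices (m : nat) (a b eta : R) : 0 < a -> a <= b -> b < 1 -> 0 < eta ->
  b * (1 - a) <= expR (m.+1%:R / eta) * (a * (1 - b)) ->
  exists G, [/\ measurable G,
    forall w t, a <= t <= b -> eta < n%:R * kl (F w t) t -> G w &
    (P G <= (m.+1%:R * (2 * expR (1 - eta)))%:E)%E].
Proof.
elim: m a b => [|m ih] a b a0 ab b1 eta0 odds.
  by rewrite mul1r; apply: slice => //; move: odds; rewrite mul1r.
have [short|long] := leP (b * (1 - a)) (expR eta^-1 * (a * (1 - b))).
  have [G [mG hG PG]] := slice a0 ab b1 eta0 short.
  exists G; split => //; apply: le_trans PG _; rewrite lee_fin.
  by rewrite ler_peMl ?ler1n// mulr_ge0// expR_ge0.
set r := expR eta^-1 in long *.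
have r1 : 1 < r by rewrite expR_gt1 invr_gt0.
have D0 : 0 < 1 - a + r * a by nra.
pose c := r * a / (1 - a + r * a).
have cE : 1 - c = (1 - a) / (1 - a + r * a) by rewrite /c; field; rewrite gt_eqF.
have h0 : 0 <= a * (1 - a) * (r - 1) by rewrite !mulr_ge0//; lra.
have ac : a <= c by rewrite /c ler_pdivlMr//; nra.
have cb : c <= b by rewrite /c ler_pdivrMr//; nra.
have c1 : c < 1 by lra.
have [G1 [mG1 hG1 PG1]] : exists G, [/\ measurable G,
    forall w t, a <= t <= c -> eta < n%:R * kl (F w t) t -> G w &
    (P G <= (2 * expR (1 - eta))%:E)%E].
  apply: slice => //; rewrite cE /c -/r le_eqVlt; apply/orP; left; apply/eqP.
  by field; rewrite gt_eqF.
have [||G2 [mG2 hG2 PG2]] := @ih c b _ cb b1 eta0; try lra.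
  rewrite cE /c.
  rewrite (_ : b * ((1 - a) / (1 - a + r * a)) = b * (1 - a) / (1 - a + r * a)); last by ring.
  rewrite (_ : expR _ * _ =
    expR (m.+1%:R / eta) * (r * a * (1 - b)) / (1 - a + r * a)); last by ring.
  rewrite ler_pM2r ?invr_gt0//; move: odds.
  by rewrite -[m.+2]addn1 natrD mulrDl mul1r expRD -/r !mulrA.
exists (G1 `|` G2); split; first exact: measurableU.
  move=> w t /andP[at_ tb] h; have [tc|/ltW ct] := leP t c.
    by left; apply: (hG1 w t) => //; rewrite at_.
  by right; apply: (hG2 w t) => //; rewrite ct.
apply: le_trans (measureU2 _ mG1 mG2) _.
rewrite -[m.+2]add1n natrD mulrDl mul1r EFinD; exact: leeD.
Qed.

(** The number of slices is the integer part of [eta L] plus one. *)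
Lemma berk_jones_sup (a b eta : R) : 0 < a -> a < b -> b < 1 -> 0 < eta ->
  let E := [set w | (eta%:E < ereal_sup [set (n%:R * kl (F w t) t)%:E | t in `[a, b]])%E] in
  measurable E /\
  (P E <= (2 * expR 1 * (eta * ln (b * (1 - a) / (a * (1 - b))) + 1) * expR (- eta))%:E)%E.
Proof.
move=> a0 ab b1 eta0 E.
have mE : measurable E.
  apply: (@measurable_right_open_sup _ _ _ (fun t w => n%:R * kl (F w t) t)).
  - exact: ltW.
  - move=> t _; apply: measurable_funM => //.
    exact: (measurableT_comp (measurable_kl t) (measurable_ecdf U t)).
  - move=> w t /andP[at_ tb] h.
    suff [e e0 he] : exists2 e : R, 0 < e & forall s, t <= s < t + e -> eta < n%:R * kl (F w s) s.
      by exists e => // s hs _; exact: he.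
    apply: near_right_ex => //.
    near=> s.
    have -> : F w s = F w t by near: s; exact: near_ecdf_right.
    near: s; apply: (cvgr_gt (n%:R * kl (F w t) t)) => //.
    apply: cvg_at_right_filter; apply: cvgM; first exact: cvg_cst.
    by apply: continuous_kl; [exact: ecdf_ge0|exact: ecdf_le1|lra|lra].
split => //.
have a1 : 0 < 1 - a by lra.
have b0 : 0 < b by lra.
have b1' : 0 < 1 - b by lra.
set L := ln _.
have od : 1 <= b * (1 - a) / (a * (1 - b)) by rewrite ler_pdivlMr ?mulr_gt0// mul1r; nra.
have L0 : 0 <= L by apply: ln_ge0.
have eL0 : 0 <= eta * L by rewrite mulr_ge0// ltW.
pose m := Num.truncn (eta * L).
have /andP[m1 m2] := truncn_itv eL0; rewrite -/m in m1 m2.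
have [|G [mG hG PG]] := @slices m a b eta a0 (ltW ab) b1 eta0.
  rewrite -ler_pdivrMr ?mulr_gt0// -[leLHS]lnK; last first.
    by rewrite posrE (lt_le_trans _ od).
  by rewrite ler_expR -/L ler_pdivlMr// mulrC ltW.
apply: (@le_trans _ _ (P G)).
  apply: le_measure; rewrite ?inE// => w /lt_ereal_sup_ex[t]; rewrite /= in_itv/=.
  exact: hG.
apply: le_trans PG _; rewrite lee_fin expRD.
rewrite (_ : 2 * expR 1 * (eta * L + 1) * expR (- eta) =
  (eta * L + 1) * (2 * (expR 1 * expR (- eta)))); last by ring.
rewrite ler_wpM2r ?mulr_ge0 ?expR_ge0// -natr1.
by rewrite lerD2r.
Unshelve. all: by end_near. Qed.

End slices.

(** * Order statistics *)

Section order_statistics.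
Context {R : realType} {n : nat}.
Implicit Types (p : 'I_n -> R) (x : R) (i : nat).

Let srt p := sort <=%R (codom p).

Let size_srt p : size (srt p) = n.
Proof. by rewrite size_sort size_codom card_ord. Qed.

Let sorted_srt p : sorted <=%R (srt p).
Proof. by apply: sort_sorted; exact: le_total. Qed.

Lemma order_stat_in p i : (0 < i <= n)%N -> exists j, order_stat p i = p j.
Proof.
case/andP=> i0 iN; have : order_stat p i \in srt p.
  by rewrite mem_nth// size_srt prednK.
by rewrite mem_sort => /codomP[j ->]; exists j.
Qed.

Lemma count_srt p x : \sum_(j < n) (p j <= x)%R%:R = (count (<= x) (srt p))%:R :> R.
Proof.
rewrite count_sort count_map -sum1_count natr_sum big_enum_cond/= [RHS]big_mkcond/=.
by apply: eq_bigr => j _; case: (p j <= x).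
Qed.

Lemma order_stat_le p i x : (0 < i <= n)%N ->
  (order_stat p i <= x) = (i <= count (<= x) (srt p))%N.
Proof.
case/andP=> i0 iN; rewrite /order_stat -/(srt p).
have s_i : (i.-1 < size (srt p))%N by rewrite size_srt prednK.
have mono j k : (j <= k)%N -> (k < size (srt p))%N -> nth 0 (srt p) j <= nth 0 (srt p) k.
  move=> jk ks; apply: (sorted_leq_nth (@le_trans _ R) (@lexx _ R) 0 (sorted_srt p)) => //.
  by rewrite inE (leq_ltn_trans jk ks).
apply/idP/idP => h.
  rewrite -(cat_take_drop i (srt p)) count_cat.
  apply: leq_trans (leq_addr _ _).
  have st : size (take i (srt p)) = i by rewrite size_takel// size_srt.
  rewrite -[leqLHS]st; suff /eqP -> : count (<= x) (take i (srt p)) == size (take i (srt p)) by [].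
  rewrite -all_count; apply/(all_nthP 0) => j; rewrite st => ji.
  by rewrite nth_take//= (le_trans _ h)// mono// -ltnS prednK.
rewrite leNgt; apply/negP => xs.
move: h; rewrite -(cat_take_drop i.-1 (srt p)) count_cat.
rewrite [X in (_ + X)%N](_ : _ = 0%N); last first.
  apply/eqP; rewrite -leqn0 leqNgt -has_count; apply/negP => /(has_nthP 0)[j].
  rewrite size_drop => jd; rewrite nth_drop/= leNgt => /negP; apply.
  apply: lt_le_trans xs _; apply: mono; first exact: leq_addr.
  by rewrite -ltn_subRL.
rewrite addn0 leqNgt => /negP; apply.
apply: leq_ltn_trans (count_size _ _) _.
by rewrite size_takel ?prednK// size_srt; apply: leq_trans iN; exact: leq_pred.
Qed.

(** The quantile transform; it also reduces the measurability of order statistics to that of [ecdf]. *)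
Lemma order_stat_ecdf p i x : (0 < i <= n)%N ->
  (order_stat p i <= x) = (i%:R / n%:R <= ecdf p x).
Proof.
move=> iN; rewrite order_stat_le// /ecdf ler_pM2r; last first.
  by rewrite invr_gt0 ltr0n; case/andP: iN => /leq_trans h /h.
by rewrite count_srt ler_nat.
Qed.

Lemma ecdf_order_stat p i : (0 < i <= n)%N -> i%:R / n%:R <= ecdf p (order_stat p i).
Proof. by move=> iN; rewrite -order_stat_ecdf. Qed.

End order_statistics.

Lemma lt_bigmaxe {R : realType} (m k : nat) (f : nat -> \bar R) (e : R) :
  (e%:E < \big[maxe/-oo]_(m <= i < k) f i)%E <->
  exists2 i, (m <= i < k)%N & (e%:E < f i)%E.
Proof.
have H (s : seq nat) : (e%:E < \big[maxe/-oo]_(i <- s) f i)%E = has (fun i => (e%:E < f i)%E) s.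
  by elim: s => [|i s ih]; rewrite ?big_nil ?big_cons//= lt_max ih.
rewrite H; split=> [/hasP[i]|[i im h]].
  by rewrite mem_index_iota => im h; exists i.
by apply/hasP; exists i => //; rewrite mem_index_iota.
Qed.

(** The inverse is discontinuous at [0]; writing it as [x * (x ^+ 2)^-1] reduces its measurability to that of real
    powers. *)
Lemma measurable_invr {R : realType} : measurable_fun setT (@GRing.inv R).
Proof.
rewrite (_ : @GRing.inv R = (fun x => x * (x ^+ 2) `^ (-1))).
  apply: measurable_funM => //.
  have mx2 : measurable_fun setT (fun x : R => x ^+ 2) by exact: measurable_funX.
  exact: (measurableT_comp (measurable_powR (-1)) mx2).
apply/funext => x; rewrite powR_inv1 ?sqr_ge0//.
have [->|x0] := eqVneq x 0; first by rewrite invr0 mul0r.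
by field.
Qed.

Lemma measurable_sqrtr {R : realType} : measurable_fun setT (@Num.sqrt R).
Proof. by apply: continuous_measurable_fun; exact: sqrt_continuous. Qed.

Section statistics_measurable.
Context {d : measure_display} {T : measurableType d} {R : realType}.
Variables (P : probability T R) (n : nat) (U : 'I_n -> {RV P >-> R}).
Hypothesis n0 : (0 < n)%N.

Lemma measurable_order_stat k : (0 < k <= n)%N ->
  measurable_fun setT (fun w => order_stat (fun i => U i w) k).
Proof.
move=> kn; apply: (measurability _ (RGenOInfty.measurableE R)) => _ [_ [x ->] <-].
rewrite setTI.
have := measurable_ecdf U x measurableT (measurable_itv `]-oo, k%:R / n%:R[).
rewrite setTI; congr measurable.
apply/seteqP; split => w/=; rewrite !in_itv/= andbT.
  by rewrite ltNge -order_stat_ecdf// -ltNge.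
by rewrite ltNge order_stat_ecdf// -ltNge.
Qed.

Lemma measurable_gt_bigmaxe (g : nat -> T -> R) (m k : nat) (eta : R) :
  (forall i, (m <= i < k)%N -> measurable_fun setT (g i)) ->
  measurable [set w | (eta%:E < \big[maxe/-oo]_(m <= i < k) (g i w)%:E)%E].
Proof.
move=> mg; rewrite [X in measurable X](_ : _ =
    \bigcup_(i in [set i | (m <= i < k)%N]) (g i @^-1` `]eta, +oo[)).
  apply: bigcup_measurable => i ik; rewrite -[X in measurable X]setTI.
  exact: mg.
apply/seteqP; split => w.
  by move=> /= /lt_bigmaxe[i ik h]; exists i => //=; rewrite in_itv/= andbT.
by case=> i ik; rewrite /= in_itv/= andbT => h; apply/lt_bigmaxe; exists i.
Qed.

Let os w k := order_stat (fun i => U i w) k.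

Let half_le k : (1 <= k < n./2.+1)%N -> (0 < k <= n)%N.
Proof.
case/andP=> -> /=; rewrite ltnS => h; apply: leq_trans h _.
by rewrite -divn2 leq_div.
Qed.

Lemma measurable_HC_gt eta : measurable [set w | (eta%:E < HC (fun i => U i w))%E].
Proof.
apply: (@measurable_gt_bigmaxe (fun k w => (Num.sqrt n%:R * ((k%:R / n%:R - os w k) /
      Num.sqrt (os w k * (1 - os w k)))))) => k /half_le kn.
have mo := measurable_order_stat kn.
apply: measurable_funM => //; apply: measurable_funM; first exact: measurable_funB.
apply: (measurableT_comp measurable_invr).
by apply: (measurableT_comp measurable_sqrtr); apply: measurable_funM => //; exact: measurable_funB.
Qed.

Lemma measurable_BJ_gt eta : measurable [set w | (eta%:E < BJ (fun i => U i w))%E].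
Proof.
apply: (@measurable_gt_bigmaxe (fun k w => ((k%:R * ln (k%:R / (n%:R * os w k)) +
      (n%:R - k%:R) * ln ((1 - k%:R / n%:R) / (1 - os w k))) *
     (os w k < k%:R / n%:R)%R%:R))) => k /half_le kn.
have mo := measurable_order_stat kn.
apply: measurable_funM.
  apply: measurable_funD; apply: measurable_funM => //; apply: measurableT_comp => //;
    apply: measurable_funM => //; apply: (measurableT_comp measurable_invr).
  - exact: measurable_funM.
  - exact: measurable_funB.
rewrite (_ : (fun x => _) = (fun x => \1_(`]-oo, k%:R / n%:R[) (os x k))); last first.
  by apply/funext => x; rewrite indicE mem_setE in_itv.
by apply: measurableT_comp => //; exact: measurable_indic.
Qed.

Lemma some_le_measurable (a : R) : measurable [set w | exists i, U i w <= a].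
Proof.
rewrite [X in measurable X](_ : _ = \bigcup_(i in [set: 'I_n]) (U i @^-1` `]-oo, a])).
  by apply: fin_bigcup_measurable => // i _; rewrite -[X in measurable X]setTI; exact: measurable_funPT.
by apply/seteqP; split => [w [i h]|w [i _]]; [exists i => //=; rewrite in_itv|rewrite /= in_itv/=; exists i].
Qed.

Lemma some_le_prob (a : R) : iid_uniform01 U -> 0 <= a -> a <= 1 ->
  (P [set w | exists i, (U i w <= a)%R] <= (n%:R * a)%:E)%E.
Proof.
move=> [_ lawU] a0 a1.
apply: (@le_trans _ _ (P (\big[setU/set0]_(i < n) (U i @^-1` `]-oo, a])))).
  apply: le_measure; rewrite ?inE//; first exact: some_le_measurable.
    by apply: bigsetU_measurable => i _; rewrite -[X in measurable X]setTI; exact: measurable_funPT.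
  move=> w [i h]; rewrite -bigcup_pred; exists i; last by rewrite /= in_itv.
  by rewrite /= unfold_in.
apply: le_trans (measure_bigsetU_le _ _ _ _) _.
  by move=> i; rewrite -[X in measurable X]setTI; exact: measurable_funPT.
rewrite (eq_bigr (fun=> a%:E)); last first.
  by move=> i _; rewrite -(uniform01_le a0 a1); exact: lawU.
by rewrite sumEFin lee_fin sumr_const card_ord mulr_natl.
Qed.

End statistics_measurable.

(** * The tail of the Berk-Jones statistic *)

Section analysis_bounds.
Context {R : realType}.
Implicit Types (x y t : R).

Lemma kl_mono t x y : 0 < t -> t < 1 -> t <= x -> x <= y -> y <= 1 -> kl x t <= kl y t.
Proof.
move=> t0 t1 tx xy y1; have [xt|xt] := eqVneq x t.
  by rewrite xt kl_refl// kl_ge0//; lra.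
have {}tx : t < x by rewrite lt_neqAle eq_sym xt.
have ty : 0 < y - t by lra.
have := @kl_convex R ((x - t) / (y - t)) y t.
rewrite (_ : _ / _ * y + _ = x); last by field; rewrite gt_eqF.
have r1 : (x - t) / (y - t) <= 1 by rewrite ler_pdivrMr// mul1r; lra.
move=> h; apply: le_trans (h _ r1 _ y1 t0 t1) _.
- by rewrite divr_gt0//; lra.
- lra.
- by rewrite ler_piMl// kl_ge0//; lra.
Qed.

Lemma exp1_le4 : expR 1 <= 4 :> R.
Proof.
have h : expR (2^-1) <= 2 :> R.
  have := @expR_ge1Dx R (- 2^-1); rewrite expRN => h.
  have {}h : 2^-1 <= (expR 2^-1)^-1 :> R by apply: le_trans h; lra.
  by move: h; rewrite lef_pV2 ?posrE ?expR_gt0.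
rewrite [X in expR X](_ : 1 = 2%:R * 2^-1 :> R); last by field.
rewrite expRM_natl (_ : 4 = 2 ^+ 2); last by ring.
by rewrite ler_pXn2r ?nnegrE ?expR_ge0.
Qed.

(** The [k]-th power of [y <= exp y] for [y = c * x / k]. *)
Lemma pow_le_exp (k : nat) (c x : R) : (0 < k)%N -> 0 < c -> 0 <= x ->
  x ^+ k <= (k%:R / c) ^+ k * expR (c * x).
Proof.
move=> k0 c0 x0; have kR : 0 < k%:R :> R by rewrite ltr0n.
have h : c * x / k%:R <= expR (c * x / k%:R).
  by apply: le_trans (expR_ge1Dx _); rewrite lerDr.
have h2 : (c * x / k%:R) ^+ k <= expR (c * x).
  rewrite [X in expR X](_ : c * x = k%:R * (c * x / k%:R)); last by field; rewrite gt_eqF.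
  have q0 : 0 <= c * x / k%:R by rewrite divr_ge0// mulr_ge0// ltW.
  by rewrite expRM_natl ler_pXn2r ?nnegrE ?expR_ge0.
rewrite (_ : x ^+ k = (k%:R / c) ^+ k * (c * x / k%:R) ^+ k); last first.
  by rewrite -exprMn; congr (_ ^+ _); field; rewrite !gt_eqF.
by rewrite ler_wpM2l// exprn_ge0// divr_ge0// ltW.
Qed.

End analysis_bounds.

Section berk_jones_tail.
Context {d : measure_display} {T : measurableType d} {R : realType}.
Variables (P : probability T R) (n : nat) (U : 'I_n -> {RV P >-> R}).
Hypothesis iidU : iid_uniform01 U.

Lemma berk_jones_tail (K eta : R) : (0 < n)%N -> 1 < K -> 0 < eta ->
  (P [set w | eta%:E < BJ (fun i => U i w)]
   <= (22 * K * ln n%:R * (eta + 1) * expR (- eta) + 2 * n%:R `^ (1 - K))%:E)%E.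
Proof.
move=> n0 K1 eta0; have [n1|n1] := leqP n 1.
  rewrite (_ : [set w | _] = set0); last first.
    apply/seteqP; split => // w /lt_bigmaxe[i /andP[i1 i2] _].
    have n2 : n./2 = 0%N by move: n1 n0; case: (n) => [|[|]].
    by move: i2; rewrite n2 ltnS leqNgt i1.
  rewrite measure0 lee_fin (_ : n = 1%N); last by apply/eqP; rewrite eqn_leq n1 n0.
  by rewrite ln1 mulr0 !mul0r add0r mulr_ge0// powR_ge0.
have nR : 2 <= n%:R :> R by rewrite (ler_nat R 2 n).
have np : 0 < n%:R :> R by lra.
set l := ln n%:R.
have l2 : 2^-1 <= l.
  have := ln_ge_subV np; apply: le_trans.
  have : n%:R^-1 <= 2^-1 :> R by rewrite lef_pV2 ?posrE.
  by lra.
pose a : R := n%:R `^ (- K).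
have aE : a = expR (- (K * l)) by rewrite /a /powR gt_eqF// mulNr.
have a0 : 0 < a by rewrite aE expR_gt0.
have na : n%:R * a = n%:R `^ (1 - K).
  rewrite aE /powR gt_eqF// mulrBl mul1r expRD -/l.
  by rewrite /l lnK ?posrE.
have ahalf : a < 2^-1.
  apply: (@lt_le_trans _ _ n%:R^-1); last by rewrite lef_pV2 ?posrE.
  rewrite aE -[n%:R^-1]lnK ?posrE ?invr_gt0// lnV ?posrE// ltr_expR ltrN2 -/l.
  by rewrite ltr_pMl//; lra.
have half1 : 2^-1 < 1 :> R by lra.
have [mE PE] := @berk_jones_sup _ _ _ P n U n0 iidU a 2^-1 eta a0 ahalf half1 eta0.
set E := [set w | _] in PE mE.
pose M := [set w | exists i, U i w <= a].
have mM : measurable M by exact: some_le_measurable.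
have PM : (P M <= (n%:R * a)%:E)%E by apply: some_le_prob => //; [exact: ltW|lra].
apply: (@le_trans _ _ (P (E `|` M))).
  apply: le_measure; rewrite ?inE; [exact: measurable_BJ_gt|exact: measurableU|].
  move=> w /lt_bigmaxe[i /andP[i1 i2]].
  have i2' : (i <= n./2)%N by rewrite -ltnS.
  have hn : (n./2.*2 <= n)%N by rewrite -[leqRHS]odd_double_half leq_addl.
  have iN : (0 < i <= n)%N.
    by rewrite i1 (leq_trans i2')// (leq_trans _ hn)// -addnn leq_addr.
  set p := order_stat _ i; rewrite lte_fin => h.
  have [pi|ip] := ltP p (i%:R / n%:R); last first.
    by move: h; rewrite (le_gtF ip) mulr0 => /(lt_trans eta0); rewrite ltxx.
  have {}h : eta < i%:R * ln (i%:R / (n%:R * p)) + (n%:R - i%:R) * ln ((1 - i%:R / n%:R) / (1 - p)).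
    by move: h; rewrite pi mulr1.
  have [j pj] := order_stat_in (fun i => U i w) iN.
  have [pa|ap] := leP p a; first by right; exists j; rewrite -pj.
  (* The supremum is tested at the order statistic itself, which lies between [a] and [i / n <= 1 / 2]. *)
  left; apply/lt_ereal_sup_ex; exists p.
    rewrite /= in_itv/= (ltW ap)/= (le_trans (ltW pi))//.
    rewrite ler_pdivrMr// mulrC ler_pdivlMr// -natrM ler_nat muln2.
    by rewrite (leq_trans _ hn)// leq_double.
  have p0 : 0 < p by lra.
  have F1 := ecdf_le1 n0 (fun i => U i w) p.
  have iF := @ecdf_order_stat R n (fun i => U i w) i iN; rewrite -/p in iF.
  apply: (lt_le_trans h); apply: (@le_trans _ _ (n%:R * kl (i%:R / n%:R) p)).
    rewrite /kl le_eqVlt; apply/orP; left; apply/eqP.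
    rewrite (_ : i%:R / n%:R / p = i%:R / (n%:R * p)); last first.
      by rewrite invfM mulrA.
    rewrite mulrDr (mulrA n%:R (i%:R / n%:R)) (mulrA n%:R (1 - _)).
    rewrite [n%:R * (i%:R / n%:R)](_ : _ = i%:R); last by field; rewrite gt_eqF.
    by rewrite [n%:R * (1 - i%:R / n%:R)](_ : _ = n%:R - i%:R)//; field; rewrite gt_eqF.
  by rewrite ler_pM2l// kl_mono//; lra.
apply: le_trans (measureU2 _ mE mM) _.
apply: le_trans (leeD PE PM) _; rewrite -EFinD lee_fin na.
have e4 := @exp1_le4 R.
have e0 := expR_gt0 (- eta).
have npw := powR_ge0 n%:R (1 - K) : 0 <= n%:R `^ (1 - K) :> R.
apply: lerD; last by lra.
rewrite ler_pM2r//.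
set L := ln _.
have LK : L <= K * l.
  rewrite -[leRHS]expRK ler_ln ?posrE ?expR_gt0//; last first.
    by rewrite divr_gt0// mulr_gt0//; lra.
  rewrite -[K * l]opprK expRN -aE ler_pdivrMr ?mulr_gt0//; last by lra.
  by rewrite (_ : a^-1 * _ = 1 - 2^-1); [lra|field; rewrite gt_eqF].
have h1 : eta * L <= eta * (K * l) by rewrite ler_pM2l.
have h2 : 1 <= 2 * (K * l) by nra.
have Kl : 0 < K * l by nra.
(* [2 * e <= 8], and [1 <= 2 * (K * l)] because [l >= 1 / 2]. *)
apply: (@le_trans _ _ (8 * (eta * (K * l) + 2 * (K * l)))).
  have L0 : 0 <= L.
    apply: ln_ge0; rewrite ler_pdivlMr ?mulr_gt0//; last by lra.
    by nra.
  have q0 : 0 <= eta * L + 1 by rewrite addr_ge0// mulr_ge0// ltW.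
  apply: (@le_trans _ _ (8 * (eta * L + 1))); first by rewrite ler_wpM2r//; lra.
  by rewrite ler_pM2l//; lra.
have : 0 <= eta * (K * l) by rewrite mulr_ge0// ltW.
rewrite (_ : 22 * K * l * (eta + 1) = 22 * (eta * (K * l)) + 22 * (K * l)); last by ring.
by lra.
Qed.

End berk_jones_tail.

(** * Standardised deviations and Higher Criticism *)

Section exceedance.
Context {R : realType}.
Implicit Types (x y t eta v : R).

(** Bernstein's bound [kl_bernstein] is increasing in the deviation [x - t], which exceeds [eta] standard deviations;
    [v] is a lower bound on [sqrt (n t (1 - t))]. *)
Lemma kl_of_exceedance (n : nat) (x t eta v : R) :
  (0 < n)%N -> 0 < t -> t < 1 -> x <= 1 -> 0 < eta -> 0 < v ->
  v ^+ 2 <= n%:R * (t * (1 - t)) ->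
  eta < Num.sqrt n%:R * ((x - t) / Num.sqrt (t * (1 - t))) ->
  t < x /\ eta ^+ 2 / (2 * (1 + eta / v)) < n%:R * kl x t.
Proof.
move=> n0 t0 t1 x1 eta0 v0 vn h.
have nR : 0 < n%:R :> R by rewrite ltr0n.
have s2 : 0 < t * (1 - t) by rewrite mulr_gt0// subr_gt0.
set q := Num.sqrt n%:R in h; set s := Num.sqrt (t * (1 - t)) in h.
have q0 : 0 < q by rewrite sqrtr_gt0.
have s0 : 0 < s by rewrite sqrtr_gt0.
have qq : q ^+ 2 = n%:R by rewrite sqr_sqrtr ?ltW.
have ss : s ^+ 2 = t * (1 - t) by rewrite sqr_sqrtr ?ltW.
have {}h : eta * s < q * (x - t) by rewrite -ltr_pdivlMr// -mulrA.
have xt : 0 < x - t.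
  have : 0 < q * (x - t) by apply: lt_trans h; rewrite mulr_gt0.
  by rewrite pmulr_rgt0.
split; first by lra.
have vqs : v <= q * s.
  rewrite -(@ler_pXn2r _ 2)// ?nnegrE ?(ltW v0) ?mulr_ge0 ?(ltW q0) ?(ltW s0)//.
  by rewrite exprMn qq ss.
have := kl_bernstein t0 t1 _ x1; rewrite -subr_ge0 => /(_ (ltW xt)).
rewrite -(ler_pM2l nR); apply: lt_le_trans.
rewrite -qq -ss; set D := x - t in h xt *.
apply: (@le_lt_trans _ _ (eta ^+ 2 / (2 * (1 + eta / (q * s))))).
  rewrite ler_pM2l ?exprn_gt0// lef_pV2 ?posrE ?mulr_gt0 ?addr_gt0 ?divr_gt0// ?mulr_gt0//.
  rewrite ler_pM2l// lerD2l ler_pM2l// lef_pV2 ?posrE ?mulr_gt0//.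
rewrite (_ : eta ^+ 2 / _ = eta ^+ 2 * (q * s) / (2 * (q * s + eta))); last first.
  by field; rewrite !gt_eqF ?addr_gt0 ?mulr_gt0//.
rewrite (mulrA (q ^+ 2)) ltr_pdivrMr ?mulr_gt0 ?addr_gt0 ?mulr_gt0//.
rewrite [X in _ < X](_ : _ = q ^+ 2 * D ^+ 2 * (2 * (q * s + eta)) / (2 * (s ^+ 2 + D))); last by ring.
have pos1 : 0 < 2 * (s ^+ 2 + D) by rewrite mulr_gt0// addr_gt0// exprn_gt0.
rewrite ltr_pdivlMr//.
set y := q * D in h.
have yE : q * D = y by [].
have e1 : eta ^+ 2 * (q * s) * (2 * (s ^+ 2 + D)) = 2 * s * (eta * s * (eta * s) * q + eta ^+ 2 * y).
  by rewrite -yE; ring.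
have e2 : q ^+ 2 * D ^+ 2 * (2 * (q * s + eta)) = 2 * (y * y * q * s + y * y * eta).
  by rewrite -yE; ring.
rewrite e1 e2.
have es0 : 0 < eta * s by rewrite mulr_gt0.
have y0 : 0 < y by lra.
have h1 : eta * s * (eta * s) < y * y by nra.
have h2 : eta * s * (eta * s) * (q * s) < y * y * (q * s) by rewrite ltr_pM2r// mulr_gt0.
have h3 : eta * y * (eta * s) < eta * y * y by rewrite ltr_pM2l// mulr_gt0.
rewrite (_ : 2 * s * _ = 2 * (eta * s * (eta * s) * (q * s) + eta * y * (eta * s))); last by ring.
rewrite (_ : y * y * q * s = y * y * (q * s)); last by ring.
rewrite (_ : y * y * eta = eta * y * y); last by ring.
lra.
Qed.

(** Since [x <= 1], the deviation is at most [1 - t], which is at most [eta] standard deviations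
    [sqrt (t * (1 - t) / n)]. *)
Lemma no_exceedance (n : nat) (x t eta : R) :
  0 < t -> t < 1 -> x <= 1 -> 2 <= eta -> 2^-1 <= t -> n%:R * (1 - t) <= eta^-1 ->
  Num.sqrt n%:R * ((x - t) / Num.sqrt (t * (1 - t))) <= eta.
Proof.
move=> t0 t1 x1 eta2 th nt.
have s2 : 0 < t * (1 - t) by rewrite mulr_gt0// subr_gt0.
have s0 : 0 < Num.sqrt (t * (1 - t)) by rewrite sqrtr_gt0.
rewrite mulrA ler_pdivrMr//.
have [xt|tx] := leP (x - t) 0.
  apply: (@le_trans _ _ 0); first by rewrite mulr_ge0_le0 ?sqrtr_ge0.
  by rewrite mulr_ge0 ?sqrtr_ge0//; lra.
apply: (@le_trans _ _ (Num.sqrt n%:R * (1 - t))).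
  by rewrite ler_wpM2l ?sqrtr_ge0//; lra.
have e0 : 0 < eta by lra.
have t1' : 0 < 1 - t by lra.
rewrite -(@ler_pXn2r _ 2)// ?nnegrE ?mulr_ge0 ?sqrtr_ge0 ?(ltW e0) ?(ltW t1')//.
rewrite !exprMn !sqr_sqrtr ?(ltW s2)// expr2 !mulrA ler_pM2r//.
have e1 : eta^-1 <= 2^-1 by rewrite lef_pV2 ?posrE.
by apply: le_trans nt _; nra.
Qed.

End exceedance.

Section higher_criticism.
Context {d : measure_display} {T : measurableType d} {R : realType}.
Variables (P : probability T R) (n : nat) (U : 'I_n -> {RV P >-> R}).
Hypothesis n0 : (0 < n)%N.
Hypothesis iidU : iid_uniform01 U.

Let F (w : T) (t : R) : R := ecdf (fun i => U i w) t.
Let X (t : R) (w : T) : R := Num.sqrt n%:R * ((F w t - t) / Num.sqrt (t * (1 - t))).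
Let S eta := [set w | (eta%:E < ereal_sup [set (X t w)%:E | t in `]0%R, 1%R[])%E].

(** The open interval [(0, 1)] is exhausted by compact ones, to which the grid argument applies. *)
Lemma measurable_std_sup eta : measurable (S eta).
Proof.
pose lo k : R := k.+2%:R^-1.
have lo0 k : 0 < lo k by rewrite invr_gt0.
have lo2 k : lo k <= 2^-1 by rewrite lef_pV2 ?posrE// ler_nat.
pose J k : set R := `[lo k, 1 - lo k]%classic.
rewrite [X in measurable X](_ : _ = \bigcup_k [set w |
    (eta%:E < ereal_sup [set (X t w)%:E | t in J k])%E]).
  apply: bigcup_measurable => k _; apply: measurable_right_open_sup.
  - by have := lo2 k; lra.
  - move=> t _; apply: measurable_funM => //; apply: measurable_funM => //.
    by apply: measurable_funB => //; exact: measurable_ecdf.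
  - move=> w t /andP[at_ tb] h.
    have t0 : 0 < t by exact: lt_le_trans at_.
    have t1 : 0 < 1 - t by have := lo0 k; lra.
    suff [e e0 he] : exists2 e : R, 0 < e & forall s, t <= s < t + e -> eta < X s w.
      by exists e => // s hs _; exact: he.
    apply: near_right_ex => //; near=> s.
    rewrite /X; have -> : F w s = F w t by near: s; exact: near_ecdf_right.
    near: s; apply: (cvgr_gt (X t w)) => //.
    apply: cvg_at_right_filter; apply: cvgM; first exact: cvg_cst.
    apply: cvgM; first by apply: cvgB; [exact: cvg_cst|exact: cvg_id].
    apply: cvgV; first by rewrite gt_eqF// sqrtr_gt0 mulr_gt0.
    apply: (@continuous_cvg _ _ _ _ _ (fun s : R => s * (1 - s)) (@Num.sqrt R)).
      exact: sqrt_continuous.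
    apply: cvgM; first exact: cvg_id.
    by apply: cvgB; [exact: cvg_cst|exact: cvg_id].
apply/seteqP; split => w.
  move=> /lt_ereal_sup_ex[t]; rewrite /= in_itv/= => /andP[t0 t1] h.
  have m0 : 0 < Num.min t (1 - t) by rewrite lt_min t0 subr_gt0.
  have [k _ hk] := near_infty_natSinv_lt (PosNum m0).
  exists k => //=; apply/lt_ereal_sup_ex; exists t => //; rewrite /J/= in_itv/=.
  have lk : lo k <= Num.min t (1 - t).
    apply: ltW; apply: le_lt_trans (hk k (leqnn _)).
    by rewrite lef_pV2 ?posrE// ler_nat.
  by move: lk; rewrite le_min => /andP[]; lra.
case=> k _ /= /lt_ereal_sup_ex[t]; rewrite /J/= in_itv/= => /andP[at_ tb] h.
apply/lt_ereal_sup_ex; exists t => //; rewrite /= in_itv/=.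
by have := lo0 k; lra.
Unshelve. all: by end_near. Qed.

(** The supremum is tested at the order statistics, where [ecdf] is at least [i / n].  A positive value of the
    Higher Criticism forces the order statistic into [(0, 1)], since division by [0] gives [0]. *)
Lemma HC_le_std_sup eta : 0 < eta ->
  (P [set w | (eta%:E < HC (fun i => U i w))%E] <= P (S eta))%E.
Proof.
move=> eta0; apply: le_measure; rewrite ?inE.
- exact: measurable_HC_gt.
- exact: measurable_std_sup.
move=> w /lt_bigmaxe[i /andP[i1 i2]]; rewrite lte_fin; set p := order_stat _ i => h.
have iN : (0 < i <= n)%N.
  by rewrite i1 (leq_trans (_ : i <= n./2)%N)// -divn2 leq_div.
have s0 : 0 < Num.sqrt (p * (1 - p)).
  rewrite lt_neqAle sqrtr_ge0 andbT eq_sym; apply/eqP => s0.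
  by move: h; rewrite s0 invr0 !mulr0 => /(lt_trans eta0); rewrite ltxx.
move: (s0); rewrite sqrtr_gt0 => s2.
have p0 : 0 < p by rewrite ltNge; apply/negP => p0; move: s2; nra.
have p1 : p < 1 by rewrite ltNge; apply/negP => p1; move: s2; nra.
apply/lt_ereal_sup_ex; exists p; first by rewrite /= in_itv/= p0.
apply: (lt_le_trans h); rewrite /X ler_wpM2l ?sqrtr_ge0// ler_pM2r ?invr_gt0//.
by rewrite lerB// ecdf_order_stat.
Qed.

Lemma std_sup_region (a b eta v kappa : R) : 0 < a -> a < b -> b < 1 -> 0 < eta -> 0 < v ->
  (forall t, a <= t <= b -> v ^+ 2 <= n%:R * (t * (1 - t))) ->
  0 < kappa -> kappa <= eta ^+ 2 / (2 * (1 + eta / v)) ->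
  exists G, [/\ measurable G, forall w t, a <= t <= b -> eta < X t w -> G w &
   (P G <= (2 * expR 1 * (kappa * ln (b * (1 - a) / (a * (1 - b))) + 1) * expR (- kappa))%:E)%E].
Proof.
move=> a0 ab b1 eta0 v0 hv k0 kv.
have [mE PE] := @berk_jones_sup _ _ _ P n U n0 iidU a b kappa a0 ab b1 k0.
eexists; split; [exact: mE| |exact: PE].
move=> w t /andP[at_ tb] h; apply/lt_ereal_sup_ex; exists t; first by rewrite /= in_itv/= at_.
have [|||_ hk] := @kl_of_exceedance R n (F w t) t eta v n0 _ _ (ecdf_le1 n0 _ _) eta0 v0 _ h; try lra.
  by apply: hv; rewrite at_.
Qed.

End higher_criticism.

Section tail_constants.
Context {R : realType}.
Implicit Types (m eta beta gamma L y : R).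

Lemma expR1_ge0 : 0 <= 2 * expR 1 :> R.
Proof. by rewrite mulr_ge0// expR_ge0. Qed.

(** The numerators of the bounds [C / eta] that the edges and the middle of the interval contribute: the powers come
    from [pow_le_exp] with exponents [9] and [2] in [sqrt eta], and with exponents [3] and [1] in [eta]. *)
Definition edge_const m : R := 2 * expR 1 * (m ^+ 2 * 54 ^+ 9 + 12 ^+ 2).

Lemma edge_const_ge0 m : 0 <= edge_const m.
Proof. by rewrite mulr_ge0 ?expR1_ge0// addr_ge0// mulr_ge0// sqr_ge0. Qed.

Definition middle_const beta gamma : R :=
  2 * expR 1 * (2 * beta * (3 / gamma) ^+ 3 + 1 / gamma).

Lemma middle_const_ge0 beta gamma : 0 <= beta -> 0 <= gamma -> 0 <= middle_const beta gamma.
Proof.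
move=> b0 g0; rewrite mulr_ge0 ?expR1_ge0// addr_ge0 ?divr_ge0//.
by apply: mulr_ge0; [exact: mulr_ge0|rewrite exprn_ge0// divr_ge0].
Qed.

Lemma edge_bound m eta L : 1 <= eta -> L <= 4 * m ^+ 2 * eta ^+ 3 ->
  2 * expR 1 * (Num.sqrt eta / 6 * L + 1) * expR (- (Num.sqrt eta / 6)) <=
  edge_const m / eta.
Proof.
rewrite /edge_const.
move=> eta1 hL; set y := Num.sqrt eta.
have eta0 : 0 < eta by lra.
have y0 : 0 < y by rewrite sqrtr_gt0.
have yy : eta = y ^+ 2 by rewrite sqr_sqrtr// ltW.
rewrite -!(mulrA (2 * expR 1)) ler_wpM2l ?expR1_ge0// ler_pdivlMr// mulrAC.
rewrite expRN ler_pdivrMr ?expR_gt0//.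
apply: (@le_trans _ _ (m ^+ 2 * y ^+ 9 + y ^+ 2)).
  apply: (@le_trans _ _ ((y / 6 * (4 * m ^+ 2 * eta ^+ 3) + 1) * eta)).
    by rewrite ler_wpM2r ?(ltW eta0)// lerD2r ler_wpM2l// divr_ge0// ltW.
  rewrite yy (_ : _ * _ = 2 / 3 * (m ^+ 2 * y ^+ 9) + y ^+ 2); last by field.
  rewrite lerD2r; have : 0 <= m ^+ 2 * y ^+ 9 by rewrite mulr_ge0 ?sqr_ge0// exprn_ge0// ltW.
  by lra.
have c6 : 0 < 6^-1 :> R by [].
have h9 := @pow_le_exp R 9 6^-1 y isT c6 (ltW y0).
have h2 := @pow_le_exp R 2 6^-1 y isT c6 (ltW y0).
rewrite (_ : 9%:R / 6^-1 = 54) ?(mulrC _ y) in h9; last by field.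
rewrite (_ : 2%:R / 6^-1 = 12) ?(mulrC _ y) in h2; last by field.
rewrite mulrDl -(mulrA (m ^+ 2)); apply: lerD; last exact: h2.
by rewrite ler_wpM2l ?sqr_ge0.
Qed.

Lemma middle_bound beta gamma eta l L : 0 < beta -> 0 < gamma -> 1 <= eta -> L <= 2 * l ->
  l <= expR ((beta - gamma) * eta ^+ 2) -> gamma <= beta ->
  2 * expR 1 * (beta * eta ^+ 2 * L + 1) * expR (- (beta * eta ^+ 2)) <=
  middle_const beta gamma / eta.
Proof.
rewrite /middle_const.
move=> b0 g0 eta1 hL hl gb.
have eta0 : 0 < eta by lra.
rewrite -!(mulrA (2 * expR 1)) ler_wpM2l ?expR1_ge0// ler_pdivlMr//.
set E := expR ((beta - gamma) * eta ^+ 2) in hl.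
have e2 : 0 <= eta ^+ 2 by rewrite sqr_ge0.
have E1 : 1 <= E by rewrite /E -expR0 ler_expR mulr_ge0//; lra.
have be : 0 <= beta * eta ^+ 2 by rewrite mulr_ge0// ltW.
have h1 : beta * eta ^+ 2 * L + 1 <= (2 * (beta * eta ^+ 2) + 1) * E.
  have : beta * eta ^+ 2 * L <= beta * eta ^+ 2 * (2 * E) by rewrite ler_wpM2l//; lra.
  by rewrite mulrDl mul1r; lra.
have h2 : expR (- (beta * eta ^+ 2)) = expR (- (gamma * eta ^+ 2)) / E.
  by rewrite /E -expRN -expRD; congr expR; ring.
have E0 : 0 < E by lra.
apply: (@le_trans _ _ ((2 * beta * eta ^+ 3 + eta ^+ 1) * expR (- (gamma * eta ^+ 2)))).
  rewrite h2 (_ : (2 * beta * eta ^+ 3 + eta ^+ 1) * expR (- (gamma * eta ^+ 2)) =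
   (2 * (beta * eta ^+ 2) + 1) * E * (expR (- (gamma * eta ^+ 2)) / E) * eta); last first.
    by field; rewrite gt_eqF.
  rewrite ler_pM2r//; apply: ler_wpM2r => //.
  by rewrite divr_ge0 ?expR_ge0// ltW.
apply: (@le_trans _ _ ((2 * beta * eta ^+ 3 + eta ^+ 1) * expR (- (gamma * eta)))).
  apply: ler_wpM2l.
    by rewrite addr_ge0// ?mulr_ge0// ?exprn_ge0// ltW.
  by rewrite ler_expR lerN2 ler_pM2l// expr2 ler_peMl// ltW.
rewrite expRN ler_pdivrMr ?expR_gt0// (mulrDl (2 * beta * _)).
have h3 := @pow_le_exp R 3 gamma eta isT g0 (ltW eta0).
have h4 := @pow_le_exp R 1 gamma eta isT g0 (ltW eta0).
rewrite [(1 / gamma) ^+ 1]expr1 in h4.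
apply: lerD => //; rewrite -(mulrA (2 * beta)) ler_pM2l// mulr_gt0//.
Qed.

End tail_constants.

Lemma ecdf_eq0 {R : realType} {n : nat} (u : 'I_n -> R) (t : R) :
  (forall i, t < u i) -> ecdf u t = 0.
Proof.
by move=> h; rewrite /ecdf big1 ?mul0r// => i _; rewrite leNgt h.
Qed.

Section std_sup_regions.
Context {d : measure_display} {T : measurableType d} {R : realType}.
Variables (P : probability T R) (n : nat) (U : 'I_n -> {RV P >-> R}).
Hypothesis n0 : (0 < n)%N.
Hypothesis iidU : iid_uniform01 U.

Let X (t : R) (w : T) : R :=
  Num.sqrt n%:R * ((ecdf (fun i => U i w) t - t) / Num.sqrt (t * (1 - t))).

Let nR : 0 < n%:R :> R. Proof. by rewrite ltr0n. Qed.

(** At the edges [n t (1 - t) >= 1 / (4 eta)], so the exceedance level for the divergence is of order [sqrt eta]; the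
    odds of [hi] are at most of order [eta^3] times those of [lo]. *)
Lemma edge_regions (m eta hi : R) : let lo := (n%:R * eta)^-1 in
  1 <= eta -> lo < hi -> hi <= 2^-1 -> hi <= 2 * m ^+ 2 * eta ^+ 2 / n%:R ->
  exists G, [/\ measurable G,
    forall w t, (lo <= t <= hi) || (1 - hi <= t <= 1 - lo) -> eta < X t w -> G w &
    (P G <= (2 * (edge_const m / eta))%:E)%E].
Proof.
move=> lo eta1 lohi hih hih2; set h2 : R := _ / n%:R in hih2.
have eta0 : 0 < eta by apply: lt_le_trans eta1.
have lo0 : 0 < lo by rewrite invr_gt0 mulr_gt0.
have nlo : n%:R * lo = eta^-1 by rewrite /lo; field; rewrite !gt_eqF.
have lo1 : lo < 1 by apply: lt_le_trans lohi (le_trans hih _); rewrite invf_le1// ler1n.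
have lo1' : 1 - lo < 1 by rewrite gtrBl.
have hi1 : 0 < 1 - hi by rewrite subr_gt0 (le_lt_trans hih)// invf_lt1// ltr1n.
have hilo : 1 - hi < 1 - lo by rewrite ltrD2l ltrN2.
have hi0 : 0 < hi := lt_trans lo0 lohi.
have hi1' : hi < 1 by rewrite -subr_gt0.
pose y := Num.sqrt eta.
have y1 : 1 <= y by rewrite -sqrtr1 ler_wsqrtr.
have yy : eta = y ^+ 2 by rewrite sqr_sqrtr// ltW.
have y0 : 0 < y by apply: lt_le_trans y1.
pose v := (2 * y)^-1.
have v0 : 0 < v by rewrite invr_gt0 mulr_gt0.
have v2 : v ^+ 2 = eta^-1 / 4 by rewrite /v yy; field; rewrite gt_eqF.
have kap0 : 0 < y / 6 by rewrite divr_gt0.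
have kap : y / 6 <= eta ^+ 2 / (2 * (1 + eta / v)).
  rewrite (_ : eta / v = 2 * y ^+ 3); last by rewrite /v yy; field; rewrite gt_eqF.
  have y3 : 1 <= y ^+ 3 by rewrite exprn_ege1.
  rewrite ler_pdivlMr; last by rewrite mulr_gt0// addr_gt0// mulr_gt0// exprn_gt0.
  rewrite yy (_ : y / 6 * _ = (2 * y + 4 * (y * y ^+ 3)) / 6); last by field.
  rewrite (_ : (y ^+ 2) ^+ 2 = y * y ^+ 3); last by ring.
  nra.
have q0 : 0 < hi * (1 - lo) / (lo * (1 - hi)) by rewrite divr_gt0 ?mulr_gt0// subr_gt0.
have Llo : ln (hi * (1 - lo) / (lo * (1 - hi))) <= 4 * m ^+ 2 * eta ^+ 3.
  apply: le_trans (ltW (ln_sublinear q0)) _.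
  rewrite ler_pdivrMr ?mulr_gt0//.
  have e1 : h2 = 2 * m ^+ 2 * eta ^+ 3 * lo.
    by rewrite /h2 /lo; field; rewrite !gt_eqF.
  apply: (@le_trans _ _ (2 * h2 * (1 - hi))).
    have h2p : 0 < h2 := lt_le_trans hi0 hih2.
    by nra.
  by rewrite e1 mulrA le_eqVlt; apply/orP; left; apply/eqP; ring.
have near_half (s t : R) : lo <= s -> 2^-1 <= t -> v ^+ 2 <= n%:R * (s * t).
  move=> los t2; rewrite v2 mulrA; apply: ler_pM => //.
  - by rewrite invr_ge0 ltW.
  - by rewrite -nlo ler_pM2l.
  - by apply: le_trans t2; rewrite lef_pV2 ?posrE// ler_nat.
have [|G1 [mG1 hG1 PG1]] := @std_sup_region _ _ _ P n U n0 iidU lo hi eta v (y / 6)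
    lo0 lohi hi1' eta0 v0 _ kap0 kap.
  by move=> t /andP[t1 t2]; apply: near_half => //; lra.
have [|G3 [mG3 hG3 PG3]] := @std_sup_region _ _ _ P n U n0 iidU (1 - hi) (1 - lo) eta v (y / 6)
    hi1 hilo lo1' eta0 v0 _ kap0 kap.
  by move=> t /andP[t1 t2]; rewrite (mulrC t); apply: near_half; lra.
have PE1 : (P G1 <= (edge_const m / eta)%:E)%E.
  by apply: le_trans PG1 _; rewrite lee_fin; apply: edge_bound.
have PE3 : (P G3 <= (edge_const m / eta)%:E)%E.
  apply: le_trans PG3 _; rewrite lee_fin; apply: edge_bound => //.
  rewrite (_ : (1 - lo) * (1 - (1 - hi)) / ((1 - hi) * (1 - (1 - lo))) =
     hi * (1 - lo) / (lo * (1 - hi)))//.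
  by rewrite !subKr; congr (_ / _); rewrite mulrC.
exists (G1 `|` G3); split; first exact: measurableU.
  by move=> w t /orP[] tin h; [left; exact: (hG1 w t)|right; exact: (hG3 w t)].
apply: le_trans (measureU2 _ mG1 mG3) (le_trans (leeD PE1 PE3) _).
by rewrite -EFinD lee_fin mulr_natl mulr2n.
Qed.

(** Here [n t (1 - t) >= (m * eta)^2], where [m] is such that the exceedance level for the divergence is exactly
    [beta * eta ^+ 2].  The log-odds length is at most [2 log n], and [ln n <= exp (eta^2 / D)] by the assumption
    on [eta]. *)
Lemma middle_region (D beta eta hi : R) : 0 < D -> D^-1 < beta -> beta < 2^-1 ->
  let m := ((2 * beta)^-1 - 1)^-1 in
  (3 <= n)%N -> 1 <= eta -> 1 <= m * eta -> Num.sqrt (D * ln (ln n%:R)) <= eta ->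
  hi = Num.min (2 * m ^+ 2 * eta ^+ 2 / n%:R) 2^-1 -> 1 <= n%:R * hi ->
  exists G, [/\ measurable G,
    forall w t, hi < t < 1 - hi -> eta < X t w -> G w &
    (P G <= (middle_const beta (beta - D^-1) / eta)%:E)%E].
Proof.
move=> D0 bD bh m n3 eta1 meta hD hiE nhi.
set h2 : R := _ / n%:R in hiE; set gamma := beta - D^-1.
have g0 : 0 < gamma by rewrite subr_gt0.
have b0 : 0 < beta by apply: lt_trans bD; rewrite invr_gt0.
have eta0 : 0 < eta by apply: lt_le_trans eta1.
have eps0 : 0 < (2 * beta)^-1 - 1.
  by rewrite subr_gt0 invf_gt1 ?mulr_gt0//; lra.
have m0 : 0 < m by rewrite invr_gt0.
have [hh|hh] := leP 2^-1 h2.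
  exists set0; split => //; last first.
    by rewrite measure0 lee_fin divr_ge0 ?(ltW eta0)// middle_const_ge0// ltW.
  by move=> w t; rewrite hiE min_r// => /andP[t1 t2]; exfalso; lra.
have {}hiE : hi = h2 by rewrite hiE min_l// ltW.
have hil : hi < 2^-1 by rewrite hiE.
have hi0 : 0 < hi by rewrite -(pmulr_rgt0 _ nR); apply: lt_le_trans nhi.
have mv0 : 0 < m * eta by rewrite mulr_gt0.
have bk0 : 0 < beta * eta ^+ 2 by rewrite mulr_gt0// exprn_gt0.
have bk : beta * eta ^+ 2 <= eta ^+ 2 / (2 * (1 + eta / (m * eta))).
  rewrite (_ : 2 * (1 + eta / (m * eta)) = beta^-1); first by rewrite invrK mulrC.
  rewrite (_ : eta / (m * eta) = (2 * beta)^-1 - 1); first by field; rewrite gt_eqF.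
  by rewrite /m invfM invrK mulrCA mulfV ?mulr1// gt_eqF.
have hi1 : hi < 1 - hi by lra.
have hi2 : 1 - hi < 1 by rewrite gtrBl.
have hi3 : 0 < 1 - hi by apply: lt_trans hi1.
have nh : n%:R * hi = 2 * (m ^+ 2 * eta ^+ 2).
  by rewrite hiE /h2; field; rewrite gt_eqF.
have [|G [mG hG PG]] := @std_sup_region _ _ _ P n U n0 iidU hi (1 - hi) eta (m * eta)
   (beta * eta ^+ 2) hi0 hi1 hi2 eta0 mv0 _ bk0 bk.
  move=> t /andP[t1 t2]; rewrite exprMn.
  have h3 : hi / 2 <= t * (1 - t) by nra.
  have : n%:R * (hi / 2) <= n%:R * (t * (1 - t)) by rewrite ler_pM2l.
  by apply: le_trans; rewrite mulrA nh [leRHS]mulrAC divff// mul1r.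
exists G; split => //.
  by move=> w t /andP[/ltW t1 /ltW t2] h; apply: (hG w t) => //; rewrite t1.
apply: le_trans PG _; rewrite lee_fin; apply: (@middle_bound R beta gamma eta (ln n%:R)) => //.
- have h1 : 0 < (1 - hi) * (1 - hi) / (hi * hi) by rewrite divr_gt0 ?mulr_gt0.
  rewrite subKr (_ : 2 * ln n%:R = ln (n%:R ^+ 2)); last by rewrite lnXn// mulr_natl.
  rewrite ler_ln ?posrE ?exprn_gt0//.
  rewrite ler_pdivrMr ?mulr_gt0// (_ : n%:R ^+ 2 * (hi * hi) = (n%:R * hi) ^+ 2); last by ring.
  apply: (@le_trans _ _ 1); last by rewrite exprn_ege1.
  by nra.
- have n1 : 0 < ln n%:R :> R by rewrite ln_gt0// ltr1n (leq_trans _ n3).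
  rewrite -[leLHS]lnK ?posrE// ler_expR /gamma subKr.
  rewrite mulrC ler_pdivlMr// mulrC.
  have [neg|pos] := leP (D * ln (ln n%:R)) 0; first by apply: le_trans neg _; rewrite sqr_ge0.
  rewrite -[leLHS](sqr_sqrtr (ltW pos)).
  by rewrite ler_pXn2r// ?nnegrE ?sqrtr_ge0// ltW.
- by rewrite gerBl invr_ge0 ltW.
Qed.

End std_sup_regions.

(** The constant is chosen so that the bound is trivial for [eta < eta1]; this gives room for [eta >= 2] and
    [m * eta >= 1] below. *)
Lemma std_sup_tail (R : realType) (D : R) : 2 < D -> exists C : R,
  forall (d : measure_display) (T : measurableType d) (P : probability T R)
    (n : nat) (U : 'I_n -> {RV P >-> R}) (eta : R),
    (3 <= n)%N -> iid_uniform01 U ->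
    0 < eta -> Num.sqrt (D * ln (ln n%:R)) <= eta ->
    (P [set w | (eta%:E < ereal_sup [set (Num.sqrt n%:R * ((ecdf (fun i => U i w) t - t)
                              / Num.sqrt (t * (1 - t))))%:E
                        | t in `]0%R, 1%R[])%E] <= (C / eta)%:E)%E.
Proof.
move=> D2; have D0 : 0 < D by apply: lt_trans D2.
have Dh : D^-1 < 2^-1 by rewrite ltf_pV2 ?posrE.
pose beta : R := (D^-1 + 2^-1) / 2.
have bD : D^-1 < beta by rewrite /beta; lra.
have bh : beta < 2^-1 by rewrite /beta; lra.
have b0 : 0 < beta by apply: lt_trans bD; rewrite invr_gt0.
pose eps : R := (2 * beta)^-1 - 1.
have eps0 : 0 < eps by rewrite subr_gt0 invf_gt1; lra.
pose m : R := eps^-1.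
have m0 : 0 < m by rewrite invr_gt0.
pose CB := edge_const m; pose CA := middle_const beta (beta - D^-1).
have CB0 : 0 <= CB by exact: edge_const_ge0.
have CA0 : 0 <= CA by apply: middle_const_ge0; rewrite ?subr_ge0 ltW.
pose eta1 : R := 2 + eps.
exists (eta1 + 1 + 2 * CB + CA) => d T P n U eta n3 iidU eta0 hD.
set C := eta1 + _ + _ + _; set S := [set w | _].
have n0 : (0 < n)%N by exact: leq_trans n3.
have mS : measurable S by exact: measurable_std_sup.
have [small|big] := ltP eta eta1.
  apply: (@le_trans _ _ 1%E); first exact: probability_le1.
  rewrite lee_fin ler_pdivlMr// mul1r (le_trans (ltW small))//.
  by rewrite /C -(addrA eta1) -addrA lerDl !addr_ge0// mulr_ge0.
have eta2 : 2 <= eta by apply: le_trans big; rewrite /eta1 lerDl ltW.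
have etage1 : 1 <= eta by apply: le_trans eta2; rewrite ler1n.
have epseta : eps <= eta by apply: le_trans big; rewrite /eta1 lerDr.
have np : 0 < n%:R :> R by rewrite ltr0n.
pose lo : R := (n%:R * eta)^-1.
have lo0 : 0 < lo by rewrite invr_gt0 mulr_gt0.
have nlo : n%:R * lo = eta^-1 by rewrite /lo; field; rewrite !gt_eqF.
pose h2 : R := 2 * m ^+ 2 * eta ^+ 2 / n%:R.
pose hi : R := Num.min h2 2^-1.
have meta : 1 <= m * eta by rewrite /m -ler_pdivrMl ?invr_gt0// invrK mulr1.
have meta2 : 1 <= m ^+ 2 * eta ^+ 2 by rewrite -exprMn exprn_ege1.
have hih : hi <= 2^-1 by rewrite ge_min lexx orbT.
have hih2 : hi <= h2 by rewrite ge_min lexx.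
have nhi : 1 <= n%:R * hi.
  rewrite /hi; case: (leP h2 2^-1) => _.
    rewrite (_ : n%:R * h2 = 2 * (m ^+ 2 * eta ^+ 2)); first by lra.
    by rewrite /h2; field; rewrite gt_eqF.
  by rewrite ler_pdivlMr// mul1r ler_nat ltnW.
have lohi : lo < hi.
  rewrite -(ltr_pM2l np) nlo; apply: lt_le_trans nhi.
  by rewrite invf_lt1// (lt_le_trans _ eta2)// ltr1n.
have [G [mG hG PG]] := @edge_regions _ _ _ P n U n0 iidU m eta hi etage1 lohi hih hih2.
have [G2 [mG2 hG2 PG2]] := @middle_region _ _ _ P n U n0 iidU D beta eta hi D0 bD bh
  n3 etage1 meta hD erefl nhi.
pose M := [set w | exists i, U i w <= lo].
have mM : measurable M by exact: some_le_measurable.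
have lo1 : lo <= 1.
  by apply: le_trans (ltW lohi) (le_trans hih _); rewrite invf_le1// ler1n.
have PM : (P M <= (eta^-1)%:E)%E by rewrite -nlo; apply: some_le_prob => //; exact: ltW.
have mGG := measurableU _ _ mG mG2.
apply: (@le_trans _ _ (P (M `|` (G `|` G2)))).
  apply: le_measure; rewrite ?inE//; first exact: measurableU.
  move=> w /lt_ereal_sup_ex[t]; rewrite /= in_itv/= => /andP[t0 t1] h.
  have F1 := ecdf_le1 n0 (fun i => U i w) t.
  have [tlo|lot] := ltP t lo.
    left; rewrite /M/=; apply: contrapT => /forallNP nU.
    move: h; rewrite ecdf_eq0; last first.
      by move=> i; apply: lt_trans tlo _; rewrite ltNge; exact/negP.
    apply/negP; rewrite -leNgt; apply: le_trans (ltW eta0).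
    rewrite mulr_ge0_le0 ?sqrtr_ge0// mulr_le0_ge0 ?invr_ge0 ?sqrtr_ge0//.
    by rewrite sub0r oppr_le0 ltW.
  right; have [thi|hit] := leP t hi; first by left; apply: (hG w t) => //; rewrite lot thi.
  have [thi'|hit'] := ltP t (1 - hi); first by right; apply: (hG2 w t) => //; rewrite hit.
  have [tlo'|lot'] := leP t (1 - lo).
    by left; apply: (hG w t) => //; rewrite hit' tlo' orbT.
  (* [n * (1 - t) < 1 / eta]: too close to [1] for an exceedance. *)
  exfalso; move: h; apply/negP; rewrite -leNgt.
  apply: no_exceedance => //; first by lra.
  by rewrite -nlo ler_pM2l//; lra.
apply: le_trans (measureU2 _ mM mGG) _.
apply: le_trans (leeD PM (le_trans (measureU2 _ mG mG2) (leeD PG PG2))) _.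
rewrite -!EFinD lee_fin (_ : eta^-1 + _ = (1 + 2 * CB + CA) / eta); last by rewrite -/CB -/CA; ring.
rewrite ler_pM2r ?invr_gt0// /C -!(addrA eta1) lerDr.
by rewrite /eta1 addr_ge0// ltW.
Qed.

(** * Joint laws from expectations of cosines *)

Section finite_measure_integrals.
Context d (T : measurableType d) (R : realType) (mu : {measure set T -> \bar R}).
Hypothesis mufin : (mu setT < +oo)%E.

Lemma integrable_le_bound (f : T -> R) (M : R) : measurable_fun setT f ->
  (forall w, `|f w| <= M) -> mu.-integrable setT (EFin \o f).
Proof.
move=> mf fM; apply: measurable_bounded_integrable => //.
exists M; split; first exact: num_real.
by move=> x Mx w _; apply: le_trans (fM w) _; exact: ltW.
Qed.

Lemma cvg_integral_bounded (f_ : nat -> T -> R) (f : T -> R) (M : R) :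
  (forall n, measurable_fun setT (f_ n)) -> (forall n w, `|f_ n w| <= M) ->
  (forall w, f_ n w @[n --> \oo] --> f w) ->
  (\int[mu]_w (f_ n w)%:E)%E @[n --> \oo] --> (\int[mu]_w (f w)%:E)%E.
Proof.
move=> mf fM ff; apply: (@dominated_cvg _ _ _ mu setT measurableT
  (fun n w => (f_ n w)%:E) (fun w => (f w)%:E) (fun=> M%:E)) => //.
- by move=> n; exact/measurable_EFinP.
- by move=> w _; apply: cvg_EFin; [exact: nearW|exact: ff].
- by apply: (@integrable_le_bound (cst M) `|M|).
- by move=> n w _; rewrite lee_fin.
Qed.

Lemma integral_lin_bounded (f g : T -> R) (a b M N : R) :
  measurable_fun setT f -> measurable_fun setT g ->
  (forall w, `|f w| <= M) -> (forall w, `|g w| <= N) ->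
  (\int[mu]_w (a * f w + b * g w)%:E = a%:E * \int[mu]_w (f w)%:E + b%:E * \int[mu]_w (g w)%:E)%E.
Proof.
move=> mf mg fM gN.
have If := integrable_le_bound mf fM; have Ig := integrable_le_bound mg gN.
under eq_integral do rewrite EFinD !EFinM.
rewrite integralD//=; [|exact: integrableZl|exact: integrableZl].
by rewrite !integralZl.
Qed.

End finite_measure_integrals.

Section trigonometric_uniqueness.
Context {R : realType} d1 d2 (T1 : measurableType d1) (T2 : measurableType d2).
Variables (P1 : {measure set T1 -> \bar R}) (P2 : {measure set T2 -> \bar R}).
Hypotheses (P1fin : (P1 setT < +oo)%E) (P2fin : (P2 setT < +oo)%E).
Variables (X1 : nat -> T1 -> R) (X2 : nat -> T2 -> R) (N : nat).
Hypotheses (mX1 : forall i, measurable_fun setT (X1 i))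
           (mX2 : forall i, measurable_fun setT (X2 i)).

Let lin (c x : nat -> R) : R := \sum_(i < N) c i * x i.

(** The test functions [phi] that cannot distinguish the two families of random variables even when they are
    multiplied by a cosine of a linear combination of the coordinates. *)
Definition trig_match (phi : (nat -> R) -> R) : Prop :=
  [/\ measurable_fun setT (fun w => phi (X1 ^~ w)),
      measurable_fun setT (fun w => phi (X2 ^~ w)),
      exists M, forall x, `|phi x| <= M &
      forall c t, (\int[P1]_w (phi (X1 ^~ w) * cos (lin c (X1 ^~ w) + t))%:E =
                   \int[P2]_w (phi (X2 ^~ w) * cos (lin c (X2 ^~ w) + t))%:E)%E].

Let mlin d (T : measurableType d) (X : nat -> T -> R) c :
  (forall i, measurable_fun setT (X i)) -> measurable_fun setT (fun w => lin c (X ^~ w)).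
Proof. by move=> mX; apply: measurable_sum => i; exact: measurable_funM. Qed.

Let mcos d (T : measurableType d) (X : nat -> T -> R) c t :
  (forall i, measurable_fun setT (X i)) ->
  measurable_fun setT (fun w => cos (lin c (X ^~ w) + t)).
Proof.
move=> mX; have mc : measurable_fun setT (@cos R).
  by apply: continuous_measurable_fun; exact: continuous_cos.
by apply: (measurableT_comp mc); apply: measurable_funD => //; exact: mlin.
Qed.

Let tr_le phi M c t x : (forall x, `|phi x| <= M) -> `|phi x * cos (lin c x + t)| <= M.
Proof.
by move=> pM; rewrite normrM (le_trans _ (pM x))// ler_piMr// cos_max.
Qed.

Lemma trig_match_lin phi psi a b : trig_match phi -> trig_match psi ->
  trig_match (fun x => a * phi x + b * psi x).
Proof.
move=> [m1 m2 [M phiM] phiE] [n1 n2 [K psiK] psiE]; split.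
- by apply: measurable_funD; exact: measurable_funM.
- by apply: measurable_funD; exact: measurable_funM.
- exists (`|a| * M + `|b| * K) => x; rewrite (le_trans (ler_normD _ _))//.
  by rewrite !normrM lerD// ler_wpM2l.
- move=> c t.
  have e d (T : measurableType d) (X : nat -> T -> R) w :
      (a * phi (X ^~ w) + b * psi (X ^~ w)) * cos (lin c (X ^~ w) + t) =
      a * (phi (X ^~ w) * cos (lin c (X ^~ w) + t)) + b * (psi (X ^~ w) * cos (lin c (X ^~ w) + t)).
    by rewrite mulrDl !mulrA.
  under eq_integral do rewrite e; under [RHS]eq_integral do rewrite e.
  rewrite (@integral_lin_bounded _ _ _ P1 P1fin _ _ a b M K);
    [|exact: measurable_funM (mcos _ _ mX1)|exact: measurable_funM (mcos _ _ mX1)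
     |by move=> w; exact: tr_le|by move=> w; exact: tr_le].
  rewrite (@integral_lin_bounded _ _ _ P2 P2fin _ _ a b M K);
    [|exact: measurable_funM (mcos _ _ mX2)|exact: measurable_funM (mcos _ _ mX2)
     |by move=> w; exact: tr_le|by move=> w; exact: tr_le].
  by rewrite phiE psiE.
Qed.

Lemma trig_match_lim (phi_ : nat -> (nat -> R) -> R) phi M :
  (forall n, trig_match (phi_ n)) -> (forall n x, `|phi_ n x| <= M) ->
  (forall x, phi_ n x @[n --> \oo] --> phi x) -> trig_match phi.
Proof.
move=> mphi phiM phi_lim; split.
- apply: (@measurable_fun_cvg _ _ _ _ (fun n w => phi_ n (X1 ^~ w))) => //.
  by move=> n; case: (mphi n).
- apply: (@measurable_fun_cvg _ _ _ _ (fun n w => phi_ n (X2 ^~ w))) => //.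
  by move=> n; case: (mphi n).
- exists M => x; rewrite -(cvg_lim _ (cvg_norm (phi_lim x)))//.
  by apply: limr_le; [apply/cvg_ex; eexists; exact: cvg_norm (phi_lim x)|exact: nearW].
move=> c t.
have h1 : (\int[P1]_w (phi_ n (X1 ^~ w) * cos (lin c (X1 ^~ w) + t))%:E)%E @[n --> \oo] -->
    (\int[P1]_w (phi (X1 ^~ w) * cos (lin c (X1 ^~ w) + t))%:E)%E.
  apply: (@cvg_integral_bounded _ _ _ P1 P1fin _ _ M).
  - by move=> n; apply: measurable_funM; [case: (mphi n)|exact: mcos].
  - by move=> n w; exact: tr_le.
  - by move=> w; apply: cvgM; [exact: phi_lim|exact: cvg_cst].
have h2 : (\int[P2]_w (phi_ n (X2 ^~ w) * cos (lin c (X2 ^~ w) + t))%:E)%E @[n --> \oo] -->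
    (\int[P2]_w (phi (X2 ^~ w) * cos (lin c (X2 ^~ w) + t))%:E)%E.
  apply: (@cvg_integral_bounded _ _ _ P2 P2fin _ _ M).
  - by move=> n; apply: measurable_funM; [case: (mphi n)|exact: mcos].
  - by move=> n w; exact: tr_le.
  - by move=> w; apply: cvgM; [exact: phi_lim|exact: cvg_cst].
rewrite -(cvg_lim _ h1)// -(cvg_lim _ h2)//; congr (lim (_ @ \oo)).
by apply/funext => n; case: (mphi n).
Qed.

(** The product of a sine and a cosine is a combination of two cosines, with linear parts changed in the coordinate
    [j] only. *)
Lemma trig_match_sin phi j a b : (j < N)%N -> trig_match phi ->
  trig_match (fun x => phi x * sin (a * x j + b)).
Proof.
move=> jN [m1 m2 [M phiM] phiE].
have msin d (T : measurableType d) (X : nat -> T -> R) :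
    (forall i, measurable_fun setT (X i)) ->
    measurable_fun setT (fun w => sin (a * X j w + b)).
  move=> mX; have ms : measurable_fun setT (@sin R).
    by apply: continuous_measurable_fun; exact: continuous_sin.
  by apply: (measurableT_comp ms); apply: measurable_funD => //; exact: measurable_funM.
split.
- by apply: measurable_funM => //; exact: msin.
- by apply: measurable_funM => //; exact: msin.
- by exists M => x; rewrite normrM (le_trans _ (phiM x))// ler_piMr// sin_max.
move=> c t.
pose sh (s : R) i := c i + s * a *+ (i == j).
have linE s x : lin (sh s) x = lin c x + s * (a * x j).
  rewrite /lin /sh; under eq_bigr do rewrite mulrDl.
  rewrite big_split/=; congr (_ + _).
  rewrite (bigD1 (Ordinal jN))//= eqxx mulr1n big1 ?addr0 ?mulrA// => i ij.
  by rewrite (_ : (i == j :> nat) = false) ?mulr0n ?mul0r//; apply/negbTE.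
have key x : phi x * sin (a * x j + b) * cos (lin c x + t) =
    2^-1 * (phi x * cos (lin (sh 1) x + (t + b - pi / 2))) +
    (- 2^-1) * (phi x * cos (lin (sh (-1)) x + (t - b - pi / 2))).
  rewrite !linE !mul1r !mulN1r.
  rewrite (_ : lin c x + a * x j + (t + b - pi / 2) = (lin c x + t + (a * x j + b)) - pi / 2); last by ring.
  rewrite (_ : lin c x - a * x j + (t - b - pi / 2) = (lin c x + t - (a * x j + b)) - pi / 2); last by ring.
  by rewrite !cosBpihalf sinD sinB; field.
under eq_integral do rewrite key; under [RHS]eq_integral do rewrite key.
rewrite (@integral_lin_bounded _ _ _ P1 P1fin _ _ _ _ M M);
    [|exact: measurable_funM (mcos _ _ mX1)|exact: measurable_funM (mcos _ _ mX1)
     |by move=> w; exact: tr_le|by move=> w; exact: tr_le].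
rewrite (@integral_lin_bounded _ _ _ P2 P2fin _ _ _ _ M M);
    [|exact: measurable_funM (mcos _ _ mX2)|exact: measurable_funM (mcos _ _ mX2)
     |by move=> w; exact: tr_le|by move=> w; exact: tr_le].
by rewrite !phiE.
Qed.

Lemma trig_match_ext phi psi : phi =1 psi -> trig_match phi -> trig_match psi.
Proof. by move=> /funext ->. Qed.

Let mult (j : nat) (f : R -> R) : Prop := (forall x, `|f x| <= 1) /\
  (forall phi, trig_match phi -> trig_match (fun x => phi x * f (x j))).

Let mult_lim j (f_ : nat -> R -> R) f : (forall n, mult j (f_ n)) ->
  (forall x, f_ n x @[n --> \oo] --> f x) -> mult j f.
Proof.
move=> mf ff; split.
  move=> x; rewrite -(cvg_lim _ (cvg_norm (ff x)))//.
  apply: limr_le; first by apply/cvg_ex; eexists; exact: cvg_norm (ff x).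
  by apply: nearW => n; case: (mf n).
move=> phi mphi; have [_ _ [M phiM] _] := mphi.
apply: (@trig_match_lim (fun n x => phi x * f_ n (x j)) _ M).
- by move=> n; case: (mf n) => _; exact.
- by move=> n x; rewrite normrM (le_trans _ (phiM x))// ler_piMr//; case: (mf n).
- by move=> x; apply: cvgM; [exact: cvg_cst|exact: ff].
Qed.

(* The iterates of this polynomial map of the interval from [-1] to [1] into itself converge to the sign: the class of multipliers is
   stable under it, so that it contains signs of sines, and then signs of [x - r] by slowing the sine down. *)
Let signer (y : R) : R := y * (3 - y ^+ 2) / 2.

Let signer_le1 y : `|y| <= 1 -> `|signer y| <= 1.
Proof.
rewrite /signer !ler_norml => /andP[h1 h2].
have k1 : 0 <= (1 - y) ^+ 2 * (2 + y) by rewrite mulr_ge0 ?sqr_ge0//; lra.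
have k2 : 0 <= (1 + y) ^+ 2 * (2 - y) by rewrite mulr_ge0 ?sqr_ge0//; lra.
apply/andP; split; nra.
Qed.

Let mult_signer j f : mult j f -> mult j (fun x => signer (f x)).
Proof.
move=> [f1 mf]; split => [x|phi mphi]; first exact: signer_le1.
have h1 := mf _ mphi; have h3 := mf _ (mf _ h1).
apply: trig_match_ext (trig_match_lin (3 / 2) (- 2^-1) h1 h3) => x.
by rewrite /signer; field.
Qed.

Let signer_cvg (y : R) : `|y| <= 1 -> iter n signer y @[n --> \oo] --> Num.sg y.
Proof.
have pos (z : R) : 0 < z -> z <= 1 -> iter n signer z @[n --> \oo] --> (1 : R).
  move=> z0 z1.
  have step n : z <= iter n signer z <= 1 /\ 1 - iter n signer z <= (1 - z / 2) ^+ n.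
    elim: n => [|n [/andP[ih1 ih2] ih3]]; first by rewrite /= lexx z1 expr0; lra.
    rewrite iterS; set u := iter n signer z in ih1 ih2 ih3 *.
    have u1 : signer u <= 1.
      by have := @signer_le1 u; rewrite !ler_norml => /(_ _)/andP[]//; lra.
    have e : 1 - signer u = (1 - u) * (1 - u / 2 - u ^+ 2 / 2) by rewrite /signer; field.
    have u2 : u <= signer u.
      have : 0 <= u * (1 - u ^+ 2) by rewrite mulr_ge0//; nra.
      by rewrite /signer; nra.
    split; first by rewrite u1 (le_trans ih1).
    rewrite e (exprSr (1 - z / 2)); apply: ler_pM => //; [lra|nra|nra].
  apply/cvgrPdist_le => e e0.
  have /cvgrPdist_le/(_ _ e0) : (1 - z / 2) ^+ n @[n --> \oo] --> (0 : R).
    by apply: cvg_expr; rewrite ger0_norm; lra.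
  apply: filterS => n; rewrite sub0r normrN => h.
  have [/andP[s1 s2] s3] := step n.
  by rewrite ger0_norm ?subr_ge0//; apply: le_trans s3 (le_trans (ler_norm _) h).
move=> y1; have [y0|y0|->] := ltgtP y 0.
- rewrite ltr0_sg// -[y]opprK.
  have -> : (fun n => iter n signer (- - y)) = (fun n => - iter n signer (- y)).
    apply/funext => n; elim: n => [//|n ih]; rewrite !iterS ih /signer.
    by rewrite sqrrN; ring.
  apply: cvgN; apply: pos; first by rewrite oppr_gt0.
  by move: y1; rewrite ler_norml; lra.
- rewrite gtr0_sg//; apply: pos => //.
  by move: y1; rewrite ler_norml; lra.
- rewrite sgr0 (_ : (fun n => _) = cst 0); first exact: cvg_cst.
  by apply/funext; elim=> [//|n ih]; rewrite iterS ih /signer !mul0r.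
Qed.

Let mult_sg_sin j a b : (j < N)%N -> mult j (fun x => Num.sg (sin (a * x + b))).
Proof.
move=> jN; apply: (@mult_lim j (fun n x => iter n signer (sin (a * x + b)))).
  elim=> [|n ih]; last exact: mult_signer ih.
  by split => [x|phi mphi]; [exact: sin_max|exact: trig_match_sin].
by move=> x; apply: signer_cvg; exact: sin_max.
Qed.

Let mult_sg j r : (j < N)%N -> mult j (fun x => Num.sg (x - r)).
Proof.
move=> jN; apply: (@mult_lim j (fun n x => Num.sg (sin (n.+1%:R^-1 * x + (- (n.+1%:R^-1 * r)))))).
  by move=> n; exact: mult_sg_sin.
move=> x; apply: cvg_near_cst; near=> n.
have n0 : 0 < n.+1%:R^-1 :> R by rewrite invr_gt0.
rewrite -mulrBr; set u := x - r.
have un : `|u| < n.+1%:R.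
  apply: lt_le_trans (_ : n%:R <= _); last by rewrite ler_nat.
  by near: n; exact: nbhs_infty_gtr.
have small : `|n.+1%:R^-1 * u| < pi.
  rewrite normrM ger0_norm ?(ltW n0)// mulrC ltr_pdivrMr// (lt_le_trans un)//.
  by rewrite ler_peMl//; have := pi_ge2 R; lra.
have sg_pos (v : R) : 0 < v -> v < pi -> Num.sg (sin v) = 1.
  by move=> v0 vp; rewrite gtr0_sg// sin_gt0_pi// v0.
have [u0|u0|->] := ltgtP u 0.
- rewrite [RHS]ltr0_sg// -[n.+1%:R^-1 * u]opprK sinN sgrN sg_pos//.
    by rewrite -mulrN mulr_gt0// oppr_gt0.
  by rewrite (le_lt_trans _ small)// -normrN ler_norm.
- rewrite [RHS]gtr0_sg// sg_pos// ?mulr_gt0//.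
  by rewrite (le_lt_trans _ small)// ler_norm.
- by rewrite mulr0 sin0 sgr0.
Unshelve. all: by end_near. Qed.

Lemma trig_match_ray phi j r : (j < N)%N -> trig_match phi ->
  trig_match (fun x => phi x * (x j <= r)%R%:R).
Proof.
move=> jN mphi; (* With [s] the sign of [x j - r], the indicator of [x j <= r] is [1 - (s ^+ 2 + s) / 2]. *)
have [_ ms] := mult_sg r jN.
have h1 := ms _ mphi; have h2 := ms _ h1.
have h := trig_match_lin 1 (- 2^-1) mphi (trig_match_lin 1 1 h2 h1).
apply: trig_match_ext h => x.
have [xr|rx|->] := ltgtP (x j) r.
- by rewrite ltr0_sg ?subr_lt0//=; field.
- by rewrite gtr0_sg ?subr_gt0//=; field.
- by rewrite subrr sgr0/=; field.
Qed.

(** A substitute for the uniqueness theorem for characteristic functions: orthants are reached one coordinate at a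
    time from the constant function [1], the only one for which the hypothesis is needed. *)
Lemma rays_of_trig (r : nat -> R) :
  (forall c t, (\int[P1]_w (cos (lin c (X1 ^~ w) + t))%:E =
                \int[P2]_w (cos (lin c (X2 ^~ w) + t))%:E)%E) ->
  P1 [set w | forall i, (i < N)%N -> X1 i w <= r i] =
  P2 [set w | forall i, (i < N)%N -> X2 i w <= r i].
Proof.
move=> h.
have m1 : trig_match (fun=> 1).
  split => //; first by exists 1 => x; rewrite normr1.
  by move=> c t; under eq_integral do rewrite mul1r; under [RHS]eq_integral do rewrite mul1r.
have mr k : (k <= N)%N -> trig_match (fun x => \prod_(i < k) (x i <= r i)%R%:R).
  elim: k => [_|k ih kN]; first by apply: trig_match_ext m1 => x; rewrite big_ord0.
  by apply: trig_match_ext (trig_match_ray (r k) kN (ih (ltnW kN))) => x; rewrite big_ord_recr.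
have [_ _ _ /(_ (fun=> 0) 0)] := mr N (leqnn N).
have e d (T : measurableType d) (P : {measure set T -> \bar R}) (X : nat -> T -> R) :
    (forall i, measurable_fun setT (X i)) ->
    (\int[P]_w (\prod_(i < N) (X i w <= r i)%R%:R * cos (lin (fun=> 0%R) (X ^~ w) + 0))%:E)%E =
    P [set w | forall i, (i < N)%N -> X i w <= r i].
  move=> mX; set A := [set w | _].
  have mA : measurable A.
    rewrite [A](_ : _ = \bigcap_(i in [set i | (i < N)%N]) (X i @^-1` `]-oo, r i])).
      apply: bigcap_measurableType => i _; rewrite -[X in measurable X]setTI.
      by apply: mX => //; exact: measurable_itv.
    by apply/seteqP; split => w Aw i iN; have := Aw i iN; rewrite /= in_itv.
  transitivity (\int[P]_w (\1_A w)%:E)%E; last by rewrite integral_indic// setIT.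
  apply: eq_integral => w _; congr EFin.
  have -> : lin (fun=> 0) (X ^~ w) + 0 = 0.
    by rewrite /lin big1 ?addr0// => i _; rewrite mul0r.
  rewrite cos0 mulr1 indicE; have [wA|wA] := boolP (w \in A).
    by rewrite big1// => i _; rewrite (set_mem wA).
  move/negP: wA => wA.
  have [i hi] : exists i : 'I_N, ~~ (X i w <= r i).
    apply: contrapT => /forallNP nex; apply: wA; rewrite inE => i iN.
    by apply/negPn/negP; exact: (nex (Ordinal iN)).
  by rewrite (bigD1 i)//= (negbTE hi) mul0r.
by rewrite (e _ _ P1 X1 mX1) (e _ _ P2 X2 mX2).
Qed.

End trigonometric_uniqueness.

(** * Integrals against normal laws *)

Section normal_integrals.
Context {R : realType}.
Implicit Types (m s a b c x y z l : R) (G : R -> R).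
Local Notation mu := (@lebesgue_measure R).

(** [normal_prob] has a density by definition, so the density is its Radon-Nikodym derivative. *)
Lemma ge0_integral_normal m s (f : R -> \bar R) : measurable_fun setT f ->
  (forall x, (0 <= f x)%E) ->
  (\int[normal_prob m s]_x f x = \int[mu]_x (f x * (normal_pdf m s x)%:E))%E.
Proof.
move=> mf f0.
have dom := @normal_prob_dominates R m s.
rewrite -(Radon_Nikodym_SigmaFinite.change_of_variables dom)//.
have mpdf : measurable_fun setT (fun x => (normal_pdf m s x)%:E).
  by apply/measurable_EFinP; exact: measurable_normal_pdf.
have iRN := Radon_Nikodym_SigmaFinite.f_integrable dom.
apply: ae_eq_integral => //.
- by apply: emeasurable_funM => //; exact: measurable_int iRN.
- exact: emeasurable_funM.
- apply: ae_eqe_mul2l; apply: integral_ae_eq => //.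
  by move=> E _ mE; rewrite -Radon_Nikodym_SigmaFinite.f_integral.
Qed.

Lemma normal_pdf_expE m s x : 0 < s ->
  normal_pdf m s x = (s * Num.sqrt (2 * pi))^-1 * expR (- ((x - m) ^+ 2 / (2 * s ^+ 2))).
Proof.
move=> s0; rewrite normal_pdfE ?gt_eqF// /normal_peak /normal_fun; congr (_^-1 * expR _).
  rewrite -mulr_natr -mulrA sqrtrM ?sqr_ge0// sqrtr_sqr ger0_norm ?(ltW s0)//.
  by rewrite (mulrC pi).
by rewrite mulNr -[s ^+ 2 *+ 2]mulr_natl.
Qed.

Lemma normal_exp_tilt m s l x : 0 < s ->
  expR (l * x) * normal_pdf m s x =
  expR (m * l + s ^+ 2 * l ^+ 2 / 2) * normal_pdf (m + s ^+ 2 * l) s x.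
Proof.
move=> s0; rewrite !normal_pdf_expE// !(mulrCA (expR _)) -!expRD; congr (_ * expR _).
by field; rewrite gt_eqF.
Qed.

Lemma normal_sq_tilt s l x : 0 < s -> 2 * l * s ^+ 2 < 1 ->
  let s' := s / Num.sqrt (1 - 2 * l * s ^+ 2) in
  expR (l * x ^+ 2) * normal_pdf 0 s x = (Num.sqrt (1 - 2 * l * s ^+ 2))^-1 * normal_pdf 0 s' x.
Proof.
move=> s0 ls; set q := Num.sqrt _ => s'.
have q0 : 0 < q by rewrite sqrtr_gt0 subr_gt0.
have qq : q ^+ 2 = 1 - 2 * l * s ^+ 2 by rewrite sqr_sqrtr// subr_ge0 ltW.
have s'0 : 0 < s' by rewrite divr_gt0.
have p0 : 0 < Num.sqrt (2 * pi) :> R by rewrite sqrtr_gt0 mulr_gt0// pi_gt0.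
rewrite !normal_pdf_expE// !(mulrCA (expR _)) -expRD [RHS]mulrA; congr (_ * expR _).
  by rewrite /s'; field; rewrite !gt_eqF.
rewrite !subr0 /s' expr_div_n qq; field.
by rewrite !gt_eqF// subr_gt0.
Qed.

(** Completing the square in [x]: the joint density of [(X, X + Y)] for independent centred normal variables of
    standard deviations [a] and [b] is the density of the sum times the conditional density of [X]. *)
Lemma normal_conv_pdf a b z x : 0 < a -> 0 < b ->
  let r := Num.sqrt (a ^+ 2 + b ^+ 2) in
  normal_pdf x b z * normal_pdf 0 a x =
  normal_pdf 0 r z * normal_pdf (z * a ^+ 2 / r ^+ 2) (a * b / r) x.
Proof.
move=> a0 b0 r.
have r0 : 0 < r by rewrite sqrtr_gt0 addr_gt0// exprn_gt0.
have rr : r ^+ 2 = a ^+ 2 + b ^+ 2 by rewrite sqr_sqrtr// addr_ge0// sqr_ge0.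
have ab0 : 0 < a * b / r by rewrite divr_gt0 ?mulr_gt0.
have p0 : 0 < Num.sqrt (2 * pi) :> R by rewrite sqrtr_gt0 mulr_gt0// pi_gt0.
rewrite !normal_pdf_expE// !(mulrACA _ (expR _)) -!expRD; congr (_ * expR _).
  by field; rewrite !gt_eqF.
rewrite expr_div_n rr subr0; field.
by rewrite !gt_eqF// addr_gt0// exprn_gt0.
Qed.

Lemma integral_exp_normal m s l : 0 < s ->
  (\int[normal_prob m s]_x (expR (l * x))%:E = (expR (m * l + s ^+ 2 * l ^+ 2 / 2))%:E)%E.
Proof.
move=> s0; rewrite ge0_integral_normal; last 2 first.
- apply/measurable_EFinP; apply: (measurableT_comp (@measurable_expR R)).
  exact: measurable_funM.
- by move=> x; rewrite lee_fin expR_ge0.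
under eq_integral do rewrite -EFinM normal_exp_tilt// EFinM.
rewrite ge0_integralZl//; last 2 first.
- by apply/measurable_EFinP; exact: measurable_normal_pdf.
- by move=> x _; rewrite lee_fin normal_pdf_ge0.
by rewrite integral_normal_pdf mule1.
Qed.

Lemma integral_sq_normal s l : 0 < s -> 2 * l * s ^+ 2 < 1 ->
  (\int[normal_prob 0 s]_x (expR (l * x ^+ 2))%:E = ((Num.sqrt (1 - 2 * l * s ^+ 2))^-1)%:E)%E.
Proof.
move=> s0 ls; rewrite ge0_integral_normal; last 2 first.
- apply/measurable_EFinP; apply: (measurableT_comp (@measurable_expR R)).
  by apply: measurable_funM => //; exact: measurable_funX.
- by move=> x; rewrite lee_fin expR_ge0.
under eq_integral do rewrite -EFinM normal_sq_tilt// EFinM.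
rewrite ge0_integralZl//; last 2 first.
- by apply/measurable_EFinP; exact: measurable_normal_pdf.
- by move=> x _; rewrite lee_fin normal_pdf_ge0.
by rewrite integral_normal_pdf mule1.
Qed.

Lemma integral_affine_normal c x G : 0 < c -> continuous G -> (forall y, 0 <= G y) ->
  (\int[normal_prob 0 1]_y (G (x + c * y))%:E = \int[mu]_z (G z * normal_pdf x c z)%:E)%E.
Proof.
move=> c0 cG G0.
have mG : measurable_fun setT G by exact: continuous_measurable_fun.
rewrite ge0_integral_normal; last 2 first.
- apply/measurable_EFinP; apply: (measurableT_comp mG).
  by apply: measurable_funD => //; exact: measurable_funM.
- by move=> y; rewrite lee_fin.
pose Fn (y : R^o) : R^o := x + c * y.
have dF y : is_derive y 1 (Fn : R -> R) c.
  have h := is_deriveD (is_derive_cst (x : R^o) (y : R^o) 1) (is_deriveZ c (is_derive_id (y : R^o) 1)).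
  rewrite /Fn; have := h; rewrite add0r /GRing.scale/= mulr1.
  by [].
have F'E : (Fn^`() = cst c)%classic.
  by apply/funext => y; rewrite derive1E; case: (dF y).
rewrite (@increasing_ge0_integration_by_substitutionT R Fn (fun z => G z * normal_pdf x c z)).
- apply: eq_integral => y _; rewrite F'E !fctE/= -EFinM -mulrA; congr (G _ * _)%:E.
  rewrite !normal_pdf_expE// [RHS]mulrAC; congr (_ * expR _); first by field; rewrite !gt_eqF ?sqrtr_gt0 ?mulr_gt0 ?pi_gt0.
  by rewrite /Fn; field; rewrite gt_eqF.
- by move=> y z yz; rewrite /Fn ltrD2l ltr_pM2l.
- by rewrite F'E => y; exact: cvg_cst.
- by rewrite F'E; exact: is_cvg_cst.
- by rewrite F'E; exact: is_cvg_cst.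
- by move=> y; case: (dF y).
- apply: cvg_comp (cvg_addrl_Ny x); exact: gt0_cvgMrNy.
- apply: cvg_comp (cvg_addrl x); exact: gt0_cvgMry.
- by move=> z; apply: cvgM; [exact: cG|apply: continuous_normal_pdf; rewrite gt_eqF].
- by move=> z; rewrite mulr_ge0// normal_pdf_ge0.
Qed.

End normal_integrals.

(** * Gaussian random variables *)

Section gaussian_laws.
Context {R : realType}.
Implicit Types (m s l x : R).

(** The normal law of standard deviation [0] has to be singled out as a Dirac mass, as in [gaussian]. *)
Definition gint m s (f : R -> \bar R) : \bar R :=
  if s == 0 then f m else (\int[normal_prob m s]_x f x)%E.

Lemma gint_exp m s l : 0 <= s ->
  gint m s (fun x => (expR (l * x))%:E) = (expR (m * l + s ^+ 2 * l ^+ 2 / 2))%:E.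
Proof.
rewrite le_eqVlt => /predU1P[<-|s0]; rewrite /gint; last by rewrite gt_eqF// integral_exp_normal.
by rewrite eqxx; congr (expR _)%:E; ring.
Qed.

Lemma gint_exp_sq s l : 0 <= s -> 2 * l * s ^+ 2 < 1 ->
  gint 0 s (fun x => (expR (l * x ^+ 2))%:E) = ((Num.sqrt (1 - 2 * l * s ^+ 2))^-1)%:E.
Proof.
rewrite le_eqVlt => /predU1P[<-|s0] ls; rewrite /gint; last by rewrite gt_eqF// integral_sq_normal.
by rewrite eqxx !expr0n/= !mulr0 subr0 expR0 sqrtr1 invr1.
Qed.

Lemma sq_le_exp x : x ^+ 2 <= 4 * (expR x + expR (- x)).
Proof.
have pos (y : R) : 0 <= y -> y ^+ 2 <= 4 * expR y.
  move=> y0; have -> : y = y / 2 + y / 2 by field.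
  rewrite expRD; have h := expR_ge1Dx (y / 2).
  have h0 : 0 <= y / 2 by rewrite divr_ge0.
  set z : R := y / 2 in h h0 *; set e : R := expR z in h *; nra.
have e1 := expR_ge0 x; have e2 := expR_ge0 (- x).
have [x0|x0] := leP 0 x; first by have := pos _ x0; lra.
have h := pos (- x); rewrite sqrrN in h; have := h (ltW _); lra.
Qed.

Context d (T : measurableType d) (P : probability T R) (V : T -> R).
Hypotheses (mV : measurable_fun setT V) (gV : gaussian P V).

Lemma gaussian_integral : exists m s, 0 <= s /\
  forall f : R -> \bar R, measurable_fun setT f -> (forall x, (0 <= f x)%E) ->
  (\int[P]_w f (V w) = gint m s f)%E.
Proof.
have [m [s [s0 h]]] := gV; exists m, s; split => // f mf f0.
rewrite /gint; case: eqP h => [_|_] h.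
  rewrite -(@ge0_integral_pushforward _ _ _ _ R V mV P setT f)//.
  rewrite (@eq_measure_integral _ _ R setT (\d_m)); last by move=> A mA _; exact: h.
  by rewrite integral_dirac// diracT mul1e.
rewrite -(@ge0_integral_pushforward _ _ _ (measurableTypeR R) R V mV P setT f)//.
by apply: eq_measure_integral => A mA _; exact: h.
Qed.

(** The exponential moments are finite, and they dominate the square. *)
Lemma gaussian_sq_integrable : P.-integrable setT (fun w => (V w ^+ 2)%:E).
Proof.
have [m [s [s0 h]]] := gaussian_integral.
have mexp l : measurable_fun setT (fun x : R => (expR (l * x))%:E).
  apply/measurable_EFinP; apply: (measurableT_comp (@measurable_expR R)).
  exact: measurable_funM.
have iexp l : P.-integrable setT (fun w => (expR (l * V w))%:E).
  apply/integrableP; split; first exact: (measurableT_comp (mexp l)).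
  under eq_integral do rewrite gee0_abs ?lee_fin ?expR_ge0//.
  have p x : (0 <= (expR (l * x))%:E)%E by rewrite lee_fin expR_ge0.
  by rewrite (h _ (mexp l) p) gint_exp// ltry.
apply: (@le_integrable _ _ _ P setT measurableT _
  (fun w => 4%:E * ((expR (1 * V w))%:E + (expR (-1 * V w))%:E))%E).
- by apply/measurable_EFinP; exact: measurable_funX.
- move=> w _; rewrite -EFinD -EFinM lee_fin ger0_norm ?sqr_ge0// ger0_norm.
    by rewrite mul1r mulN1r sq_le_exp.
  by rewrite mulr_ge0// addr_ge0// expR_ge0.
- by apply: integrableZl => //; exact: integrableD.
Qed.

Lemma gaussian_integrable : P.-integrable setT (fun w => (V w)%:E).
Proof.
apply: (@le_integrable _ _ _ P setT measurableT _ (fun w => (1 + (V w ^+ 2)%:E)%E)).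
- exact/measurable_EFinP.
- move=> w _; rewrite -EFinD lee_fin [X in _ <= X]ger0_norm ?addr_ge0 ?sqr_ge0//.
  rewrite -(real_normK (num_real (V w))); set x := `|_|; nra.
- by apply: integrableD => //; [exact: finite_measure_integrable_cst|exact: gaussian_sq_integrable].
Qed.

(** The parameters of a gaussian law are recovered from its moments through Jensen's inequality alone, without
    computing the first two moments of the normal law: [E exp (l V) >= 1] for all [l] forces the mean to vanish, and
    [E exp (l V^2) >= 1 + l v] for all small [l] of both signs forces the variance to be [v]. *)
Lemma centered_gaussian_integral v :
  (\int[P]_w (V w)%:E = 0)%E -> (\int[P]_w (V w ^+ 2)%:E = v%:E)%E ->
  forall f : R -> \bar R, measurable_fun setT f -> (forall x, (0 <= f x)%E) ->
  (\int[P]_w f (V w) = gint 0 (Num.sqrt v) f)%E.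
Proof.
move=> V1 V2; have [m [s [s0 h]]] := gaussian_integral.
have i1 := gaussian_integrable; have i2 := gaussian_sq_integrable.
have v0 : 0 <= v.
  by rewrite -lee_fin -V2; apply: integral_ge0 => w _; rewrite lee_fin sqr_ge0.
have jensen (g : R -> R) (c b : R) : measurable_fun setT g ->
    P.-integrable setT (fun w => (g (V w))%:E) -> (\int[P]_w (g (V w))%:E = c%:E)%E ->
    gint m s (fun x => (expR (g x))%:E) = b%:E -> 1 + c <= b.
  move=> mg ig cE bE.
  have mgV : measurable_fun setT (fun w => (expR (g (V w)))%:E).
    apply/measurable_EFinP; apply: (measurableT_comp (@measurable_expR R)).
    exact: measurableT_comp mg mV.
  have hb : (\int[P]_w (expR (g (V w)))%:E = b%:E)%E.
    rewrite -bE (h (fun x => (expR (g x))%:E))//.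
    by apply/measurable_EFinP; exact: (measurableT_comp (@measurable_expR R)).
  rewrite -lee_fin -hb.
  have -> : (1 + c)%:E = (\int[P]_w (1 + (g (V w))%:E))%E.
    rewrite integralD//; last exact: finite_measure_integrable_cst.
    by rewrite integral_cst// cE [X in (_ * X)%E]probability_setT mule1.
  apply: le_integral => //.
  - by apply: integrableD => //; exact: finite_measure_integrable_cst.
  - apply/integrableP; split => //.
    by under eq_integral do rewrite gee0_abs ?lee_fin ?expR_ge0//; rewrite hb ltry.
  - by move=> w _; rewrite -EFinD lee_fin expR_ge1Dx.
have m0 : m = 0.
  have key l : 0 <= m * l + s ^+ 2 * l ^+ 2 / 2.
    rewrite -ler_expR expR0 -[X in X <= _]addr0.
    apply: (jensen (fun x => l * x)) (gint_exp m l s0).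
    - exact: measurable_funM.
    - by under eq_fun do rewrite EFinM; exact: integrableZl.
    - by under eq_integral do rewrite EFinM; rewrite integralZl// V1 mule0.
  have q0 : 0 < s ^+ 2 + 1 by rewrite ltr_wpDl ?sqr_ge0.
  have := key (- m / (s ^+ 2 + 1)).
  rewrite (_ : _ + _ = - (m ^+ 2 * (s ^+ 2 / 2 + 1) / (s ^+ 2 + 1) ^+ 2)); last by field; rewrite gt_eqF.
  rewrite oppr_ge0 ler_pdivrMr ?exprn_gt0// mul0r => h1.
  by apply/eqP; rewrite -sqrf_eq0 eq_le sqr_ge0 andbT; have h2 := sqr_ge0 s; have h3 := sqr_ge0 m; nra.
suff -> : Num.sqrt v = s by rewrite -{1}m0; exact: h.
have key l : 2 * l * s ^+ 2 < 1 -> 0 <= 1 + l * v -> (1 + l * v) ^+ 2 * (1 - 2 * l * s ^+ 2) <= 1.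
  move=> ls lv; have l1 : 0 < 1 - 2 * l * s ^+ 2 by rewrite subr_gt0.
  have q0 : 0 < Num.sqrt (1 - 2 * l * s ^+ 2) by rewrite sqrtr_gt0.
  have h2 : 1 + l * v <= (Num.sqrt (1 - 2 * l * s ^+ 2))^-1.
    move: (gint_exp_sq s0 ls); rewrite -{1}m0; apply: (jensen (fun x => l * x ^+ 2)).
    - by apply: measurable_funM => //; exact: measurable_funX.
    - by under eq_fun do rewrite EFinM; exact: integrableZl.
    - by under eq_integral do rewrite EFinM; rewrite integralZl// V2.
  move: h2; rewrite -[X in _ <= X]mul1r ler_pdivlMr// => h2.
  have e := sqr_sqrtr (ltW l1); rewrite -[X in _ * X <= _]e -exprMn exprn_ile1//.
  by rewrite mulr_ge0// ltW.
suff -> : v = s ^+ 2 by rewrite sqrtr_sqr ger0_norm.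
have v0' : 0 <= v by [].
set q : R := s ^+ 2 in key *; have q0 : 0 <= q by rewrite sqr_ge0.
(* To first order in [l], [key] says [l * (v - q) <= 0]; [l] is proportional to [v - q], and small enough for the
   second order to be negligible. *)
pose D : R := v - q; pose K : R := 1 + 4 * (v * q) + 2 * (v ^+ 2 * q).
pose M : R := K + 2 * (1 + v + q) ^+ 2.
have vq0 := mulr_ge0 v0 q0; have vvq0 := mulr_ge0 (sqr_ge0 v) q0.
have K0 : 0 < K by rewrite /K; lra.
have M0 : 0 < M by rewrite /M ltr_wpDr// mulr_ge0// sqr_ge0.
pose l : R := D / M.
have lM : l * M = D by rewrite /l divfK// gt_eqF.
have l_le : `|l| * (2 * (1 + v + q)) < 1.
  rewrite normrM normfV (gtr0_norm M0) mulrAC ltr_pdivrMr// mul1r.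
  have Dle : `|D| <= 1 + v + q by rewrite ler_norml /D; apply/andP; split; lra.
  have p0 : 0 <= 1 + v + q by lra.
  apply: (@le_lt_trans _ _ (2 * (1 + v + q) ^+ 2)); last by rewrite /M ltrDr.
  by rewrite mulrCA ler_pM2l// [X in _ <= X]expr2 ler_wpM2r.
have := ler_norm l; have := ler_norm (- l); rewrite normrN => l1 l2.
have nl0 := normr_ge0 l.
have hl : (1 + l * v) ^+ 2 * (1 - 2 * l * q) <= 1.
  apply: key.
    by have := mulr_ge0 nl0 v0; have := ler_wpM2r q0 l2; lra.
  by have := mulr_ge0 nl0 q0; have := ler_wpM2r v0 l1; lra.
have lle1 : l <= 1 by have := mulr_ge0 nl0 v0; have := mulr_ge0 nl0 q0; lra.
have h1 : 2 * (l * D) <= l ^+ 2 * K.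
  have h2 := ler_wpM2r (mulr_ge0 (sqr_ge0 l) vvq0) lle1.
  have h3 := mulr_ge0 (sqr_ge0 l) (sqr_ge0 v); have h4 := sqr_ge0 l.
  rewrite /D /K; move: hl h2 h3 h4; rewrite !mul1r => hl h2 h3 h4; nra.
have l0 : l = 0.
  apply/eqP; rewrite -sqrf_eq0 eq_le sqr_ge0 andbT.
  have MK : K <= M by rewrite /M lerDl mulr_ge0// sqr_ge0.
  have h2 := ler_wpM2l (sqr_ge0 l) MK.
  rewrite -lM in h1; have h3 : l ^+ 2 * M <= 0 by rewrite expr2 in h1 h2 *; nra.
  by move: h3; rewrite pmulr_lle0.
by apply/eqP; rewrite -subr_eq0 -/D -lM l0 mul0r.
Qed.

End gaussian_laws.

(** * The innovation of a stationary gaussian chain *)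

Section gaussian_sums.
Context {R : realType} d (T : measurableType d) (P : probability T R).

Lemma gaussian_mul_integrable (Y Z : T -> R) : measurable_fun setT Y -> measurable_fun setT Z ->
  gaussian P Y -> gaussian P Z -> P.-integrable setT (fun w => (Y w * Z w)%:E).
Proof.
move=> mY mZ gY gZ.
have iY := gaussian_sq_integrable mY gY; have iZ := gaussian_sq_integrable mZ gZ.
apply: (@le_integrable _ _ _ P setT measurableT _ (fun w => ((Y w ^+ 2)%:E + (Z w ^+ 2)%:E)%E)).
- by apply/measurable_EFinP; exact: measurable_funM.
- move=> w _; rewrite -EFinD lee_fin [X in _ <= X]ger0_norm ?addr_ge0 ?sqr_ge0//.
  rewrite ler_norml; have h1 := sqr_ge0 (Y w + Z w); have h2 := sqr_ge0 (Y w - Z w).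
  by have h3 := sqr_ge0 (Y w); have h4 := sqr_ge0 (Z w); apply/andP; split; nra.
- exact: integrableD.
Qed.

Lemma gaussian_sum_integral n (Y : 'I_n -> T -> R) (C : 'I_n -> 'I_n -> R) :
  (forall i, measurable_fun setT (Y i)) -> (forall i, gaussian P (Y i)) ->
  gaussian P (fun w => \sum_(i < n) Y i w) ->
  (forall i, \int[P]_w (Y i w)%:E = 0)%E ->
  (forall i j, \int[P]_w (Y i w * Y j w)%:E = (C i j)%:E)%E ->
  forall f : R -> \bar R, measurable_fun setT f -> (forall x, (0 <= f x)%E) ->
  (\int[P]_w f (\sum_(i < n) Y i w)%R = gint 0 (Num.sqrt (\sum_(i < n) \sum_(j < n) C i j)) f)%E.
Proof.
move=> mY gY gV Y1 Y2.
have iY i := gaussian_integrable (mY i) (gY i).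
have iYY i j := gaussian_mul_integrable (mY i) (mY j) (gY i) (gY j).
apply: (centered_gaussian_integral _ gV).
- exact: measurable_sum.
- under eq_integral do rewrite -sumEFin.
  by rewrite integral_sum// big1.
- have e w : ((\sum_(i < n) Y i w) ^+ 2)%:E = (\sum_(i < n) \sum_(j < n) (Y i w * Y j w)%:E)%E.
    rewrite expr2 mulr_suml -sumEFin; apply: eq_bigr => i _.
    by rewrite mulr_sumr -sumEFin.
  under eq_integral do rewrite e.
  rewrite integral_sum//; last by move=> i; exact: integrable_sum.
  rewrite -sumEFin; apply: eq_bigr => i _.
  by rewrite integral_sum// -sumEFin; apply: eq_bigr.
Qed.

End gaussian_sums.

Section normal_convolution.
Context {R : realType}.
Implicit Types (c s x z : R) (G : R -> R).
Local Notation mu := (@lebesgue_measure R).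
Local Notation N01 := (normal_prob (0 : R) (1 : R)).

Lemma measurable_normal_pdf2 c : 0 < c ->
  measurable_fun setT (fun p : R * R => normal_pdf p.1 c p.2).
Proof.
move=> c0; under eq_fun do rewrite normal_pdf_expE//.
apply: measurable_funM => //; apply: (measurableT_comp (@measurable_expR R)).
apply: measurableT_comp => //; apply: measurable_funM => //.
by apply: measurable_funX; apply: measurable_funB.
Qed.

Lemma measurable_affine_integral c G : measurable_fun setT G -> (forall x, 0 <= G x) ->
  measurable_fun setT (fun x => (\int[N01]_y (G (x + c * y))%:E)%E).
Proof.
move=> mG G0.
apply: (@measurable_fun_fubini_tonelli_F _ _ _ _ R N01 (fun p : R * R => (G (p.1 + c * p.2))%:E)).
  apply/measurable_EFinP; apply: (measurableT_comp mG).
  by apply: measurable_funD => //; apply: measurable_funM.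
by move=> p; rewrite lee_fin.
Qed.

(** The sum of independent centred normal variables is normal.  The continuity of [G] is what the change of variables
    [z = x + c * y] asks for. *)
Lemma gint_conv s c G : 0 <= s -> 0 <= c -> continuous G -> (forall x, 0 <= G x) ->
  gint 0 s (fun x => (\int[N01]_y (G (x + c * y))%:E)%E) =
  gint 0 (Num.sqrt (s ^+ 2 + c ^+ 2)) (fun x => (G x)%:E).
Proof.
move=> s0 c0 cG G0; have mG : measurable_fun setT G by exact: continuous_measurable_fun.
move: c0; rewrite le_eqVlt => /predU1P[<-|c0].
  rewrite expr0n addr0 sqrtr_sqr ger0_norm//; congr gint; apply/funext => x.
  under eq_integral do rewrite mul0r addr0.
  by rewrite integral_cst// [X in (_ * X)%E]probability_setT mule1.
move: s0; rewrite le_eqVlt => /predU1P[<-|s0].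
  have -> : Num.sqrt (0 ^+ 2 + c ^+ 2) = c by rewrite expr0n add0r sqrtr_sqr gtr0_norm.
  rewrite /gint (negbTE (lt0r_neq0 c0)) eqxx.
  rewrite integral_affine_normal// ge0_integral_normal//.
  exact/measurable_EFinP.
set r := Num.sqrt _; have r0 : 0 < r by rewrite sqrtr_gt0 addr_gt0// exprn_gt0.
have sc0 : 0 < s * c / r by rewrite divr_gt0 ?mulr_gt0.
rewrite /gint (negbTE (lt0r_neq0 s0)) (negbTE (lt0r_neq0 r0)) ge0_integral_normal; last 2 first.
- exact: measurable_affine_integral.
- by move=> x; apply: integral_ge0 => y _; rewrite lee_fin.
under eq_integral => x _.
  rewrite integral_affine_normal// -ge0_integralZr//; last 3 first.
  - apply/measurable_EFinP; apply: measurable_funM => //.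
    by apply: measurable_normal_pdf; rewrite gt_eqF.
  - by move=> z _; rewrite lee_fin mulr_ge0// normal_pdf_ge0.
  - by rewrite lee_fin normal_pdf_ge0.
  over.
rewrite (@fubini_tonelli _ _ _ _ R mu mu (fun p : R * R =>
  ((G p.2 * normal_pdf p.1 c p.2)%:E * (normal_pdf 0 s p.1)%:E)%E))/=; last 2 first.
- apply: emeasurable_funM; apply/measurable_EFinP.
    apply: measurable_funM; first exact: (measurableT_comp mG measurable_snd).
    exact: measurable_normal_pdf2.
  exact: (measurableT_comp (@measurable_normal_pdf R 0 s) measurable_fst).
- by move=> p; rewrite mule_ge0// lee_fin ?mulr_ge0// normal_pdf_ge0.
rewrite ge0_integral_normal; last 2 first.
- exact/measurable_EFinP.
- by move=> x; rewrite lee_fin.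
apply: eq_integral => z _.
under eq_integral => x _.
  rewrite -EFinM -mulrA normal_conv_pdf// mulrA EFinM.
  over.
rewrite ge0_integralZl//.
- by rewrite integral_normal_pdf mule1 EFinM.
- by apply/measurable_EFinP; exact: measurable_normal_pdf.
- by move=> x _; rewrite lee_fin normal_pdf_ge0.
- by rewrite lee_fin mulr_ge0// normal_pdf_ge0.
Qed.

End normal_convolution.

Section stationary_chain.
Context {R : realType} d (T : measurableType d) (P : probability T R).
Local Notation N01 := (normal_prob (0 : R) (1 : R)).

Definition qform (r : nat -> nat -> R) n (c : nat -> R) : R :=
  \sum_(i < n) \sum_(j < n) c i * c j * r i j.

Lemma qform_recr r n c : (forall i j, r i j = r j i) ->
  qform r n.+1 c = qform r n c + 2 * c n * (\sum_(i < n) c i * r i n) + c n ^+ 2 * r n n.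
Proof.
move=> rC; rewrite /qform big_ord_recr/=.
under eq_bigr do rewrite big_ord_recr/=.
rewrite big_split/= big_ord_recr/= -!addrA; congr (_ + _).
rewrite [LHS]addrA; congr (_ + _).
rewrite mulr_sumr -big_split/=; apply: eq_bigr => i _.
by rewrite (rC n i); ring.
Qed.

(* The covariances are [rho ^+ |i - j|], and [lawX] says that the linear combinations are centred and gaussian. *)
Variables (X : nat -> T -> R) (rho : R).
Hypotheses (mX : forall i, measurable_fun setT (X i)) (rho01 : 0 <= rho <= 1).
Let r (i j : nat) : R := rho ^+ `|i - j|%N.
Hypothesis lawX : forall n (c : nat -> R) (f : R -> \bar R), measurable_fun setT f ->
  (forall x, (0 <= f x)%E) ->
  (\int[P]_w f (\sum_(i < n) c i * X i w)%R = gint 0 (Num.sqrt (qform r n c)) f)%E.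

(* The first [k.+1] variables of the chain, followed by the variable rebuilt from the last of them and from an
   independent standard normal variable. *)
Let innov k : nat -> T * R -> R := fun i w =>
  if (i <= k)%N then X i w.1 else rho * X k w.1 + Num.sqrt (1 - rho ^+ 2) * w.2.

(* Moving [rho] times the last coefficient onto the previous one leaves an independent innovation. *)
Let qform_innov k (c : nat -> R) :
  let c' i := if i == k then c k + rho * c k.+1 else c i in
  qform r k.+2 c = qform r k.+1 c' + (c k.+1 * Num.sqrt (1 - rho ^+ 2)) ^+ 2.
Proof.
move=> c'; have rC i j : r i j = r j i by rewrite /r distnC.
have rr i : r i i = 1 by rewrite /r distnn.
have r2 : 0 <= 1 - rho ^+ 2.
  by have /andP[? ?] := rho01; rewrite subr_ge0 exprn_ile1.
rewrite exprMn sqr_sqrtr// (qform_recr _ _ rC) !rr [X in X + _ + _](qform_recr _ _ rC).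
rewrite (qform_recr _ c' rC) !rr.
have -> : qform r k c' = qform r k c.
  by apply: eq_bigr => i _; apply: eq_bigr => j _; rewrite /c' !ltn_eqF.
have -> : \sum_(i < k) c' i * r i k = \sum_(i < k) c i * r i k.
  by apply: eq_bigr => i _; rewrite /c' ltn_eqF.
have -> : \sum_(i < k.+1) c i * r i k.+1 = rho * (\sum_(i < k) c i * r i k + c k).
  rewrite big_ord_recr/= mulrDr mulr_sumr; congr (_ + _).
    apply: eq_bigr => i _; rewrite mulrCA; congr (_ * _).
    have ik := ltnW (ltn_ord i).
    by rewrite /r (distnEr ik) (distnEr (leqW ik)) (subSn ik) exprS.
  by rewrite /r (distnS k) expr1 mulrC.
rewrite /c' eqxx; ring.
Qed.

Let qform_ge0 n (c : nat -> R) : 0 <= qform r n c.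
Proof.
elim: n c => [|[|n] ih] c; first by rewrite /qform big_ord0.
  by rewrite /qform !big_ord1 /r distnn expr0 mulr1 -expr2 sqr_ge0.
by rewrite qform_innov addr_ge0// sqr_ge0.
Qed.

Let minnov k i : measurable_fun setT (innov k i).
Proof.
rewrite /innov; case: (i <= k)%N; first exact: (measurableT_comp (mX i) measurable_fst).
have m1 : measurable_fun setT (fun w : T * R => X k w.1).
  exact: (measurableT_comp (mX k) measurable_fst).
have m2 : measurable_fun setT (fun w : T * R => w.2) by exact: measurable_snd.
exact: measurable_funD (measurable_funM (measurable_cst _) m1) (measurable_funM (measurable_cst _) m2).
Qed.

Let lin n (c : nat -> R) (x : nat -> R) := \sum_(i < n) c i * x i.

Let sum_innov k (c : nat -> R) w :
  let c' i := if i == k then c k + rho * c k.+1 else c i in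
  lin k.+2 c (innov k ^~ w) =
  lin k.+1 c' (X ^~ w.1) + c k.+1 * Num.sqrt (1 - rho ^+ 2) * w.2.
Proof.
move=> c'; rewrite /lin 2!big_ord_recr [in RHS]big_ord_recr/=.
have -> : \sum_(i < k) c' i * X i w.1 = \sum_(i < k) c i * X i w.1.
  by apply: eq_bigr => i _; rewrite /c' ltn_eqF.
have -> : \sum_(i < k) c i * innov k i w = \sum_(i < k) c i * X i w.1.
  by apply: eq_bigr => i _; rewrite /innov ltnW.
by rewrite /c' eqxx /innov leqnn ltnn; ring.
Qed.

Let mlin n (c : nat -> R) : measurable_fun setT (fun w => lin n c (X ^~ w)).
Proof. by apply: measurable_sum => i; exact: measurable_funM. Qed.

Let raised_cos_innov k c t : 0 <= c k.+1 ->
  (\int[P]_w (1 + cos (lin k.+2 c (X ^~ w) + t))%:E =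
   \int[P \x N01]_w (1 + cos (lin k.+2 c (innov k ^~ w) + t))%:E)%E.
Proof.
move=> ck0; pose G (x : R) : R := 1 + cos (x + t).
have cG : continuous G.
  move=> x; apply: cvgD; first exact: cvg_cst.
  apply: (@continuous_comp _ _ _ (fun y : R => y + t) cos); last exact: continuous_cos.
  by apply: cvgD; [exact: cvg_id|exact: cvg_cst].
have G0 x : 0 <= G x by rewrite /G -lerBlDl sub0r cos_geN1.
have mG : measurable_fun setT G by exact: continuous_measurable_fun.
have G0' x : (0 <= (G x)%:E)%E by rewrite lee_fin.
have mGE : measurable_fun setT (fun x => (G x)%:E) by exact/measurable_EFinP.
rewrite (lawX _ _ mGE G0') qform_innov.
set c' := fun i => _; set g := c k.+1 * _.
have g0 : 0 <= g by rewrite mulr_ge0// sqrtr_ge0.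
rewrite fubini_tonelli1; last 2 first.
- apply/measurable_EFinP; apply: (measurableT_comp mG).
  by apply: measurable_sum => i; exact: measurable_funM (measurable_cst _) (minnov k i).
- by move=> w; exact: G0'.
rewrite /fubini_F.
under [RHS]eq_integral => w _.
  under eq_integral => y _ do rewrite sum_innov.
  over.
rewrite -/c' -/g /=.
rewrite (lawX k.+1 c' (measurable_affine_integral g mG G0)); last first.
  by move=> x; apply: integral_ge0 => y _.
rewrite (gint_conv (sqrtr_ge0 _) g0 cG G0).
congr (gint 0 (Num.sqrt (_ + _))); rewrite sqr_sqrtr; [by []|exact: qform_ge0].
Qed.

Let cos_innov k c t :
  (\int[P]_w (cos (lin k.+2 c (X ^~ w) + t))%:E =
   \int[P \x N01]_w (cos (lin k.+2 c (innov k ^~ w) + t))%:E)%E.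
Proof.
(* The cosine is even, so the signs of [t] and of all coefficients may be changed together. *)
wlog ck0 : c t / 0 <= c k.+1 => [hw|].
  have [c0|c0] := leP 0 (c k.+1); first exact: hw.
  have linN (x : nat -> R) : lin k.+2 c x = - lin k.+2 (fun i => - c i) x.
    by rewrite /lin -sumrN; apply: eq_bigr => i _; rewrite mulNr opprK.
  have cosN_lin (x : nat -> R) : cos (lin k.+2 c x + t) = cos (lin k.+2 (fun i => - c i) x + - t).
    by rewrite linN -cosN opprD opprK.
  under eq_integral do rewrite cosN_lin.
  under [RHS]eq_integral do rewrite cosN_lin.
  by apply: hw; rewrite oppr_ge0 ltW.
have := raised_cos_innov t ck0.
have split_cos d' (S : measurableType d') (Q : probability S R) (Z : S -> R) :
    measurable_fun setT Z ->
    (\int[Q]_w (1 + cos (Z w))%:E = 1 + \int[Q]_w (cos (Z w))%:E)%E.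
  move=> mZ; have mc : measurable_fun setT (fun w => cos (Z w)).
    by apply: measurableT_comp mZ; apply: continuous_measurable_fun; exact: continuous_cos.
  under eq_integral do rewrite EFinD.
  rewrite integralD//; last 2 first.
  - exact: finite_measure_integrable_cst.
  - apply: (@integrable_le_bound _ _ _ Q _ (fun w => cos (Z w)) 1) => //.
    + by rewrite [X in (X < _)%E]probability_setT ltry.
    + by move=> w; rewrite ler_norml cos_geN1 cos_le1.
  by rewrite integral_cst// [X in (_ * X)%E]probability_setT mule1.
rewrite split_cos; last by apply: measurable_funD => //; exact: mlin.
rewrite (split_cos _ _ (P \x N01)%E); last first.
  apply: measurable_funD => //; apply: measurable_sum => i.
  exact: measurable_funM (measurable_cst _) (minnov k i).
by move=> /(congr1 (fun z => (z - 1%:E)%E)); rewrite /= !(addeC 1%E) !addeK.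
Qed.

(** The variable [X k.+1] is, jointly with the past, distributed as [rho * X k] plus an independent normal variable: the
    expectations of [1 + cos], which is nonnegative and continuous as [gint_conv] requires, agree for all linear
    combinations. *)
Lemma innovation_rays k (b : nat -> R) :
  P [set w | forall i, (i < k.+2)%N -> X i w <= b i] =
  (P \x N01)%E [set w : T * R | forall i, (i < k.+2)%N -> innov k i w <= b i].
Proof.
apply: rays_of_trig => //.
- by rewrite [X in (X < _)%E]probability_setT ltry.
- by rewrite [X in (X < _)%E]probability_setT ltry.
- exact: minnov.
- exact: cos_innov.
Qed.

End stationary_chain.

(** * Gaussian tails and exponential tilting *)

Section gaussian_tails.
Context {R : realType}.
Implicit Types (m a b eta x y : R).
Local Notation mu := (@lebesgue_measure R).

Definition phi x : R := (Num.sqrt (2 * pi))^-1 * expR (- (x ^+ 2 / 2)).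

Lemma normal_pdf01E x : normal_pdf 0 1 x = phi x.
Proof. by rewrite normal_pdf_expE// mul1r subr0 expr1n mulr1. Qed.

Lemma phi_ge0 x : 0 <= phi x.
Proof. by rewrite mulr_ge0 ?expR_ge0// invr_ge0 sqrtr_ge0. Qed.

Lemma phiN x : phi (- x) = phi x.
Proof. by rewrite /phi sqrrN. Qed.

Lemma le_phi x y : `|x| <= `|y| -> phi y <= phi x.
Proof.
move=> xy; rewrite ler_wpM2l ?invr_ge0 ?sqrtr_ge0// ler_expR lerN2 ler_wpM2r//.
by rewrite -(real_normK (num_real x)) -(real_normK (num_real y)) lerXn2r ?nnegrE.
Qed.

Lemma is_derive_phi x : is_derive x 1 phi (- (x * phi x)).
Proof.
have h1 : is_derive x 1 (fun y : R => 0 - y ^+ 2 * 2^-1) (- x).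
  apply: is_derive_eq1 (is_deriveB1 (is_derive_cst1 0 x)
    (is_deriveM1 (is_deriveX1 2 (is_derive_id1 x)) (is_derive_cst1 2^-1 x))) _.
  by rewrite expr1; field.
have h2 : is_derive x 1 (fun y : R => expR (0 - y ^+ 2 * 2^-1)) (expR (- (x ^+ 2 / 2)) * - x).
  have := @is_derive1_comp R (@expR R) (fun y : R => 0 - y ^+ 2 * 2^-1) x _ _ (is_derive_expR _) h1.
  by rewrite sub0r.
have -> : phi = fun y => (Num.sqrt (2 * pi))^-1 * expR (0 - y ^+ 2 * 2^-1).
  by apply/funext => y; rewrite sub0r.
apply: is_derive_eq1 (is_deriveM1 (is_derive_cst1 _ x) h2) _.
by rewrite sub0r; ring.
Qed.

Lemma continuous_phi : continuous phi.
Proof.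
move=> x; apply: differentiable_continuous; apply/derivable1_diffP.
by have [] := is_derive_phi x.
Qed.

Lemma measurable_phi : measurable_fun setT phi.
Proof. by apply: continuous_measurable_fun; exact: continuous_phi. Qed.

Lemma cvg_phi : phi x @[x --> +oo] --> 0.
Proof.
rewrite -[X in _ --> X](mulr0 (Num.sqrt (2 * pi))^-1); apply: cvgMr.
have -> : (fun x => expR (- (x ^+ 2 / 2))) = @gauss_fun R \o (fun x => x * (Num.sqrt 2)^-1).
  by apply/funext => x; rewrite /= /gauss_fun exprMn exprVn sqr_sqrtr.
apply: cvg_comp (@cvg_gauss_fun R); apply: gt0_cvgMly; last exact: cvg_id.
by rewrite invr_gt0 sqrtr_gt0.
Qed.

(** Mills' inequality: on the domain of integration [phi x <= (x / eta) * phi x], and [x * phi x] has primitive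
    [- phi x]. *)
Lemma mills eta : 0 < eta ->
  (\int[mu]_(x in `[eta, +oo[) (phi x)%:E <= (phi eta / eta)%:E)%E.
Proof.
move=> eta0; apply: (@le_trans _ _ (\int[mu]_(x in `[eta, +oo[) (eta^-1%:E * (x * phi x)%:E))%E).
  apply: ge0_le_integral => //.
  - by move=> x _; rewrite lee_fin phi_ge0.
  - by apply/measurable_EFinP; apply: measurable_funTS; exact: measurable_phi.
  - apply/measurable_EFinP; apply: measurable_funTS; apply: measurable_funM => //.
    by apply: measurable_funM => //; exact: measurable_phi.
  - move=> x /=; rewrite in_itv/= andbT => ex; rewrite -EFinM lee_fin mulrA.
    by rewrite -[X in X <= _]mul1r ler_wpM2r ?phi_ge0// mulrC ler_pdivlMr// mul1r.
rewrite ge0_integralZl//; last 3 first.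
- apply/measurable_EFinP; apply: measurable_funTS; apply: measurable_funM => //.
  exact: measurable_phi.
- move=> x /=; rewrite in_itv/= andbT => ex; rewrite lee_fin mulr_ge0 ?phi_ge0//.
  exact: le_trans (ltW eta0) ex.
- by rewrite lee_fin invr_ge0 ltW.
rewrite (@ge0_continuous_FTC2y R (fun x => x * phi x) (fun x => - phi x) eta 0).
- by rewrite -EFinB sub0r opprK -EFinM mulrC.
- by move=> x ex; rewrite mulr_ge0 ?phi_ge0// (le_trans (ltW eta0)).
- apply: continuous_subspaceT => x; apply: cvgM; [exact: cvg_id|exact: continuous_phi].
- by rewrite -oppr0; apply: cvgN; exact: cvg_phi.
- by move=> x _; apply: derivableN; have [] := is_derive_phi x.
- by apply: cvgN; apply: cvg_at_right_filter; exact: continuous_phi.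
- move=> x _; rewrite derive1E deriveN; last by have [] := is_derive_phi x.
  by have [_ ->] := is_derive_phi x; rewrite opprK.
Qed.

Lemma mills_left eta : 0 < eta ->
  (\int[mu]_(x in `]-oo, (- eta)%R]) (phi x)%:E <= (phi eta / eta)%:E)%E.
Proof.
move=> eta0; rewrite ge0_integration_by_substitutionNy.
- apply: le_trans (mills eta0); rewrite le_eqVlt; apply/orP; left; apply/eqP.
  by apply: eq_integral => x _; rewrite /= phiN.
- by apply: continuous_subspaceT => x; exact: continuous_phi.
- by move=> x _; exact: phi_ge0.
Qed.

Lemma integral_phi_shift m b :
  (\int[mu]_(x in `]-oo, b]) (phi (x - m))%:E = \int[mu]_(x in `]-oo, (b - m)%R]) (phi x)%:E)%E.
Proof.
pose Fn (x : R) : R := x - m.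
have dF x : is_derive x 1 Fn 1.
  by apply: is_derive_eq1 (is_deriveB1 (is_derive_id1 x) (is_derive_cst1 m x)) _; rewrite subr0.
have F'E : (Fn^`() = cst 1)%classic by apply/funext => x; rewrite derive1E; case: (dF x).
have cF : continuous Fn by move=> x; apply: cvgB; [exact: cvg_id|exact: cvg_cst].
rewrite -[(b - m)%R]/(Fn b) (@increasing_ge0_integration_by_substitutionNy R Fn phi b).
- by apply: eq_integral => x _; rewrite F'E !fctE mulr1.
- by move=> x y _ _ xy; rewrite /Fn ltrD2r.
- by rewrite F'E => x _; exact: cvg_cst.
- by rewrite F'E; exact: is_cvg_cst.
- by rewrite F'E; exact: cvg_cst.
- split; first by move=> x _; case: (dF x).
  by apply: cvg_at_left_filter; exact: cF.
- exact: cvg_addrr_Ny.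
- by apply: continuous_subspaceT => x; exact: continuous_phi.
- by move=> x _; exact: phi_ge0.
Qed.

Lemma integral_phi_window a b M : a <= b -> (forall x, a <= x <= b -> phi x <= M) ->
  (\int[mu]_(x in `]a, b]) (phi x)%:E <= (M * (b - a))%:E)%E.
Proof.
move=> ab hM; apply: (@le_trans _ _ (\int[mu]_(x in `]a, b]) (M%:E))%E).
  apply: ge0_le_integral => //.
  - by move=> x _; rewrite lee_fin phi_ge0.
  - by apply/measurable_EFinP; apply: measurable_funTS; exact: measurable_phi.
  - move=> x /=; rewrite in_itv/= => /andP[ax xb]; rewrite lee_fin hM//.
    by rewrite xb ltW.
have mab : mu `]a, b]%classic = (b - a)%:E.
  rewrite lebesgue_measure_itv/= lte_fin; case: ltP => [//|ba].
  by rewrite (@le_anti _ _ a b) ?ab// subrr.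
by rewrite integral_cst// [X in (_ * X)%E]mab.
Qed.

Local Notation N01 := (normal_prob (0 : R) (1 : R)).

(** The likelihood ratio of the normal law of mean [c] and variance [1] to the standard one. *)
Definition tilt c x : R := expR (c * x - c ^+ 2 / 2).

Lemma measurable_tilt c : measurable_fun setT (tilt c).
Proof.
apply: (measurableT_comp (@measurable_expR R)).
by apply: measurable_funB => //; exact: measurable_funM.
Qed.

Lemma tilt_phi c x : tilt c x * phi x = phi (x - c).
Proof. by rewrite /tilt /phi mulrCA -expRD; congr (_ * expR _); field. Qed.

Lemma tilt_left c b : (\int[N01]_(x in `]-oo, b]) (tilt c x)%:E =
  \int[mu]_(x in `]-oo, (b - c)%R]) (phi x)%:E)%E.
Proof.
have mb : measurable (`]-oo, b]%classic : set (measurableTypeR R)) by exact: measurable_itv.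
rewrite -integral_phi_shift integral_mkcond ge0_integral_normal; last 2 first.
- apply/(measurable_restrictT _ mb).
  by apply: measurable_funTS; apply: measurableT_comp (measurable_tilt c).
- by move=> x; apply: erestrict_ge0 => y _; rewrite lee_fin expR_ge0.
rewrite [RHS]integral_mkcond; apply: eq_integral => x _.
rewrite !patchE; case: ifPn => _; last by rewrite mul0e.
by rewrite -EFinM normal_pdf01E tilt_phi.
Qed.

Lemma normal01_tail eta : 0 < eta -> (N01 [set x | (eta < x)%R] <= (phi eta / eta)%:E)%E.
Proof.
move=> eta0; apply: le_trans (mills eta0); rewrite /normal_prob.
under eq_integral do rewrite normal_pdf01E.
apply: ge0_subset_integral => //=.
- by rewrite -[X in measurable X]set_itvoy; exact: measurable_itv.
- by apply/measurable_EFinP; apply: measurable_funTS; exact: measurable_phi.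
- by move=> x _; rewrite lee_fin phi_ge0.
- by move=> x /= /ltW; rewrite in_itv/= andbT.
Qed.

Lemma tilt_le eta rho x : 0 < eta -> 0 <= rho <= 1 -> x <= eta ->
  tilt (2 * eta) x <= tilt (2 * eta * rho) x.
Proof.
move=> eta0 /andP[rho0 rho1] xe; rewrite /tilt ler_expR.
have h1 : 0 <= eta * (1 - rho) by rewrite mulr_ge0 ?subr_ge0// ltW.
have h2 : 0 <= eta * (1 + rho) - x by nra.
by have := mulr_ge0 h1 h2; nra.
Qed.

(** Both tilts integrate to left tails of the standard normal law, which differ by its mass between [- eta] and
    [eta - 2 * eta * rho]; there the density is at most its value at the inner end point. *)
Lemma tilt_increment eta rho : 0 < eta -> 1 / 2 <= rho -> rho <= 1 ->
  (\int[N01]_(x in `]-oo, eta]) (tilt (2 * eta * rho) x - tilt (2 * eta) x)%:E <=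
   (phi (eta * (2 * rho - 1)) * (2 * eta * (1 - rho)))%:E)%E.
Proof.
move=> eta0 rho2 rho1; pose J := `]-oo, eta]%classic; pose K := `]-oo, (- eta)%R]%classic.
pose W := `]- eta, eta - 2 * eta * rho]%classic.
have mJ : measurable (J : set (measurableTypeR R)) by exact: measurable_itv.
have ineq : - eta <= eta - 2 * eta * rho by nra.
have dge0 x : J x -> tilt (2 * eta) x <= tilt (2 * eta * rho) x.
  by rewrite /J/= in_itv/=; apply: tilt_le => //; lra.
have split1 : (\int[N01]_(x in J) (tilt (2 * eta * rho) x)%:E =
   \int[N01]_(x in J) (tilt (2 * eta) x)%:E +
   \int[N01]_(x in J) (tilt (2 * eta * rho) x - tilt (2 * eta) x)%:E)%E.
  rewrite -ge0_integralD//.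
  - by apply: eq_integral => x _; rewrite -EFinD; congr _%:E; ring.
  - by move=> x _; rewrite lee_fin expR_ge0.
  - by apply/measurable_EFinP; apply: measurable_funTS; exact: measurable_tilt.
  - by move=> x Jx; rewrite lee_fin subr_ge0 dge0.
  - by apply/measurable_EFinP; apply: measurable_funTS; apply: measurable_funB; exact: measurable_tilt.
have split2 : (\int[mu]_(x in `]-oo, (eta - 2 * eta * rho)%R]) (phi x)%:E =
   \int[mu]_(x in K) (phi x)%:E +
   \int[mu]_(x in W) (phi x)%:E)%E.
  rewrite -ge0_integral_setU//=.
  - by rewrite /K /W -itv_bndbnd_setU// bnd_simp.
  - exact: measurable_itv.
  - exact: measurable_itv.
  - by apply/measurable_EFinP; apply: measurable_funTS; exact: measurable_phi.
  - by move=> x _; rewrite lee_fin phi_ge0.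
  - apply/disj_set2P; rewrite -subset0 => x []; rewrite /K /W /= !in_itv/= => xe /andP[ex _].
    by move: (lt_le_trans ex xe); rewrite ltxx.
have Kfin : (\int[mu]_(x in K) (phi x)%:E)%E \is a fin_num.
  rewrite ge0_fin_numE; first exact: le_lt_trans (mills_left eta0) (ltry _).
  by apply: integral_ge0 => x _; rewrite lee_fin phi_ge0.
move: split1; rewrite !tilt_left split2.
rewrite (_ : (eta - 2 * eta)%R = - eta); last by ring.
move=> /(congr1 (fun z => (z - \int[mu]_(x in K) (phi x)%:E)%E)).
rewrite ![((\int[mu]_(x in K) _) + _)%E]addeC !addeK// => <-.
rewrite (_ : 2 * eta * (1 - rho) = (eta - 2 * eta * rho) - - eta); last by ring.
apply: integral_phi_window => //.
move=> x /andP[ex xe]; apply: le_phi.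
rewrite [X in X <= _]ger0_norm; last by nra.
rewrite ler_normr; apply/orP; right; lra.
Qed.

End gaussian_tails.

(** * The crossing probability of the chain *)

Section restricted_integrals.
Context {R : realType}.

Lemma eq_measure_rays (m1 m2 : {measure set (measurableTypeR R) -> \bar R}) :
  (forall r : R, m1 `]-oo, r]%classic = m2 `]-oo, r]%classic) ->
  (forall r : R, m1 `]-oo, r]%classic < +oo)%E ->
  forall A, measurable A -> m1 A = m2 A.
Proof.
move=> e fin A mA; pose G : set (set R) := [set B | exists r : R, B = `]-oo, r]%classic].
have GA : <<s G >> A.
  have := mA; rewrite -[measurable]/((@ocitv R).-sigma.-measurable) RGenOInfty.measurableE.
  apply: smallest_sub; first exact: smallest_sigma_algebra.
  move=> _ [r ->]; rewrite -setCitvl; apply: sigma_algebraC.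
  by apply: sub_sigma_algebra; exists r.
have mG : G `<=` measurable by move=> _ [r ->]; exact: measurable_itv.
have gG k : G `]-oo, (k%:R : R)]%classic by exists k%:R.
apply: (@g_sigma_algebra_measure_unique _ R (measurableTypeR R) G mG _ gG _ m1 m2 _ _ _ A GA).
- apply/seteqP; split => // x _; exists (Num.truncn x).+1 => //=.
  by rewrite in_itv/= ltW// truncnS_gt.
- move=> _ _ [r ->] [s ->]; exists (Num.min r s).
  by apply/seteqP; split => x /=; rewrite !in_itv/= le_min; [case=> -> ->|move/andP].
- by move=> _ [r ->]; exact: e.
- by move=> k; exact: fin.
Qed.

Local Notation image_measure :=
  measure_function_pushforward__canonical__measure_function_Measure.

(** A finite measure on the line is determined by rays; [Z1] and [Z2] may live on different spaces. *)
Lemma eq_integral_rays d1 d2 (T1 : measurableType d1) (T2 : measurableType d2)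
    (mu1 : {measure set T1 -> \bar R}) (mu2 : {measure set T2 -> \bar R})
    (Z1 : T1 -> measurableTypeR R) (Z2 : T2 -> measurableTypeR R) (f : measurableTypeR R -> \bar R) :
  measurable_fun setT Z1 -> measurable_fun setT Z2 -> (mu1 setT < +oo)%E ->
  (forall r : R, mu1 [set w | Z1 w <= r] = mu2 [set w | Z2 w <= r]) ->
  measurable_fun setT f -> (forall x, (0 <= f x)%E) ->
  (\int[mu1]_w f (Z1 w) = \int[mu2]_w f (Z2 w))%E.
Proof.
move=> mZ1 mZ2 fin e mf f0.
rewrite -(ge0_integral_pushforward mZ1 mu1 (D := setT))//.
rewrite -(ge0_integral_pushforward mZ2 mu2 (D := setT))//.
have rayE d (T : measurableType d) (Z : T -> R) (r : R) :
    Z @^-1` `]-oo, r]%classic = [set w | Z w <= r].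
  by apply/seteqP; split => w /=; rewrite in_itv.
apply: eq_measure_integral => C mC _.
apply: (@eq_measure_rays (image_measure mu1 mZ1) (image_measure mu2 mZ2)) mC => r.
  by rewrite /= /pushforward !rayE.
rewrite /= /pushforward; apply: le_lt_trans fin; apply: le_measure => //.
- by rewrite inE -[X in measurable X]setTI; apply: mZ1 => //; exact: measurable_itv.
- by rewrite inE.
Qed.

Context d (T : measurableType d) (mu : {measure set T -> \bar R}).

Lemma ge0_integral_mrestr (A : set T) (mA : measurable A) (f : T -> \bar R) :
  measurable_fun setT f -> (forall x, (0 <= f x)%E) ->
  (\int[mrestr mu mA]_x f x = \int[mu]_(x in A) f x)%E.
Proof.
move=> mf f0.
have mAC : measurable (~` A) by exact: measurableC.
rewrite (@ge0_negligible_integral _ _ _ (mrestr mu mA) setT (~` A))//.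
- rewrite setTD setCK; apply: eq_measure_integral => B mB BA.
  by rewrite /= /mrestr setIidl.
- by rewrite /= /mrestr setICl measure0.
Qed.

End restricted_integrals.

Section chain_bound.
Context {R : realType} d (T : measurableType d) (P : probability T R).
Local Notation N01 := (normal_prob (0 : R) (1 : R)).
Variables (X : nat -> T -> R) (rho : R).
Hypotheses (mX : forall i, measurable_fun setT (X i)) (rho01 : 0 <= rho <= 1).
Let r (i j : nat) : R := rho ^+ `|i - j|%N.
Hypothesis lawX : forall n (c : nat -> R) (f : R -> \bar R), measurable_fun setT f ->
  (forall x, (0 <= f x)%E) ->
  (\int[P]_w f (\sum_(i < n) c i * X i w)%R =
   gint 0 (Num.sqrt (qform r n c)) f)%E.
Variable eta : R.

Let A k := [set w | forall i, (i <= k)%N -> X i w <= eta].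

Let mA k : measurable (A k).
Proof.
have -> : A k = \bigcap_(i in [set i | (i <= k)%N]) [set w | X i w <= eta].
  by apply/seteqP; split => w /= h i; exact: h.
apply: bigcap_measurableType => i _.
by rewrite -[X in measurable X]setTI; apply: measurable_fun_le.
Qed.

(* On the event that the chain stays below [eta] up to time [k], the next variable may be replaced by its
   autoregression, integrated over the innovation. *)
Let innovation_law k (f : R -> \bar R) :
  measurable_fun setT f -> (forall x, (0 <= f x)%E) ->
  (\int[P]_(w in A k) f (X k.+1 w) =
   \int[P]_(w in A k) \int[N01]_y f (rho * X k w + Num.sqrt (1 - rho ^+ 2) * y)%R)%E.
Proof.
move=> mf f0; set s := Num.sqrt _.
pose TR := (T * measurableTypeR R)%type.
pose Z (w : TR) : R := rho * X k w.1 + s * w.2.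
have mZ : measurable_fun setT Z.
  have m1 : measurable_fun setT (fun w : TR => X k w.1).
    exact: (measurableT_comp (mX k) measurable_fst).
  have m2 : measurable_fun setT (fun w : TR => w.2) by exact: measurable_snd.
  exact: measurable_funD (measurable_funM (measurable_cst _) m1) (measurable_funM (measurable_cst _) m2).
have mB : measurable (A k `*` [set: measurableTypeR R]) by exact: measurableX.
rewrite -(ge0_integral_mrestr P (mA k)) => [|//|]; last 2 first.
- exact: (measurableT_comp mf (mX k.+1)).
- by [].
rewrite (@eq_integral_rays _ _ _ _ _ (mrestr P (mA k)) (mrestr (P \x N01)%E mB) (X k.+1) Z)//; last 3 first.
- exact: mX.
- by rewrite /= /mrestr setTI; apply: le_lt_trans (probability_le1 _ _) _ => //; rewrite ltry.
- move=> b; rewrite /= /mrestr.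
  have := innovation_rays mX rho01 lawX k (fun i => if (i <= k)%N then eta else b).
  rewrite (_ : [set w | _] = [set w | X k.+1 w <= b] `&` A k); last first.
    apply/seteqP; split => w /=.
      move=> h; split; first by have := h k.+1 (ltnSn _); rewrite ltnn.
      by move=> i ik; have := h i (leqW ik); rewrite ik.
    move=> [h1 h2] i; rewrite ltnS leq_eqVlt ltnS => /predU1P[->|ik]; first by rewrite ltnn.
    by rewrite ik; exact: h2.
  move=> ->; congr (_ _); apply/seteqP; split => w /=.
    move=> h; split; first by have := h k.+1 (ltnSn _); rewrite ltnn.
    by split => // i ik; have := h i (leqW ik); rewrite ik.
  move=> [h1 [h2 _]] i; rewrite ltnS leq_eqVlt ltnS => /predU1P[->|ik]; first by rewrite ltnn.
  by rewrite ik; exact: h2.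
rewrite ge0_integral_mrestr//; last exact: measurableT_comp mf mZ.
rewrite integral_mkcond fubini_tonelli1; last 2 first.
- by apply/(measurable_restrictT _ mB); apply: measurable_funTS; exact: (measurableT_comp mf mZ).
- by move=> w; apply: erestrict_ge0.
rewrite [RHS]integral_mkcond; apply: eq_integral => w _.
rewrite /fubini_F /= patchE; case: ifPn => [wA|wA].
  apply: eq_integral => y _; rewrite patchE ifT//.
  by move: wA; rewrite !inE.
rewrite -[RHS](integral0 N01 setT); apply: eq_integral => y _; rewrite patchE ifF//.
by apply/negbTE; move: wA; apply: contra; rewrite !inE => -[].
Qed.

Let tilt_innovation k c :
  (\int[P]_(w in A k) (tilt c (X k.+1 w))%:E = \int[P]_(w in A k) (tilt (c * rho) (X k w))%:E)%E.
Proof.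
have mV : measurable_fun setT (fun x : R => (tilt c x)%:E).
  by apply/measurable_EFinP; exact: measurable_tilt.
rewrite (innovation_law k mV) => [|x]; last by rewrite lee_fin expR_ge0.
apply: eq_integral => w _; set s := Num.sqrt _.
have ss : s ^+ 2 = 1 - rho ^+ 2.
  by have /andP[? ?] := rho01; rewrite sqr_sqrtr// subr_ge0 exprn_ile1.
have e y : tilt c (rho * X k w + s * y) =
    expR (c * rho * X k w - c ^+ 2 / 2) * expR ((c * s) * y).
  by rewrite -expRD; congr expR; ring.
under eq_integral do rewrite e EFinM.
rewrite ge0_integralZl//; last first.
  apply/measurable_EFinP; apply: (measurableT_comp (@measurable_expR R)).
  exact: measurable_funM.
rewrite integral_exp_normal// -EFinM -expRD; congr (expR _)%:E.
by rewrite !exprMn ss; field.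
Qed.

Let law1 k (f : R -> \bar R) : measurable_fun setT f -> (forall x, (0 <= f x)%E) ->
  (\int[P]_w f (X k w) = \int[N01]_x f x)%E.
Proof.
move=> mf f0.
have e w : X k w = \sum_(i < k.+1) (i == k :> nat)%:R * X i w.
  rewrite big_ord_recr/= eqxx mul1r big1 ?add0r// => i _.
  by rewrite ltn_eqF ?mul0r.
under eq_integral do rewrite e.
rewrite (lawX k.+1 (fun i => (i == k)%:R) mf f0) /qform.
rewrite (_ : \sum_(i < k.+1) _ = 1) ?sqrtr1 /gint ?oner_eq0//.
rewrite big_ord_recr/= big1 ?add0r; last first.
  by move=> i _; rewrite big1// => j _; rewrite (ltn_eqF (ltn_ord i)) !mul0r.
rewrite big_ord_recr/= eqxx big1 ?add0r; first by rewrite /r distnn expr0 !mulr1.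
by move=> i _; rewrite (ltn_eqF (ltn_ord i)) mulr0 mul0r.
Qed.

Hypotheses (eta0 : 0 < eta) (rho2 : 1 / 2 <= rho).
Let rho1 : rho <= 1. Proof. by have /andP[] := rho01. Qed.
Let J : set R := `]-oo, eta]%classic.
Let mJ : measurable (J : set (measurableTypeR R)). Proof. exact: measurable_itv. Qed.

Let mX_gt k : measurable [set w | eta < X k w].
Proof.
rewrite (_ : [set _ | _] = ~` [set w | X k w <= eta]).
  by apply: measurableC; rewrite -[X in measurable X]setTI; apply: measurable_fun_le.
by apply/seteqP; split => w /=; rewrite ltNge => /negP.
Qed.

Let law1_left k (g : R -> R) : measurable_fun setT g -> (forall x, J x -> 0 <= g x) ->
  (\int[P]_(w in [set w | (X k w <= eta)%R]) (g (X k w))%:E = \int[N01]_(x in J) (g x)%:E)%E.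
Proof.
move=> mg g0; pose f : R -> \bar R := (fun x => (g x)%:E) \_ J.
have f0 x : (0 <= f x)%E by apply: erestrict_ge0 => y Jy; rewrite lee_fin g0.
have mf : measurable_fun setT f.
  apply/(measurable_restrictT _ mJ); apply: measurable_funTS.
  by apply: measurableT_comp mg.
rewrite [RHS]integral_mkcond -/f -(law1 k mf f0) integral_mkcond.
apply: eq_integral => w _; rewrite /f !patchE.
by congr (if _ then _ else _); apply/idP/idP; rewrite !inE /J/= in_itv.
Qed.

(* The tilt is [1] at [eta] and larger beyond, so that a crossing at time [k.+1] costs at most what the second term
   loses there. *)
Let score k := (P (~` A k) + \int[P]_(w in A k) (tilt (2 * eta) (X k w))%:E)%E.
Let delta : R := phi (eta * (2 * rho - 1)) * (2 * eta * (1 - rho)).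

Let mtilt_X k c (D : set T) : measurable_fun D (fun w => (tilt c (X k w))%:E).
Proof.
apply: measurable_funTS; apply/measurable_EFinP.
exact: (measurableT_comp (measurable_tilt c) (mX k)).
Qed.

Let score0 : (score 0 <= (2 * (phi eta / eta))%:E)%E.
Proof.
have A0 : A 0 = [set w | X 0 w <= eta].
  by apply/seteqP; split => w /= h; [exact: h|case=> // _].
rewrite /score A0 (_ : 2 * (phi eta / eta) = phi eta / eta + phi eta / eta); last by ring.
rewrite EFinD; apply: leeD.
  rewrite (_ : ~` _ = [set w | eta < X 0 w]); last first.
    by apply/seteqP; split => w /=; rewrite ltNge => /negP.
  apply: le_trans (normal01_tail eta0).
  pose S : set R := [set x : R | eta < x].
  have mS : measurable (S : set (measurableTypeR R)) by rewrite /S -set_itvoy; exact: measurable_itv.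
  have m1 : measurable_fun setT (fun x : R => (\1_S x : R)%:E).
    by apply/measurable_EFinP; exact: measurable_indic mS.
  have p1 (x : R) : (0 <= (\1_S x : R)%:E)%E by rewrite lee_fin.
  have := @law1 0 _ m1 p1; rewrite integral_indic//; last exact: mX_gt.
  have e0 : (fun w => S (X 0 w)) `&` setT = [set w | (eta < X 0 w)%R] by rewrite setIT.
  by rewrite e0 => ->; rewrite integral_indic// setIT.
rewrite (law1_left 0 (measurable_tilt _)) => [|x _]; last exact: expR_ge0.
rewrite tilt_left (_ : eta - 2 * eta = - eta); last by ring.
exact: mills_left.
Qed.

Let scoreS k : (score k.+1 <= score k + delta%:E)%E.
Proof.
pose G := A k `&` [set w | eta < X k.+1 w].
have mG : measurable G by exact: measurableI.
have AS : A k = A k.+1 `|` G.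
  apply/seteqP; split => w.
    move=> h; have [le|lt] := leP (X k.+1 w) eta; [left|by right].
    by move=> i; rewrite leq_eqVlt ltnS => /predU1P[->//|]; exact: h.
  by case=> [h i ik|[]//]; apply: h; exact: leqW.
have disj : [disjoint A k.+1 & G].
  apply/disj_set2P; rewrite -subset0 => w [h [_ /=]].
  by rewrite ltNge (h k.+1 (leqnn _)).
have t0 c x : (0 <= (tilt c x)%:E)%E by rewrite lee_fin expR_ge0.
have splitA : (\int[P]_(w in A k) (tilt (2 * eta) (X k.+1 w))%:E =
    \int[P]_(w in A k.+1) (tilt (2 * eta) (X k.+1 w))%:E +
    \int[P]_(w in G) (tilt (2 * eta) (X k.+1 w))%:E)%E.
  by rewrite [in LHS]AS ge0_integral_setU.
have PG : (P G <= \int[P]_(w in G) (tilt (2 * eta) (X k.+1 w))%:E)%E.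
  rewrite -[leLHS]mul1e -integral_cst//; apply: ge0_le_integral => //.
  move=> w [_ /= wG]; rewrite lee_fin /tilt -[leLHS]expR0 ler_expR; set x : R := X k.+1 w in wG *.
  rewrite (_ : 2 * eta * x - _ = 2 * eta * (x - eta)); last by field.
  by rewrite mulr_ge0 ?subr_ge0 ?mulr_ge0// ltW.
have PA : (P (~` A k.+1) <= P (~` A k) + P G)%E.
  rewrite (_ : ~` A k.+1 = ~` A k `|` G); last first.
    apply/seteqP; split => w /=.
      move=> nA; have [Ak|] := pselect (A k w); last by left.
      by right; move: Ak; rewrite AS => -[/nA|].
    case=> [nA Ak|wG Ak]; first by apply: nA; rewrite AS; left.
    by have : (A k.+1 `&` G) w by []; move/disj_set2P : disj => ->.
  by apply: measureU2 => //; exact: measurableC.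
have incr : (\int[P]_(w in A k) (tilt (2 * eta * rho) (X k w))%:E <=
    \int[P]_(w in A k) (tilt (2 * eta) (X k w))%:E + delta%:E)%E.
  pose D x : R := tilt (2 * eta * rho) x - tilt (2 * eta) x.
  have mD : measurable_fun setT D by apply: measurable_funB; exact: measurable_tilt.
  have mDX S : measurable_fun S (fun w => (D (X k w))%:E).
    by apply: measurable_funTS; apply/measurable_EFinP; exact: (measurableT_comp mD (mX k)).
  have D0 x : x <= eta -> (0 <= (D x)%:E)%E.
    by move=> xe; rewrite lee_fin subr_ge0 tilt_le.
  have D0A w : A k w -> (0 <= (D (X k w))%:E)%E by move=> h; apply: D0; exact: h.
  rewrite (_ : (\int[P]_(w in A k) (tilt (2 * eta * rho) (X k w))%:E =
    \int[P]_(w in A k) ((tilt (2 * eta) (X k w))%:E + (D (X k w))%:E))%E); last first.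
    by apply: eq_integral => w _; rewrite -EFinD /D; congr _%:E; ring.
  rewrite ge0_integralD//; apply: leeD2l.
  apply: (@le_trans _ _ (\int[P]_(w in [set w | (X k w <= eta)%R]) (D (X k w))%:E)%E).
    apply: ge0_subset_integral => //.
    - by rewrite -[X in measurable X]setTI; apply: measurable_fun_le.
    - by move=> w /D0.
    - by move=> w; apply.
  rewrite (law1_left k mD) => [|x]; last by rewrite /J/= in_itv/= => /D0; rewrite lee_fin.
  exact: tilt_increment.
rewrite /score; apply: (@le_trans _ _ (P (~` A k) + P G +
    \int[P]_(w in A k.+1) (tilt (2 * eta) (X k.+1 w))%:E)%E); first exact: leeD2r.
rewrite -[leLHS]addeA -[leRHS]addeA; apply: leeD2l.
apply: (le_trans _ incr); rewrite -tilt_innovation splitA addeC.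
exact: leeD2l.
Qed.

(** [score] dominates the crossing probability and grows by at most [delta] at each step: [tilt_innovation] turns
    the tilt by [2 * eta] of the next variable into the tilt by [2 * eta * rho] of the present one, and the difference
    of the two tilts is nonnegative below [eta] ([tilt_le]), so that restricting to [A k] can be forgotten. *)
Lemma chain_bound m :
  (P (~` A m) <= (2 * (phi eta / eta) + m%:R * delta)%:E)%E.
Proof.
suff: (score m <= (2 * (phi eta / eta) + m%:R * delta)%:E)%E.
  by apply: le_trans; rewrite leeDl// integral_ge0// => w _; rewrite lee_fin expR_ge0.
elim: m => [|m ih]; first by rewrite mul0r addr0.
apply: le_trans (scoreS m) _.
rewrite (_ : 2 * (phi eta / eta) + m.+1%:R * delta = (2 * (phi eta / eta) + m%:R * delta) + delta).
  by rewrite EFinD; exact: leeD2r.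
by rewrite -[m.+1]addn1 natrD; ring.
Qed.

End chain_bound.

(** * The normalised bridge in log-odds time *)

Section bridge_in_log_odds.
Context {R : realType}.
Implicit Types (s t : R).

Definition logistic s : R := expR s / (1 + expR s).
(** The inverse of [sqrt (t * (1 - t))] at [t = logistic s], see [inv_sdE]. *)
Definition inv_sd s : R := expR (s / 2) + expR (- (s / 2)).

Let den_gt0 s : 0 < 1 + expR s.
Proof. by rewrite ltr_pwDl// expR_ge0. Qed.

Lemma logistic01 s : 0 < logistic s < 1.
Proof.
by rewrite divr_gt0 ?expR_gt0//= ltr_pdivrMr// mul1r ltrDr.
Qed.

Lemma logistic_le s t : s <= t -> logistic s <= logistic t.
Proof.
move=> st; rewrite ler_pdivrMr// mulrAC ler_pdivlMr//.
by have := st; rewrite -ler_expR => h; lra.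
Qed.

Lemma logistic_logit t : 0 < t -> t < 1 -> logistic (ln (t / (1 - t))) = t.
Proof.
move=> t0 t1; have t1' : 0 < 1 - t by rewrite subr_gt0.
rewrite /logistic lnK ?posrE ?divr_gt0//; field.
by rewrite gt_eqF//= (_ : 1 - t + t = 1) ?oner_eq0//; ring.
Qed.

Lemma expR_half s : expR (s / 2) ^+ 2 = expR s.
Proof. by rewrite expr2 -expRD; congr expR; field. Qed.

Lemma inv_sdE s : inv_sd s = (Num.sqrt (logistic s * (1 - logistic s)))^-1.
Proof.
have i0 : 0 < inv_sd s by rewrite addr_gt0 ?expR_gt0.
have e0 := expR_gt0 (s / 2).
rewrite -[LHS]gtr0_norm// -sqrtr_sqr -sqrtrV.
  congr Num.sqrt; rewrite /inv_sd /logistic expRN -(expR_half s).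
  set e : R := expR (s / 2) in e0 *; field.
  rewrite (gt_eqF e0) addrK oner_eq0 !andbT.
  by rewrite gt_eqF// ltr_pwDl// sqr_ge0.
by rewrite ltW// mulr_gt0 ?subr_gt0; case/andP: (logistic01 s).
Qed.

Lemma bridge_cov_log_odds s t : s <= t ->
  inv_sd s * inv_sd t * (logistic s - logistic s * logistic t) = expR ((s - t) / 2).
Proof.
move=> st; rewrite mulrBl expRD expRN /inv_sd /logistic !expRN -(expR_half s) -(expR_half t).
have := expR_gt0 (s / 2); have := expR_gt0 (t / 2).
set e : R := expR (s / 2); set f : R := expR (t / 2) => f0 e0; field.
rewrite (gt_eqF e0) (gt_eqF f0)/=.
have h (x : R) : 1 + x ^+ 2 != 0 by rewrite gt_eqF// ltr_pwDl// sqr_ge0.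
by rewrite !h.
Qed.

Lemma continuous_logistic : continuous logistic.
Proof.
move=> s; apply: cvgM; first exact: continuous_expR.
apply: cvgV; first by rewrite gt_eqF.
by apply: cvgD; [exact: cvg_cst|exact: continuous_expR].
Qed.

Lemma continuous_inv_sd : continuous inv_sd.
Proof.
move=> s; apply: cvgD.
  apply: (@continuous_comp _ _ _ (fun y : R => y / 2) expR); last exact: continuous_expR.
  by apply: cvgM; [exact: cvg_id|exact: cvg_cst].
apply: (@continuous_comp _ _ _ (fun y : R => - (y / 2)) expR); last exact: continuous_expR.
by apply: cvgN; apply: cvgM; [exact: cvg_id|exact: cvg_cst].
Qed.

Context d (T : measurableType d) (P : probability T R).
Variable B : R -> {RV P >-> R}.
Hypothesis bridge : brownian_bridge B.

Definition std_bridge s (w : T) : R := B (logistic s) w * inv_sd s.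

Lemma measurable_std_bridge s : measurable_fun setT (std_bridge s).
Proof. by apply: measurable_funM. Qed.

Let logistic_itv s : 0 <= logistic s <= 1.
Proof. by have /andP[? ?] := logistic01 s; rewrite !ltW. Qed.

Let gaussian_bridge s c : gaussian P (fun w => c * B (logistic s) w).
Proof.
have [gp _ _ _] := bridge.
have := gp 1 (fun=> logistic s) (fun=> c) (fun=> logistic_itv s).
by under [X in gaussian _ X]funext do rewrite big_ord1.
Qed.

Let gB s : gaussian P (B (logistic s)).
Proof.
have := gaussian_bridge s 1.
by under [X in gaussian _ X]funext do rewrite mul1r.
Qed.

Let bridge_mean s : (\int[P]_w (B (logistic s) w)%:E = 0)%E.
Proof. by have [_ m _ _] := bridge; rewrite -expectation_def m. Qed.

Let bridge_product s t : s <= t ->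
  (\int[P]_w (B (logistic s) w * B (logistic t) w)%:E =
   (logistic s - logistic s * logistic t)%:E)%E.
Proof.
have [_ m c _] := bridge => st; have := c _ _ (logistic_itv s) (logistic_itv t).
rewrite (min_idPl (logistic_le st)) => <-.
rewrite covariance.unlock !m// expectation.unlock/=.
by apply: eq_integral => w _; rewrite /= !fctE/= !subr0.
Qed.

Lemma continuous_std_bridge w : continuous (std_bridge ^~ w).
Proof.
have [_ _ _ cB] := bridge => s; apply: cvgM; last exact: continuous_inv_sd.
apply: (@continuous_comp _ _ _ logistic (fun t => B t w)); first exact: continuous_logistic.
have /continuous_within_itvP[//|+ _ _] := cB w.
by apply; rewrite in_itv/=; exact: logistic01.
Qed.

(** On a grid of step [h] in log-odds time, the normalised bridge satisfies the hypothesis of [chain_bound] with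
    correlation [exp (- h / 2)]. *)
Lemma std_bridge_chain (s h : R) : 0 <= h ->
  let r (i j : nat) : R := expR (- (h / 2)) ^+ `|i - j|%N in
  forall n (c : nat -> R) (f : R -> \bar R), measurable_fun setT f ->
  (forall x, (0 <= f x)%E) ->
  (\int[P]_w f (\sum_(i < n) c i * std_bridge (s + i%:R * h) w)%R =
   gint 0 (Num.sqrt (qform r n c)) f)%E.
Proof.
move=> h0 r n c f mf f0; pose u (i : nat) : R := s + i%:R * h.
pose Y (i : 'I_n) w := c i * inv_sd (u i) * B (logistic (u i)) w.
have e w : \sum_(i < n) c i * std_bridge (s + i%:R * h) w = \sum_(i < n) Y i w.
  by apply: eq_bigr => i _; rewrite /Y /std_bridge -/(u i); ring.
under eq_integral do rewrite e.
apply: (gaussian_sum_integral (C := fun i j => c i * c j * r i j)) => //.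
- by move=> i; exact: measurable_funM.
- by move=> i; exact: gaussian_bridge.
- have [gp _ _ _] := bridge.
  exact: gp n (fun i => logistic (u i)) (fun i => c i * inv_sd (u i)) (fun i => logistic_itv (u i)).
- move=> i; rewrite /Y; under eq_integral do rewrite EFinM.
  by rewrite integralZl ?bridge_mean ?mule0//; exact: gaussian_integrable (gB _).
- have product (i j : 'I_n) : (i <= j)%N ->
      (\int[P]_w (Y i w * Y j w)%:E = (c i * c j * r i j)%:E)%E.
    move=> ij; have uij : u i <= u j by rewrite /u lerD2l ler_wpM2r// ler_nat.
    have e1 w : Y i w * Y j w = (c i * c j * (inv_sd (u i) * inv_sd (u j))) *
        (B (logistic (u i)) w * B (logistic (u j)) w).
      by rewrite /Y; ring.
    under eq_integral do rewrite e1 EFinM.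
    rewrite integralZl//; last exact: gaussian_mul_integrable (gB _) (gB _).
    rewrite bridge_product// -EFinM; congr _%:E.
    rewrite -(mulrA (c i * c j)) bridge_cov_log_odds//; congr (_ * _).
    rewrite /r distnEr// -expRM_natl natrB//; congr expR.
    by rewrite /u; field.
  move=> i j; have [ij|/ltnW ji] := leqP i j; first exact: product.
  under eq_integral do rewrite mulrC.
  by rewrite product// (mulrC (c j)) /r distnC.
Qed.

Let grid_event (la lb eta : R) N :=
  \bigcup_(j in [set j | (j <= N.+1)%N]) [set w | eta < std_bridge (grid la lb N j) w].

Let grid_bound (L eta : R) N : R :=
  2 * (phi eta / eta) + eta * L * phi (eta * (2 * expR (- (L / N.+1%:R / 2)) - 1)).

Let measurable_grid_event la lb eta N : measurable (grid_event la lb eta N).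
Proof.
apply: bigcup_measurable => j _.
have := measurable_std_bridge (grid la lb N j) measurableT (measurable_itv `]eta, +oo[).
rewrite setTI; congr measurable.
by apply/seteqP; split => w/=; rewrite in_itv/= andbT.
Qed.

(* The assumption on [N] gives [rho >= 1 / 2]; and [1 - rho <= h / 2], so the [N.+1] increments of the score add up to
   at most [eta * L] times a value of the density. *)
Let grid_event_le la lb eta N : la <= lb -> 0 < eta -> lb - la <= N.+1%:R ->
  (P (grid_event la lb eta N) <= (grid_bound (lb - la) eta N)%:E)%E.
Proof.
move=> lab eta0 LN; set L : R := lb - la in LN *; have L0 : 0 <= L by rewrite subr_ge0.
have N0 : 0 < N.+1%:R :> R by rewrite ltr0n.
pose h : R := L / N.+1%:R; have h0 : 0 <= h by rewrite divr_ge0.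
have h1 : h <= 1 by rewrite ler_pdivrMr// mul1r.
pose rho : R := expR (- (h / 2)).
have rho0 : 0 <= rho by exact: expR_ge0.
have rho1 : rho <= 1 by rewrite -[leRHS]expR0 ler_expR oppr_le0 divr_ge0.
have rhoh : 1 - rho <= h / 2 by have := expR_ge1Dx (- (h / 2)); rewrite -/rho; lra.
have rho2 : 1 / 2 <= rho by lra.
have rho01 : 0 <= rho <= 1 by rewrite rho0.
have mX j : measurable_fun setT (std_bridge (la + j%:R * h)) by exact: measurable_std_bridge.
have := chain_bound mX rho01 (std_bridge_chain la h0) eta0 rho2 N.+1.
rewrite (_ : ~` _ = grid_event la lb eta N); last first.
  have gE j : grid la lb N j = la + j%:R * h by rewrite /grid /h -/L; ring.
  apply/seteqP; split => w /=.
    move=> /existsNP[j /not_implyP[jN /negP]]; rewrite -ltNge => hj.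
    by exists j => //=; rewrite gE.
  by move=> [j /= jN]; rewrite gE ltNge => /negP hj H; apply/hj/H.
move/le_trans; apply; rewrite lee_fin /grid_bound -/h -/rho lerD2l.
rewrite mulrCA [leRHS]mulrC ler_wpM2l ?phi_ge0//.
rewrite (_ : L = N.+1%:R * h); last by rewrite /h mulrC divfK// gt_eqF.
have := ler_wpM2l (mulr_ge0 (ltW eta0) (ltW N0)) rhoh; lra.
Qed.

Let grid_bound_cvg L eta :
  grid_bound L eta N @[N --> \oo] --> 2 * (phi eta / eta) + eta * L * phi eta.
Proof.
apply: cvgD; first exact: cvg_cst.
apply: cvgMr.
have c0 : - (L / N.+1%:R / 2) @[N --> \oo] --> - (L * 0 / 2).
  by apply: cvgN; apply: cvgMl; apply: cvgMr; exact: cvg_harmonic.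
have c1 : eta * (2 * expR (- (L / N.+1%:R / 2)) - 1) @[N --> \oo] -->
    eta * (2 * expR (- (L * 0 / 2)) - 1).
  apply: cvgMr; apply: cvgB; last exact: cvg_cst.
  by apply: cvgMr; exact: (cvg_comp _ _ c0 (@continuous_expR R _)).
have e : eta * (2 * expR (- (L * 0 / 2)) - 1) = eta.
  by rewrite mulr0 mul0r oppr0 expR0; ring.
by have := cvg_comp _ _ c1 (@continuous_phi R _); rewrite e.
Qed.

(** The time change turns the supremum over [[a, b]] into one over [[la, lb]]; by continuity of the paths it is caught by
    fine grids.  Grids with fewer than [M] points are dropped, as [grid_event_le] asks for a small step. *)
Lemma bridge_sup_tail (a b eta : R) : 0 < a -> a < b -> b < 1 -> 0 < eta ->
  (P [set w | eta%:E < ereal_sup [set (B t w / Num.sqrt (t * (1 - t)))%:E | t in `[a, b]]]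
   <= ((2 / eta + eta * ln (b * (1 - a) / (a * (1 - b))))
        / Num.sqrt (2 * pi) * expR (- (eta ^+ 2 / 2)))%:E)%E.
Proof.
move=> a0 ab b1 eta0; have a1 := lt_trans ab b1; have b0 := lt_trans a0 ab.
pose la := ln (a / (1 - a)); pose lb := ln (b / (1 - b)).
have a1' : 0 < 1 - a by rewrite subr_gt0. have b1' : 0 < 1 - b by rewrite subr_gt0.
have LE : ln (b * (1 - a) / (a * (1 - b))) = lb - la.
  rewrite /lb /la -ln_div ?posrE ?divr_gt0//; congr ln; field.
  by rewrite !gt_eqF.
have logit_le (x y : R) : 0 < x -> x <= y -> y < 1 -> ln (x / (1 - x)) <= ln (y / (1 - y)).
  move=> x0 xy y1; have x1 := le_lt_trans xy y1.
  rewrite ler_ln ?posrE ?divr_gt0 ?subr_gt0// ?(lt_le_trans x0)//.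
  rewrite ler_pdivrMr ?subr_gt0// mulrAC ler_pdivlMr ?subr_gt0//; nra.
have lab : la <= lb by apply: logit_le => //; exact: ltW.
have -> : [set w | (eta%:E < ereal_sup [set (B t w / Num.sqrt (t * (1 - t)))%:E | t in `[a, b]])%E] =
    [set w | (eta%:E < ereal_sup [set (std_bridge s w)%:E | s in `[la, lb]])%E].
  apply/seteqP; split => w /= /lt_ereal_sup_ex[t]; rewrite /= in_itv/= => /andP[t1 t2] h;
    apply/lt_ereal_sup_ex.
    have t0 := lt_le_trans a0 t1; have t1' := le_lt_trans t2 b1.
    exists (ln (t / (1 - t))); first by rewrite /= in_itv/= !logit_le.
    by rewrite /std_bridge inv_sdE logistic_logit.
  exists (logistic t).
    rewrite /= in_itv/= -(logistic_logit a0 a1) -(logistic_logit b0 b1).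
    by rewrite !logistic_le.
  by move: h; rewrite /std_bridge inv_sdE.
have right_open w s : la <= s <= lb -> eta < std_bridge s w ->
    exists2 e : R, 0 < e & forall u, s <= u < s + e -> u <= lb -> eta < std_bridge u w.
  move=> _ hs; have : \forall u \near s, eta < std_bridge u w.
    exact: (cvgr_gt (std_bridge s w) (@continuous_std_bridge w s)).
  move=> /nbhs_ballP[e /= e0 he]; exists e => // u /andP[su ue] _; apply: he.
  by rewrite /ball/= distrC ger0_norm ?subr_ge0// ltrBlDl.
have mX t : la <= t <= lb -> measurable_fun setT (std_bridge t) by move=> _; exact: measurable_std_bridge.
pose M := Num.truncn (lb - la).
have shifted N : (lb - la) <= (N + M).+1%:R.
  apply: ltW; apply: lt_le_trans (truncnS_gt (lb - la)) _.
  by rewrite ler_nat ltnS leq_addl.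
have mG N : measurable (grid_event la lb eta (N + M)) by exact: measurable_grid_event.
apply: (@le_trans _ _ (P (eventually_in (fun N => grid_event la lb eta (N + M))))).
  apply: le_measure; rewrite ?inE.
  - exact: (measurable_right_open_sup lab mX right_open).
  - exact: measurable_eventually_in.
  - move=> w /= /lt_ereal_sup_ex[s]; rewrite /= in_itv/= => slab hs.
    have [K _ hK] := sup_grid_eventually lab right_open slab hs.
    by exists K => // N /= KN; apply: hK => /=; rewrite (leq_trans KN)// leq_addr.
have -> : (2 / eta + eta * ln (b * (1 - a) / (a * (1 - b)))) / Num.sqrt (2 * pi) *
    expR (- (eta ^+ 2 / 2)) = 2 * (phi eta / eta) + eta * (lb - la) * phi eta.
  by rewrite LE /phi; ring.
apply: (measure_eventually_in_le mG (fun N => grid_event_le lab eta0 (shifted N))).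
rewrite (@cvg_shiftn M R (grid_bound (lb - la) eta)).
exact: grid_bound_cvg.
Qed.

End bridge_in_log_odds.

Theorem proposition3p2 (R : realType) :
  [/\ (* (i) *)
      forall (d : measure_display) (T : measurableType d) (P : probability T R)
        (B : R -> {RV P >-> R}) (a b eta : R),
        brownian_bridge B -> 0 < a -> a < b -> b < 1 -> 0 < eta ->
        (P [set w | eta%:E <
              ereal_sup [set (B t w / Num.sqrt (t * (1 - t)))%:E
                        | t in `[a, b]]]
         <= ((2 / eta + eta * ln (b * (1 - a) / (a * (1 - b))))
              / Num.sqrt (2 * pi) * expR (- (eta ^+ 2 / 2)))%:E)%E,
      (* (ii) *)
      forall (d : measure_display) (T : measurableType d) (P : probability T R)
        (n : nat) (U : 'I_n -> {RV P >-> R}) (a b eta : R),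
        (0 < n)%N -> iid_uniform01 U ->
        0 < a -> a < b -> b < 1 -> 0 < eta ->
        (P [set w | eta%:E <
              ereal_sup [set (let F := ecdf (fun i => U i w) t in
                              n%:R * (F * ln (F / t)
                                      + (1 - F) * ln ((1 - F) / (1 - t))))%:E
                        | t in `[a, b]]]
         <= (2 * expR 1 * (eta * ln (b * (1 - a) / (a * (1 - b))) + 1)
              * expR (- eta))%:E)%E,
      (* (iii) *)
      forall (d : measure_display) (T : measurableType d) (P : probability T R)
        (n : nat) (U : 'I_n -> {RV P >-> R}) (K eta : R),
        (0 < n)%N -> iid_uniform01 U -> 1 < K -> 0 < eta ->
        (P [set w | eta%:E < BJ (fun i => U i w)]
         <= (22 * K * ln n%:R * (eta + 1) * expR (- eta)
              + 2 * n%:R `^ (1 - K))%:E)%E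
    & (* (iv) *)
      forall D : R, 2 < D -> exists C : R,
      forall (d : measure_display) (T : measurableType d) (P : probability T R)
        (n : nat) (U : 'I_n -> {RV P >-> R}) (eta : R),
        (3 <= n)%N -> iid_uniform01 U ->
        0 < eta -> Num.sqrt (D * ln (ln n%:R)) <= eta ->
        let S := [set w | (eta%:E <
              ereal_sup [set (Num.sqrt n%:R * ((ecdf (fun i => U i w) t - t)
                              / Num.sqrt (t * (1 - t))))%:E
                        | t in `]0%R, 1%R[])%E] in
        (P [set w | eta%:E < HC (fun i => U i w)] <= P S)%E
        /\ (P S <= (C / eta)%:E)%E ].
Proof.
split.
- by move=> d T P B a b eta bridge; exact: bridge_sup_tail.
- move=> d T P n U a b eta n0 iidU a0 ab b1 eta0.
  exact: (berk_jones_sup n0 iidU a0 ab b1 eta0).2.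
- by move=> d T P n U K eta n0 iidU; exact: berk_jones_tail.
- move=> D D2; have [C hC] := std_sup_tail D2; exists C.
  move=> d T P n U eta n3 iidU eta0 hD S; split.
    by apply: HC_le_std_sup => //; exact: ltn_trans n3.
  exact: hC n3 iidU eta0 hD.
Qed.
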